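(* Suppose the local model $(\widetilde W,\omega_{can},S)$ admits a compatible holomorphic 2-form $\Omega$. Then: 1) the semi-global invariant $S$ is harmonic; 2) the action integrals of $\Omega$ have the form $$Z_{\gamma_m}=\frac1{2\pi}\bigl[c-c\ln c+(S+i\widetilde S)\bigr],\qquad Z_{\gamma_e}=c_2-ic_1=-ic,$$ where $\widetilde S$ is a harmonic conjugate of $S$ (so $S+i\widetilde S$ is holomorphic in $c$); 3) on $\widetilde W_0$ the holomorphic 2-form $\Omega$ is determined as $$\Omega=dZ_{\gamma_m}\wedge d\theta_{\gamma_e}+dZ_{\gamma_e}\wedge d\theta_{\gamma_m}+i\,h(c_1,c_2)\,dc_1\wedge dc_2,$$ where $h(c_1,c_2)$ is a smooth function, with the positive definite condition $S_1>\ln|c|$.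
   Context: Local model. Let $0<\epsilon<1$, $B=\{c=c_1+ic_2\in\mathbb C:|c|<\epsilon\}$, $B_0=B\setminus\{0\}$. Let $S:\mathbb R^2\to\mathbb R$ be smooth with $S(0)=0$ (the semi-global invariant), regarded as a function of $c=(c_1,c_2)$, and $S_i=\partial S/\partial c_i$. Let $W=\mathbb C^2$ with coordinates $(z_1,z_2)$, $\omega_{can}=\mathrm{Re}(dz_1\wedge dz_2)$, $\pi_{can}(z_1,z_2)=z_1z_2=c$, with Hamiltonian flows $\phi_1^t(z_1,z_2)=(e^tz_1,e^{-t}z_2)$, $\phi_2^t(z_1,z_2)=(e^{-it}z_1,e^{it}z_2)$ of $c_1,c_2$. Let $\Pi_1=\{(c,1):|c|<\epsilon\}$, $\Pi_2=\{(e^{S_1-iS_2},\,c\,e^{-S_1+iS_2}):|c|<\epsilon\}$. The space $\widetilde W$ is obtained from the part of $W$ over $B$ between the $\phi_2$-orbits $\phi_2(\Pi_1),\phi_2(\Pi_2)$ by gluing collar neighbourhoods of these orbits fibrewise via $\psi(z_1,z_2)=(e^{S_1(c)-iS_2(c)}z_2^{-1},\,e^{-S_1(c)+iS_2(c)}z_1z_2^2)$, $c=z_1z_2$. Fibres over $B_0$ are 2-tori, the central fibre is a pinched torus, and $\omega_{can}$ descends to $\widetilde W$. Put $\widetilde W_0=\pi_{can}^{-1}(B_0)$. Coordinates. $T(c;t_1,t_2)=(c\,e^{-t_1+it_2},e^{t_1-it_2})$ parametrizes $\widetilde W_0$ by $B_0\times\mathbb R^2$ modulo, over each $c$, the lattice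 $\langle (S_1-\ln|c|,S_2+\arg c),(0,2\pi)\rangle$. Action-angle coordinates of $\omega_{can}$ on $\widetilde W_0$ are $z_{\gamma_m}=\frac1{2\pi}[-\ln|c|c_1+\arg c\,c_2+c_1+S]$, $z_{\gamma_e}=c_2$, $\theta_{\gamma_e}=\frac{2\pi t_1}{S_1-\ln|c|}$, $\theta_{\gamma_m}=t_2-\frac{S_2+\arg c}{S_1-\ln|c|}t_1$, with $\omega_{can}=dz_{\gamma_m}\wedge d\theta_{\gamma_e}+dz_{\gamma_e}\wedge d\theta_{\gamma_m}$. Local branches of $\arg c$ and $\ln c=\ln|c|+i\arg c$ are fixed. Compatible holomorphic 2-form: a complex 2-form $\Omega$ on $\widetilde W$ such that (i) $\omega_{can}=\mathrm{Re}(\Omega)$; (ii) $d\Omega=0$, $\Omega\wedge\Omega=0$, $\Omega\wedge\overline\Omega>0$ (positivity with respect to the orientation $dc_1\wedge dc_2\wedge d\theta_{\gamma_m}\wedge d\theta_{\gamma_e}$ on $\widetilde W_0$); (iii) $\pi_{can}:\widetilde W\to B\subset\mathbb C$ is an elliptic fibration (holomorphic map) with respect to the complex structure $J_0$ determined by $\Omega$, i.e. the unique complex structure for which $\Omega$ is a holomorphic 2-form. Action integrals of $\Omega$: $Z_{\gamma}(c)=\frac1{2\pi}\int_\gamma\kappa$ for $\gamma=\gamma_m,\gamma_e$, where $\kappa$ is a 1-form near the fibre over $c$ with $d\kappa=\Omega$ and $\gamma_m,\gamma_e$ are the cycles whose action integrals for $\omega_{can}$ are $z_{\gamma_m},z_{\gamma_e}$.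 Additive constants are normalized so that $\mathrm{Re}(Z_{\gamma_m})=z_{\gamma_m}$, $\mathrm{Re}(Z_{\gamma_e})=z_{\gamma_e}$, and the imaginary additive constant of $Z_{\gamma_e}$ is chosen to be zero. *)

(* Defs.v *)
From HB Require Import structures.
From mathcomp Require Import all_boot all_order all_algebra.
From mathcomp Require Import complex.
From mathcomp Require Import all_classical all_reals all_analysis.
Set Implicit Arguments.
Unset Strict Implicit.
Unset Printing Implicit Defensive.
Import Order.TTheory GRing.Theory Num.Theory.
Import numFieldNormedType.Exports.
Local Open Scope classical_set_scope.
Local Open Scope ring_scope.

(* - C is identified with R^2 = 'rV[R]_2 by c = c1 + i c2, and C^2 with       *)
(*   R^4 = 'rV[R]_4 by (x1, y1, x2, y2), z_k = x_k + i y_k.                   *)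
(* - The coordinates (c, t) of the parametrization T are (c1, c2, t1, t2).    *)
(* - A complex-valued 1-form on R^n is the row of its coefficients; a 2-form  *)
(*   A is the alternating matrix with A x i j = A_x (e_i, e_j), so that       *)
(*   A_x (u, v) = u *m A x *m v^T on row vectors.                             *)
(* - Linear maps act on row vectors from the right, as in [jacobian].         *)

Section Forms.
Variable R : realType.

Definition cexp (w : R[i]) : R[i] :=
  ((expR (complex.Re w))%:C * (cos (complex.Im w) +i* sin (complex.Im w)))%C.

Definition pd n (i : 'I_n.+1) (f : 'rV[R]_n.+1 -> R) : 'rV[R]_n.+1 -> R :=
  fun x => 'D_(delta_mx 0 i) f x.

(* For an open U this is C^infinity on U: all iterated partial derivatives    *)
(* exist and are differentiable.                                              *)
Definition smooth_on n (U : set 'rV[R]_n.+1) (f : 'rV[R]_n.+1 -> R) : Prop :=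
  forall (s : seq 'I_n.+1) x, U x -> differentiable (foldr (@pd n) f s) x.

Definition csmooth_on n (U : set 'rV[R]_n.+1) (f : 'rV[R]_n.+1 -> R[i]) : Prop :=
  smooth_on U (fun x => complex.Re (f x)) /\
  smooth_on U (fun x => complex.Im (f x)).

Definition cpd n (i : 'I_n.+1) (f : 'rV[R]_n.+1 -> R[i]) (x : 'rV[R]_n.+1) : R[i] :=
  (pd i (fun y => complex.Re (f y)) x +i* pd i (fun y => complex.Im (f y)) x)%C.

Definition d0 n (f : 'rV[R]_n.+1 -> R[i]) (x : 'rV[R]_n.+1) : 'rV[R[i]]_n.+1 :=
  \row_i cpd i f x.

Definition d1 n (k : 'rV[R]_n.+1 -> 'rV[R[i]]_n.+1) (x : 'rV[R]_n.+1) :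
    'M[R[i]]_n.+1 :=
  \matrix_(i, j) (cpd i (fun y => k y 0 j) x - cpd j (fun y => k y 0 i) x).

Definition closed2_on n (U : set 'rV[R]_n.+1)
    (A : 'rV[R]_n.+1 -> 'M[R[i]]_n.+1) : Prop :=
  forall x i j k, U x ->
    cpd i (fun y => A y j k) x + cpd j (fun y => A y k i) x
      + cpd k (fun y => A y i j) x = 0.

Definition wedge11 n (a b : 'rV[R[i]]_n) : 'M[R[i]]_n := a^T *m b - b^T *m a.

(* The coefficient of dx0 /\ dx1 /\ dx2 /\ dx3 in A /\ B. *)
Definition wedge22 (A B : 'M[R[i]]_4) : R[i] :=
  A 0 1 * B 2 3 - A 0 2 * B 1 3 + A 0 3 * B 1 2
  + A 1 2 * B 0 3 - A 1 3 * B 0 2 + A 2 3 * B 0 1.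

Definition cmx m n (M : 'M[R]_(m, n)) : 'M[R[i]]_(m, n) :=
  map_mx (fun r : R => (r%:C)%C) M.

Definition conj_mx m n (M : 'M[R[i]]_(m, n)) : 'M[R[i]]_(m, n) :=
  map_mx (fun w : R[i] => w^*) M.

Definition pull1 n m (f : 'rV[R]_n.+1 -> 'rV[R]_m.+1)
    (k : 'rV[R]_m.+1 -> 'rV[R[i]]_m.+1) (x : 'rV[R]_n.+1) : 'rV[R[i]]_n.+1 :=
  k (f x) *m (cmx (jacobian f x))^T.

Definition pull2 n m (f : 'rV[R]_n.+1 -> 'rV[R]_m.+1)
    (A : 'rV[R]_m.+1 -> 'M[R[i]]_m.+1) (x : 'rV[R]_n.+1) : 'M[R[i]]_n.+1 :=
  cmx (jacobian f x) *m A (f x) *m (cmx (jacobian f x))^T.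

Definition line_integral n (k : 'rV[R]_n.+1 -> 'rV[R[i]]_n.+1)
    (g : R -> 'rV[R]_n.+1) : R[i] :=
  let v s : R[i] := (k (g s) *m (cmx (derive1 g s))^T) 0 0 in
  ((\int[lebesgue_measure]_(s in `[0, 1]) complex.Re (v s))
   +i* (\int[lebesgue_measure]_(s in `[0, 1]) complex.Im (v s)))%C.

Definition harmonic_on (U : set 'rV[R]_2) (f : 'rV[R]_2 -> R) : Prop :=
  smooth_on U f /\ forall c, U c -> pd 0 (pd 0 f) c + pd 1 (pd 1 f) c = 0.

(* Cauchy-Riemann: dF/dc2 = i dF/dc1. *)
Definition holomorphic_on (U : set 'rV[R]_2) (F : 'rV[R]_2 -> R[i]) : Prop :=
  forall c, U c ->
    [/\ differentiable (fun y => complex.Re (F y)) c,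
        differentiable (fun y => complex.Im (F y)) c
      & cpd 1 F c = 'i%C * cpd 0 F c].

Definition harmonic_conjugate (U : set 'rV[R]_2) (f g : 'rV[R]_2 -> R) : Prop :=
  harmonic_on U g /\ holomorphic_on U (fun c => f c +i* g c)%C.

(* J is an integrable almost complex structure on the open set U of R^n: the  *)
(* last clause is the vanishing of the Nijenhuis tensor, where                *)
(* J e_i = \sum_l J x i l e_l.                                                *)
Definition complex_structure_on n (U : set 'rV[R]_n.+1)
    (J : 'rV[R]_n.+1 -> 'M[R]_n.+1) : Prop :=
  [/\ forall i j, smooth_on U (fun x => J x i j),
      forall x, U x -> J x *m J x = - 1%:M
    & forall x i j k, U x ->
        \sum_l (J x i l * pd l (fun y => J y j k) x
                - J x j l * pd l (fun y => J y i k) x)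
        - \sum_l (pd i (fun y => J y j l) x - pd j (fun y => J y i l) x) * J x l k
        = 0].

End Forms.

Section LocalModel.
Variables (R : realType) (eps : R) (S : 'rV[R]_2 -> R).

Definition mk2 (a b : R) : 'rV[R]_2 := \row_(i < 2) [:: a; b]`_i.
Definition mkC2 (w1 w2 : R[i]) : 'rV[R]_4 :=
  \row_(i < 4) [:: complex.Re w1; complex.Im w1; complex.Re w2; complex.Im w2]`_i.
Definition mk4 (a b c d : R) : 'rV[R]_4 := \row_(i < 4) [:: a; b; c; d]`_i.

Definition toC (c : 'rV[R]_2) : R[i] := (c 0 0 +i* c 0 1)%C.

(* The Euclidean modulus; the library norm on 'rV is the sup norm. *)
Definition modulus (c : 'rV[R]_2) : R := Num.sqrt (c 0 0 ^+ 2 + c 0 1 ^+ 2).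

Definition disc : set 'rV[R]_2 := [set c | modulus c < eps].
Definition pdisc : set 'rV[R]_2 := disc `&` [set c | c != 0].

Definition z1 (z : 'rV[R]_4) : R[i] := (z 0 0 +i* z 0 1)%C.
Definition z2 (z : 'rV[R]_4) : R[i] := (z 0 2 +i* z 0 3)%C.
Definition picanC (z : 'rV[R]_4) : R[i] := z1 z * z2 z.
Definition pican (z : 'rV[R]_4) : 'rV[R]_2 :=
  mk2 (complex.Re (picanC z)) (complex.Im (picanC z)).

Definition omega_can (z : 'rV[R]_4) : 'M[R]_4 :=
  map_mx (@complex.Re R) (wedge11 (d0 z1 z) (d0 z2 z)).

Definition S1 : 'rV[R]_2 -> R := pd 0 S.
Definition S2 : 'rV[R]_2 -> R := pd 1 S.

Definition psi (z : 'rV[R]_4) : 'rV[R]_4 :=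
  let w : R[i] := (S1 (pican z) -i* S2 (pican z))%C in
  mkC2 (cexp w / z2 z) (cexp (- w) * z1 z * z2 z ^+ 2).

(* The glued space is encoded upstairs.  The part of C^2 over the disc lying  *)
(* between the two orbits, |z2| <= 1 and |z1| <= e^(S_1), is a fundamental    *)
(* domain for the identification z ~ psi z (z2 z != 0) on the preimage of the *)
(* disc, and psi (T (c, t)) = T (c, t - (S_1 - ln|c|, S_2 + arg c)), so psi   *)
(* also generates the first period of the lattice over a punctured disc.      *)
(* Thus the part of the glued space over V is (over V) modulo psi, and a      *)
(* tensor on it is a psi-invariant tensor on (over V).                        *)
Definition over (V : set 'rV[R]_2) : set 'rV[R]_4 := pican @^-1` V.

Definition one_form_over (V : set 'rV[R]_2) (k : 'rV[R]_4 -> 'rV[R[i]]_4) : Prop :=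
  (forall i, csmooth_on (over V) (fun z => k z 0 i)) /\
  (forall z, over V z -> z2 z != 0 -> pull1 psi k z = k z).

Definition two_form_over (V : set 'rV[R]_2) (A : 'rV[R]_4 -> 'M[R[i]]_4) : Prop :=
  [/\ forall i j, csmooth_on (over V) (fun z => A z i j),
      forall z, over V z -> (A z)^T = - A z
    & forall z, over V z -> z2 z != 0 -> pull2 psi A z = A z].

Definition complex_structure_over (V : set 'rV[R]_2)
    (J : 'rV[R]_4 -> 'M[R]_4) : Prop :=
  complex_structure_on (over V) J /\
  (forall z, over V z -> z2 z != 0 ->
     J z *m jacobian psi z = jacobian psi z *m J (psi z)).

Definition base (x : 'rV[R]_4) : 'rV[R]_2 := mk2 (x 0 0) (x 0 1).

Definition T (x : 'rV[R]_4) : 'rV[R]_4 :=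
  mkC2 (toC (base x) * cexp (- x 0 2 +i* x 0 3)%C) (cexp (x 0 2 -i* x 0 3)%C).

(* A continuous branch of the argument on a domain D of the punctured disc. *)
Definition arg_branch (D : set 'rV[R]_2) (arg : 'rV[R]_2 -> R) : Prop :=
  [/\ open D, connected D, D `<=` pdisc
    & forall c, D c ->
        {for c, continuous arg} /\
        toC c = ((modulus c)%:C * (cos (arg c) +i* sin (arg c)))%C].

Section Branch.
Variable arg : 'rV[R]_2 -> R.

Definition Ln (c : 'rV[R]_2) : R[i] := (ln (modulus c) +i* arg c)%C.

Definition per1 (c : 'rV[R]_2) : R := S1 c - ln (modulus c).
Definition per2 (c : 'rV[R]_2) : R := S2 c + arg c.

Definition z_gm (c : 'rV[R]_2) : R :=
  (2 * pi)^-1 * (- ln (modulus c) * c 0 0 + arg c * c 0 1 + c 0 0 + S c).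
Definition z_ge (c : 'rV[R]_2) : R := c 0 1.

Definition theta_ge (x : 'rV[R]_4) : R := 2 * pi * x 0 2 / per1 (base x).
Definition theta_gm (x : 'rV[R]_4) : R :=
  x 0 3 - per2 (base x) / per1 (base x) * x 0 2.

(* The differentials of the coordinates, on the (c, t)-space. *)
Definition dc1 : 'rV[R]_4 -> 'rV[R[i]]_4 := d0 (fun x => ((x 0 0)%:C)%C).
Definition dc2 : 'rV[R]_4 -> 'rV[R[i]]_4 := d0 (fun x => ((x 0 1)%:C)%C).
Definition dtheta_ge : 'rV[R]_4 -> 'rV[R[i]]_4 := d0 (fun x => ((theta_ge x)%:C)%C).
Definition dtheta_gm : 'rV[R]_4 -> 'rV[R[i]]_4 := d0 (fun x => ((theta_gm x)%:C)%C).

(* The cycles of the fibre over c: along gamma_m theta_ge runs from 0 to      *)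
(* 2 pi with theta_gm fixed, along gamma_e the converse.  Since               *)
(* omega_can = d (z_gm dtheta_ge + z_ge dtheta_gm), the action integrals of   *)
(* omega_can along them are z_gm and z_ge.                                    *)
Definition gamma_m (c : 'rV[R]_2) (s : R) : 'rV[R]_4 :=
  T (mk4 (c 0 0) (c 0 1) (s * per1 c) (s * per2 c)).
Definition gamma_e (c : 'rV[R]_2) (s : R) : 'rV[R]_4 :=
  T (mk4 (c 0 0) (c 0 1) 0 (s * (2 * pi))).

Definition Z_gm (St : 'rV[R]_2 -> R) (c : 'rV[R]_2) : R[i] :=
  (((2 * pi)^-1)%:C * (toC c - toC c * Ln c + (S c +i* St c)))%C.
Definition Z_ge (c : 'rV[R]_2) : R[i] := - 'i%C * toC c.

End Branch.

(* The primitive k of Omega near a fibre is unique up to a closed 1-form, so  *)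
(* Z is determined up to a locally constant function; hence the constant a.   *)
Definition action_integral (Omega : 'rV[R]_4 -> 'M[R[i]]_4)
    (gamma : 'rV[R]_2 -> R -> 'rV[R]_4) (D : set 'rV[R]_2)
    (Z : 'rV[R]_2 -> R[i]) : Prop :=
  forall c0, D c0 ->
    exists V (k : 'rV[R]_4 -> 'rV[R[i]]_4) (a : R[i]),
      [/\ open V, V c0, V `<=` D, one_form_over V k
        & (forall z, over V z -> d1 k z = Omega z) /\
          (forall c, V c ->
             Z c = a + (((2 * pi)^-1)%:C)%C * line_integral k (gamma c))].

(* For a closed form of type (2,0) on a complex surface, being holomorphic is *)
(* automatic; the first clause expresses type (2,0): Omega (J u, v) =         *)
(* i Omega (u, v).  The second is holomorphy of the projection:               *)
(* d pi (J u) = i d pi (u).                                                   *)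
Definition holomorphic_fibration (Omega : 'rV[R]_4 -> 'M[R[i]]_4)
    (J : 'rV[R]_4 -> 'M[R]_4) : Prop :=
  forall z, over disc z ->
    cmx (J z) *m Omega z = 'i%C *: Omega z /\
    cmx (J z) *m (d0 picanC z)^T = 'i%C *: (d0 picanC z)^T.

(* Omega /\ conj Omega is a volume form, positive over the punctured disc for *)
(* the orientation dc1 /\ dc2 /\ dtheta_gm /\ dtheta_ge; both sides are       *)
(* compared in the coordinates (c, t).                                        *)
Definition positive_form (Omega : 'rV[R]_4 -> 'M[R[i]]_4) : Prop :=
  (forall z, over disc z -> wedge22 (Omega z) (conj_mx (Omega z)) != 0) /\
  (forall D arg, arg_branch D arg -> forall x, D (base x) ->
     exists2 f : R, 0 < f &
       wedge22 (pull2 T Omega x) (conj_mx (pull2 T Omega x))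
       = (f%:C)%C * wedge22 (wedge11 (dc1 x) (dc2 x))
                            (wedge11 (dtheta_gm arg x) (dtheta_ge x))).

Definition compatible (Omega : 'rV[R]_4 -> 'M[R[i]]_4) : Prop :=
  [/\ two_form_over disc Omega,
      forall z, over disc z -> map_mx (@complex.Re R) (Omega z) = omega_can z,
      [/\ closed2_on (over disc) Omega,
          forall z, over disc z -> wedge22 (Omega z) (Omega z) = 0
        & positive_form Omega]
    & exists J0, complex_structure_over disc J0 /\ holomorphic_fibration Omega J0].

End LocalModel.

(* Main.v *)
(** Where z2 <> 0, the conditions Re Omega = omega_can, type (2,0) and holomorphy
    of pi force Omega = dz1 /\ dz2 + i H dc1 /\ dc2, and d Omega = 0 makes the
    real function H constant on the fibres.  Comparing Omega with its pull-back by
    psi along the section (c, 1) then leaves d(S_1 - i S_2) /\ dc = 0, i.e. S is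
    harmonic.  Pulling back by T gives dc /\ dtau + i h dc1 /\ dc2 with
    tau = t1 - i t2; positivity is the sign of the period S_1 - ln|c|, and the
    action-angle expression is a rewriting of dc /\ dtau.  Finally, by Stokes'
    formula on the strip swept by the cycle, the boundary terms cancelling by
    psi-invariance of the primitive, d Z_gamma_m = (2 pi)^-1 (period) dc, which
    determines Im Z up to a constant absorbed in the harmonic conjugate. *)
Require Import Defs.
From HB Require Import structures.
From mathcomp Require Import all_boot all_order all_algebra.
From mathcomp Require Import complex.
From mathcomp Require Import all_classical all_reals all_analysis.
From mathcomp Require Import ring lra.
Import Order.TTheory GRing.Theory Num.Theory.
Import numFieldNormedType.Exports.
Local Open Scope classical_set_scope.
Local Open Scope ring_scope.
Set Implicit Arguments.
Unset Strict Implicit.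
Unset Printing Implicit Defensive.
Local Notation over := Defs.over.

(** * Directional derivatives on row vectors *)

Section Calculus.
Variable R : realType.

(** The chart [T] covers exactly the points with z2 <> 0, so the points with z2 = 0, the pinched
    point among them, lie outside it. The description of Omega is therefore proved where z2 <> 0,
    and two statements must cross c = 0 separately. Smoothness of h is read off on the section (c,
    1), which stays in the region z2 <> 0 even over c = 0. The image of that section under psi has
    z2 = c e^(-S_1 + i S_2), so harmonicity is compared over the punctured disc and reaches the
    origin by continuity. The real part of the same comparison yields the symmetry of the second
    derivatives of S. Smoothness is built on full differentials, whereas integrals are
    differentiated one direction at a time: curves and integrals are restricted to lines, and the
    C^1 criterion [differentiable_pd] returns from directional derivatives to differentiability. One
    Stokes lemma, [derive_line_family], serves twice: along radii to construct the harmonic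
    conjugate, and along the cycles to differentiate the imaginary parts of the actions, the real
    parts being fixed by the normalization. *)

Lemma derive1_line (V W : normedModType R) (f : V -> W) x v df :
  is_derive x v f df <-> is_derive (0 : R) 1 (fun h : R => f (h *: v + x)) df.
Proof.
have E : 'D_v f x = 'D_(1 : R) (fun h : R => f (h *: v + x)) 0.
  rewrite /derive; apply: (congr1 (fun u : R -> W => lim (u @ 0^'))).
  apply: funext => h /=.
  by rewrite scale0r add0r scaler1 addr0.
have [D1 D2] := @derivable1P R V W f x v.
split=> -[dd e].
  by apply: DeriveDef; [exact: D1|rewrite -E].
by apply: DeriveDef; [exact: D2|rewrite E].
Qed.

Lemma is_derive_line (V W : normedModType R) (f : V -> W) x v (h : R) df :
  is_derive (h *: v + x) v f df ->
  is_derive h 1 (fun k : R => f (k *: v + x)) df.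
Proof.
move=> /derive1_line D.
have E : (fun k : R => f (k *: v + (h *: v + x))) =
    (fun k : R => (fun k : R => f (k *: v + x)) (k *: 1 + h)).
  by apply: funext => k; rewrite /= [k *: 1]mulr1 scalerDl addrA.
have [_ D2] := @derive1_line R W (fun k : R => f (k *: v + x)) h 1 df.
by apply: D2; rewrite -E.
Qed.

(** Only derivability of [g] along [v] is assumed. Restricted to the line through [x] it becomes
    differentiability in one real variable, where the chain rule applies. *)
Lemma is_derive_comp_diff (V W W' : normedModType R) (f : W -> W') (g : V -> W)
    x v dg :
  is_derive x v g dg -> differentiable f (g x) ->
  is_derive x v (f \o g) ('d f (g x) dg).
Proof.
move=> /derive1_line dG df; apply/derive1_line.
set G := fun h : R => g (h *: v + x).
have G0 : G 0 = g x by rewrite /G scale0r add0r.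
have dG' : differentiable G 0 by apply/derivable1_diffP; case: dG.
have dfG : differentiable f (G 0) by rewrite G0.
have dd : differentiable (f \o G) 0 by exact: differentiable_comp.
change (is_derive (0 : R) 1 (f \o G) ('d f (g x) dg)).
split; first exact: diff_derivable.
rewrite deriveE// diff_comp//= G0.
by rewrite -(deriveE _ dG') derive_val.
Qed.

Lemma derive_pd n (f : 'rV[R]_n.+1 -> R) x v :
  differentiable f x -> 'D_v f x = \sum_i v 0 i * pd i f x.
Proof.
move=> df; rewrite deriveE// {1}(row_sum_delta v) linear_sum/=.
by apply: eq_bigr => i _; rewrite linearZ/= /pd deriveE.
Qed.

Lemma is_derive_row n (V : normedModType R) (g : V -> 'rV[R]_n) x v (dg : 'rV[R]_n) :
  (forall i, is_derive x v (fun y => g y 0 i) (dg 0 i)) -> is_derive x v g dg.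
Proof.
move=> h.
have D : derivable g x v.
  by apply/derivable_mxP => i j; rewrite ord1; case: (h j).
split=> //; rewrite derive_mx//; apply/rowP => j; rewrite !mxE.
by case: (h j).
Qed.

Lemma is_derive_coord n (V : normedModType R) (g : V -> 'rV[R]_n) x v (dg : 'rV[R]_n) i :
  is_derive x v g dg -> is_derive x v (fun y => g y 0 i) (dg 0 i).
Proof.
move=> [D <-]; have Di := (@derivable_mxP _ _ _ _ g x v).1 D 0 i.
by rewrite derive_mx// !mxE; exact/derivableP.
Qed.

Lemma differentiable_row n (V : normedModType R) (g : V -> 'rV[R]_n) x :
  (forall i, differentiable (fun y => g y 0 i) x) -> differentiable g x.
Proof.
move=> h.
have -> : g = \sum_(i < n) (fun y => g y 0 i *: delta_mx 0 i).
  by apply/funext => y; rewrite {1}(row_sum_delta (g y)) fct_sumE.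
by apply: differentiable_sum => i; exact: differentiableZl.
Qed.

Lemma is_derive_comp_row n (V : normedModType R) (f : 'rV[R]_n.+1 -> R)
    (g : V -> 'rV[R]_n.+1) x v (dg : 'I_n.+1 -> R) :
  (forall i, is_derive x v (fun y => g y 0 i) (dg i)) ->
  differentiable f (g x) ->
  is_derive x v (fun y => f (g y)) (\sum_i dg i * pd i f (g x)).
Proof.
move=> h df.
have hg : is_derive x v g (\row_i dg i).
  by apply: is_derive_row => i; rewrite mxE.
have := is_derive_comp_diff hg df.
rewrite -deriveE// derive_pd//.
by under eq_bigr do rewrite mxE.
Qed.

Lemma jacobianE n m (f : 'rV[R]_n.+1 -> 'rV[R]_m.+1) x i j :
  differentiable f x -> jacobian f x i j = pd i (fun y => f y 0 j) x.
Proof.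
move=> df; have := deriveEjacobian (delta_mx 0 i) df.
rewrite -rowE => /(congr1 (fun M : 'rV_m.+1 => M 0 j)); rewrite mxE => <-.
have D := @diff_derivable _ _ _ _ _ (delta_mx 0 i) df.
by rewrite derive_mx// mxE.
Qed.

Lemma is_derive_pd n (f : 'rV[R]_n.+1 -> R) x i df :
  is_derive x (delta_mx 0 i) f df -> pd i f x = df.
Proof. by case. Qed.

Lemma is_derive_jacobian n m (V : normedModType R) (f : 'rV[R]_n.+1 -> 'rV[R]_m.+1)
   (g : V -> 'rV[R]_n.+1) x v (dg : 'rV[R]_n.+1) j :
  is_derive x v g dg -> differentiable f (g x) ->
  is_derive x v (fun y => f (g y) 0 j) (\sum_i dg 0 i * jacobian f (g x) i j).
Proof.
move=> hg df.
have := is_derive_coord j (is_derive_comp_diff hg df).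
rewrite -deriveE// deriveEjacobian// mxE.
by [].
Qed.

Lemma near_pd n (f g : 'rV[R]_n.+1 -> R) x i :
  (\near x, f x = g x) -> pd i f x = pd i g x.
Proof. by move=> h; apply: near_eq_derive; rewrite ?delta_mx_eq0. Qed.

Lemma eq_on_foldr_pd n (f g : 'rV[R]_n.+1 -> R) (U : set 'rV[R]_n.+1) s :
  open U -> (forall x, U x -> f x = g x) ->
  forall x, U x -> foldr (@pd R n) f s x = foldr (@pd R n) g s x.
Proof.
move=> oU fg; elim: s => //= i s IH x Ux.
by apply: near_pd; apply: filterS (open_nbhs_nbhs (conj oU Ux)); exact: IH.
Qed.

(** A differential sees only first-order behaviour, so that of [g] at [x] also serves for [f]. *)
Lemma differentiable_approx (V W : normedModType R) (f g : V -> W) x :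
  differentiable g x ->
  (forall e, 0 < e -> \forall y \near x,
     `|f y - f x - (g y - g x)| <= e * `|y - x|) ->
  differentiable f x.
Proof.
move=> dg fg.
have [cg eg] : continuous ('d g x) /\
    g = cst (g x) + 'd g x \o center x +o_x (center x).
  by case: dg; rewrite lim_id.
apply/diffP => /=.
(* ['d f x] is a chosen value: it has the two required properties as soon as some linear map has
   them, here the differential of [g]. *)
apply: (@getPex _ (fun (df : {linear V -> W}) => continuous df /\
  forall y, f y = f (lim (nbhs x)) + df (y - lim (nbhs x))
                  +o_(y \near x) (y - lim (nbhs x)))).
exists ('d g x); split => //; rewrite lim_id//.
suff E : f = cst (f x) + 'd g x \o center x +o_x (center x).
  by move=> y; rewrite {1}E.
apply/eqaddoP => e e0.
have /eqaddoP /(_ (e / 2)) := eg; rewrite divr_gt0// => /(_ isT) G.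
have F := fg (e / 2) (divr_gt0 e0 (ltr0Sn R 1)).
near=> y.
have Gy : `|(g - (cst (g x) + 'd g x \o center x)) y| <= e / 2 * `|center x y| by near: y.
have Fy : `|f y - f x - (g y - g x)| <= e / 2 * `|y - x| by near: y.
rewrite [e]splitr mulrDl.
have -> : (f - (cst (f x) + 'd g x \o center x)) y
   = (f y - f x - (g y - g x)) + (g - (cst (g x) + 'd g x \o center x)) y.
  have aux (a b d p q : W) : a - (b + d) = (a - b - (p - q)) + (p - (q + d)).
    by rewrite (opprD b d) (opprD q d) (addrA a) (addrA p) addrA subrK.
  exact: aux.
exact: le_trans (ler_normD _ _) (lerD Fy Gy).
Unshelve. all: by end_near. Qed.

Lemma near_differentiable (V W : normedModType R) (f g : V -> W) x :
  (\near x, f x = g x) -> differentiable f x -> differentiable g x.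
Proof.
move=> fg df; apply: (differentiable_approx df) => e e0.
have fgx : f x = g x by exact: nbhs_singleton fg.
apply: filterS fg => y ->; rewrite fgx subrr normr0.
by rewrite mulr_ge0// ltW.
Qed.

(** An iterated partial derivative differentiates first along the last index of the sequence, so
    splitting that index off leaves an iterated partial of a function already known to be smooth. *)
Lemma smooth_on_pd n (f : 'rV[R]_n.+1 -> R) (U : set 'rV[R]_n.+1) :
  open U -> (forall x, U x -> differentiable f x) ->
  (forall i, exists g, smooth_on U g /\ forall x, U x -> pd i f x = g x) ->
  smooth_on U f.
Proof.
move=> oU df H; elim/last_ind => [|s i _] x Ux; first exact: df.
rewrite foldr_rcons; have [g [sg gE]] := H i.
apply: (near_differentiable _ (sg s x Ux)).
apply: filterS (open_nbhs_nbhs (conj oU Ux)) => y Uy.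
by rewrite (eq_on_foldr_pd s oU gE Uy).
Qed.

Lemma smooth_onN n (f : 'rV[R]_n.+1 -> R) (U : set 'rV[R]_n.+1) :
  open U -> smooth_on U f -> smooth_on U (fun x => - f x).
Proof.
move=> oU sf; have E : forall s x, U x ->
    foldr (@pd R n) (fun x => - f x) s x = - foldr (@pd R n) f s x.
  elim => //= i s IH x Ux.
  rewrite (@near_pd _ _ (fun x => - foldr (@pd R n) f s x)).
    by rewrite /pd deriveN//; apply: diff_derivable; exact: sf.
  by apply: filterS (open_nbhs_nbhs (conj oU Ux)); exact: IH.
move=> s x Ux.
apply: (@near_differentiable _ _ (fun x => - foldr (@pd R n) f s x)).
  by apply: filterS (open_nbhs_nbhs (conj oU Ux)) => y /E ->.
by apply: differentiableN; exact: sf.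
Qed.

Lemma smooth_on_differentiable n (f : 'rV[R]_n.+1 -> R) (U : set 'rV[R]_n.+1) x :
  smooth_on U f -> U x -> differentiable f x.
Proof. by move=> /(_ [::]); apply. Qed.

Lemma smooth_on_pdr n (f : 'rV[R]_n.+1 -> R) (U : set 'rV[R]_n.+1) i :
  smooth_on U f -> smooth_on U (pd i f).
Proof. by move=> sf s x Ux; rewrite -foldr_rcons; exact: sf. Qed.

(** The C^1 criterion. Since all directional derivatives near [x] are given, one application of the
    mean value theorem on the segment from [x] to [y] suffices, and continuity of the [a i] controls
    the error. *)
Lemma differentiable_pd n (f : 'rV[R]_n.+1 -> R) (a : 'I_n.+1 -> 'rV[R]_n.+1 -> R)
    (x : 'rV[R]_n.+1) :
  (\forall y \near x, forall v, is_derive y v f (\sum_i v 0 i * a i y)) ->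
  (forall i, {for x, continuous (a i)}) ->
  differentiable f x.
Proof.
move=> fa ca.
apply: (@differentiable_approx 'rV[R]_n.+1 R f
  (fun y : 'rV[R]_n.+1 => \sum_i a i x * y 0 i)).
  have -> : (fun y : 'rV[R]_n.+1 => \sum_i a i x * y 0 i) =
      \sum_i (a i x *: (fun y : 'rV[R]_n.+1 => y 0 i)).
    by apply/funext => y; rewrite fct_sumE.
  apply: differentiable_sum => i; apply: differentiableZ.
  exact: differentiable_coord.
move=> e e0.
(* Each of the n + 1 coordinates may contribute [d * |y - x|] to the error. *)
pose d := e / n.+1%:R.
have d0 : 0 < d by rewrite divr_gt0// ltr0n.
have ca' : \forall y \near x, forall i, `|a i y - a i x| <= d.
  apply: (@filter_forall _ _ (fun i y => is_true (`|a i y - a i x| <= d)) (nbhs x)).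
  by move=> i; have /cvgrPdistC_le := ca i; apply.
have [r r0 rP] : exists2 r : R, 0 < r & forall y, ball x r y ->
   (forall v, is_derive y v f (\sum_i v 0 i * a i y)) /\
   (forall i, `|a i y - a i x| <= d).
  have [r /= r0 rP] := (nbhs_ballP x _).1 (filterI fa ca').
  by exists r => // y /rP.
near=> y.
have xy : ball x r y by near: y; exact: nbhsx_ballx.
pose F (h : R) := f (h *: (y - x) + x).
have bh (h : R) : h \in `[0, 1] -> ball x r (h *: (y - x) + x).
  rewrite in_itv/= => /andP[h0 h1].
  move: xy; rewrite -!ball_normE/= opprD addrCA subrr addr0 normrN normrZ => xy.
  rewrite ger0_norm//; apply: le_lt_trans (_ : `|y - x| < r).
    by rewrite ler_piMl.
  by rewrite distrC.
have dF (h : R) : h \in `[0, 1] ->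
   is_derive h 1 F (\sum_i (y - x) 0 i * a i (h *: (y - x) + x)).
  move=> h01; have [/(_ (y - x)) D _] := rP _ (bh _ h01).
  exact: is_derive_line.
have [h h01] : exists2 h : R, h \in `[0, 1]%R &
    F 1 - F 0 = \sum_i (y - x) 0 i * a i (h *: (y - x) + x) * (1 - 0).
  have [h h01 E] := @MVT_segment R F
     (fun h : R => \sum_i (y - x) 0 i * a i (h *: (y - x) + x)) 0 1 ler01
     (fun h hi => dF h (subset_itv_oo_cc hi))
     (@derivable_within_continuous _ _ F `[0, 1] (fun h hi => @ex_derive _ _ _ _ _ _ _ (dF h hi))).
  by exists h => //; rewrite -mulr_suml.
rewrite /F scale1r scale0r add0r subrK subr0 => ->.
rewrite -sumrB -sumrB.
apply: le_trans (ler_norm_sum _ _ _) _.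
apply: le_trans (_ : \sum_(i < n.+1) d * `|y - x| <= _); last first.
  rewrite sumr_const card_ord -mulr_natl mulrA /d mulrCA divff ?pnatr_eq0//.
  by rewrite mulr1.
apply: ler_sum => i _.
have -> : (y - x) 0 i * a i (h *: (y - x) + x) * 1 - (a i x * y 0 i - a i x * x 0 i)
  = (a i (h *: (y - x) + x) - a i x) * (y - x) 0 i by rewrite !mxE; ring.
rewrite normrM ler_pM//; first by have [_] := rP _ (bh _ h01); apply.
rewrite [leRHS]/Num.Def.normr/= mx_normrE.
exact: (le_bigmax _ (fun ij => `|(y - x) ij.1 ij.2|) (0, i)).
Unshelve. all: by end_near. Qed.

End Calculus.

(** * Differentiation rules for real-valued functions in pointwise form *)

Section ScalarRules.
Variables (R : realType) (V : normedModType R).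
Implicit Types (f g : V -> R) (x v : V).

Lemma is_derive_eqr f x v df df' : is_derive x v f df' -> df' = df -> is_derive x v f df.
Proof. by move=> h <-. Qed.

Lemma is_derive_constr (c : R) x v : is_derive x v (fun=> c) 0.
Proof. exact: is_derive_cst. Qed.

Lemma is_deriveDr f g x v df dg : is_derive x v f df -> is_derive x v g dg ->
  is_derive x v (fun y => f y + g y) (df + dg).
Proof. by move=> hf hg; exact: is_deriveD. Qed.

Lemma is_deriveBr f g x v df dg : is_derive x v f df -> is_derive x v g dg ->
  is_derive x v (fun y => f y - g y) (df - dg).
Proof. by move=> hf hg; exact: is_deriveB. Qed.

Lemma is_deriveNr f x v df : is_derive x v f df ->
  is_derive x v (fun y => - f y) (- df).
Proof. by move=> hf; exact: is_deriveN. Qed.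

Lemma is_deriveMr f g x v df dg : is_derive x v f df -> is_derive x v g dg ->
  is_derive x v (fun y => f y * g y) (f x * dg + g x * df).
Proof. by move=> hf hg; exact: is_deriveM. Qed.

Lemma is_derive_compr (F : R -> R) f x v df dF : is_derive (f x) 1 F dF ->
  is_derive x v f df -> is_derive x v (fun y => F (f y)) (df * dF).
Proof.
move=> [dF1 dF2] hf.
have D : differentiable F (f x) by apply/derivable1_diffP.
have := is_derive_comp_diff hf D.
suff -> : df * dF = 'd F (f x) df by [].
have L : 'd F (f x) (df *: (1 : R)) = df *: 'd F (f x) (1 : R) by rewrite linearZ.
rewrite -dF2 deriveE//; transitivity ('d F (f x) (df *: (1 : R))).
  by rewrite L.
by rewrite [df *: _]mulr1.
Qed.

Lemma is_derive_expRr f x v df : is_derive x v f df ->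
  is_derive x v (fun y => expR (f y)) (df * expR (f x)).
Proof. by apply: is_derive_compr; exact: is_derive_expR. Qed.

Lemma is_derive_cosr f x v df : is_derive x v f df ->
  is_derive x v (fun y => cos (f y)) (df * - sin (f x)).
Proof. by apply: is_derive_compr; exact: is_derive_cos. Qed.

Lemma is_derive_sinr f x v df : is_derive x v f df ->
  is_derive x v (fun y => sin (f y)) (df * cos (f x)).
Proof. by apply: is_derive_compr; exact: is_derive_sin. Qed.

Lemma is_derive_lnr f x v df : 0 < f x -> is_derive x v f df ->
  is_derive x v (fun y => ln (f y)) (df * (f x)^-1).
Proof. by move=> f0; apply: is_derive_compr; exact: is_derive1_ln. Qed.

Lemma is_derive_atanr f x v df : is_derive x v f df ->
  is_derive x v (fun y => atan (f y)) (df * (1 + f x ^+ 2)^-1).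
Proof. by apply: is_derive_compr; exact: is_derive1_atan. Qed.

Lemma is_deriveVr f x v df : f x != 0 -> is_derive x v f df ->
  is_derive x v (fun y => (f y)^-1) (df * - (f x) ^- 2).
Proof.
move=> f0; apply: is_derive_compr.
apply: DeriveDef; first exact: (@derivableV _ _ id).
by rewrite (@deriveV _ _ id)// derive_id [_ *: _]mulr1.
Qed.

Lemma is_deriveXr f n x v df : is_derive x v f df ->
  is_derive x v (fun y => f y ^+ n) (n%:R * f x ^+ n.-1 * df).
Proof.
move=> hf; apply: (is_derive_eqr (df' := (n%:R * f x ^+ n.-1) *: df)) => //.
have -> : (fun y => f y ^+ n) = f ^+ n by apply: funext => y; rewrite exprfctE.
exact: is_deriveX.
Qed.

End ScalarRules.

Lemma is_derive_coordr (R : realType) n (x v : 'rV[R]_n) i :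
  is_derive x v (fun y : 'rV[R]_n => y 0 i) (v 0 i).
Proof. exact: (is_derive_coord i (is_derive_id x v)). Qed.

Lemma is_derive_idr (R : realType) (x v : R) : is_derive x v (fun y => y) v.
Proof. exact: is_derive_id. Qed.

(** The derivative is synthesized from the shape of the function, and what remains is the algebraic
    identity between it and the announced value. *)
Ltac der := eapply is_derive_eqr;
  [ repeat first [ eassumption | eapply is_derive_constr | eapply is_derive_idr
    | eapply is_derive_coordr | eapply is_deriveDr | eapply is_deriveBr
    | eapply is_deriveNr | eapply is_deriveMr | eapply is_deriveXr
    | eapply is_derive_expRr | eapply is_derive_cosr | eapply is_derive_sinr
    | eapply is_derive_atanr ] | cbv beta ].

(** * Differentiation under the integral sign *)

Section Transgression.
Variable R : realType.
Local Notation mu := (@lebesgue_measure R).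

Lemma pair_continuousr (a s : R) : {for s, continuous (fun s : R => (a, s))}.
Proof.
move=> A [[P Q] /= [Pa Qs] PQ]; apply: filterS Qs => t Qt; apply: PQ.
by split => //; exact: nbhs_singleton.
Qed.

(** Dominated convergence, with a constant as dominating function. Joint continuity is required only
    on the slice u = a, because compactness of [0, 1] spreads the bound to nearby u. *)
Lemma is_derive_Rintegral (f df : R -> R -> R) (a : R) :
  (\forall u \near a, forall s : R, 0 <= s <= 1 -> is_derive (u : R) 1 (f ^~ s) (df u s)) ->
  (\forall u \near a, forall s : R, 0 <= s <= 1 -> {for s, continuous (f u)}) ->
  (forall s : R, 0 <= s <= 1 -> {for (a, s), continuous (fun p : R * R => df p.1 p.2)}) ->
  is_derive a 1 (fun u => \int[mu]_(s in `[0, 1]) f u s)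
     (\int[mu]_(s in `[0, 1]) df a s).
Proof.
move=> Hd Hc Hj.
have cdf s : 0 <= s <= 1 -> {for s, continuous (df a)}.
  move=> s01; apply: (@continuous_comp _ _ _ (fun s : R => (a, s))
    (fun p : R * R => df p.1 p.2) s _ (Hj s s01)).
  exact: pair_continuousr.
have c01 : compact (`[0, 1]%classic : set R) by exact: segment_compact.
have [M HM] : exists M, forall s : R, 0 <= s <= 1 -> `|df a s| <= M.
  have cn : {within `[0, 1], continuous (fun s => `|df a s|)}.
    apply/continuous_in_subspaceT => s; rewrite inE/= in_itv/= => s01.
    by apply: continuous_comp (cdf s s01) _; exact: norm_continuous.
  have [c _ cP] := EVT_max ler01 cn.
  by exists `|df a c| => s s01; apply: cP; rewrite in_itv.
(* Tube argument: each (a, s) has a product neighbourhood where [df] differs by at most 1 from its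
   value there, and by compactness one neighbourhood of [a] works for all s. *)
have Hb : \forall u \near a, forall s : R, 0 <= s <= 1 -> `|df u s| <= M + 1.
  suff W : nbhs a (fun u => `[0, 1]%classic `<=` (fun s => is_true (`|df u s| <= M + 1))).
    by apply: filterS W => u H s s01; apply: H; rewrite /= in_itv.
  apply: ((near_covering_withinP _).2 ((compact_near_coveringP _).1 c01)
    R (nbhs a) (fun u s => is_true (`|df u s| <= M + 1))).
  move=> s /=; rewrite in_itv/= => s01.
  have /cvgrPdist_le /(_ 1 ltr01) /= := Hj s s01.
  move=> [[P Q] /= [Pa Qs] PQ].
  exists (Q, P) => //= -[t u] /= [Qt Pu] _.
  have := PQ (u, t) (conj Pu Qt) => /= h.
  have := ler_distD (df a s) (df u t) 0; rewrite !subr0 => /le_trans; apply.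
  by rewrite addrC lerD ?HM// distrC.
have [r r0 rP] : exists2 r : R, 0 < r & forall u, u \in `]a - r, a + r[ ->
  [/\ forall s : R, 0 <= s <= 1 -> is_derive (u : R) 1 (f ^~ s) (df u s),
     forall s : R, 0 <= s <= 1 -> {for s, continuous (f u)} &
     forall s : R, 0 <= s <= 1 -> `|df u s| <= M + 1].
  have [r /= r0 rP] := (nbhs_ballP a _).1 (filterI (filterI Hd Hc) Hb).
  exists r => // u; rewrite in_itv/= => /andP[u1 u2].
  have : ball a r u by rewrite -ball_normE/= ltr_distlC u1 u2.
  by move=> /rP[[h1 h2] h3].
have aI : a \in `]a - r, a + r[ by rewrite in_itv/= ltrBlDr ltrDl r0.
have cI (g : R -> R) : (forall s : R, 0 <= s <= 1 -> {for s, continuous g}) ->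
    mu.-integrable `[0, 1] (EFin \o g).
  move=> gc; apply: continuous_compact_integrable => //.
  by apply/continuous_in_subspaceT => s; rewrite inE/= in_itv/= => /gc.
have M0 : 0 <= M + 1.
  by apply: addr_ge0 => //; apply: le_trans (HM 0 _); rewrite ?lexx ?ler01.
have d1E u s : u \in `]a - r, a + r[ -> 0 <= s <= 1 -> partial1of2 f u s = df u s.
  by move=> uI s01; rewrite partial1of2E; have [/(_ s s01)[_ ->]] := rP u uI.
have K := @cvg_differentiation_under_integral R _ _ mu f `[0, 1]
  (measurable_itv _) a (a - r) (a + r) aI.
have {}K := K (fun u uI => cI _ (let: And3 _ h _ := rP u uI in h)).
have {}K : h^-1 *: (\int[mu]_(y in `[0, 1]) f (h + a) y -
     \int[mu]_(y in `[0, 1]) f a y) @[h --> 0^'] -->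
     \int[mu]_(y in `[0, 1]) partial1of2 f a y.
  apply: (K _ (cst (M + 1))) => //.
  - move=> u s uI /=; rewrite in_itv/= => s01.
    by have [/(_ s s01)[]] := rP u uI.
  - by apply: cI => s _; exact: cst_continuous.
  - move=> u s uI /=; rewrite in_itv/= => s01.
    by rewrite d1E//; have [_ _] := rP u uI; apply.
have E : \int[mu]_(y in `[0, 1]) partial1of2 f a y = \int[mu]_(y in `[0, 1]) df a y.
  by apply: eq_Rintegral => s; rewrite inE/= in_itv/= => s01; rewrite d1E.
rewrite E in K.
have K' : h^-1 *: (\int[mu]_(y in `[0, 1]) f (h *: 1 + a) y -
     \int[mu]_(y in `[0, 1]) f a y) @[h --> 0^'] -->
     \int[mu]_(y in `[0, 1]) df a y.
  by under eq_fun do rewrite [_ *: 1]mulr1.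
by apply: DeriveDef; [apply/cvg_ex; eexists; exact: K'|exact: (cvg_lim _ K')].
Qed.

Lemma Rintegral_derive (g dg : R -> R) :
  (forall s : R, 0 <= s <= 1 -> is_derive s 1 g (dg s)) ->
  (forall s : R, 0 <= s <= 1 -> {for s, continuous dg}) ->
  \int[mu]_(s in `[0, 1]) dg s = g 1 - g 0.
Proof.
move=> Hg Hc.
have cg s : 0 <= s <= 1 -> {for s, continuous g}.
  move=> /Hg[D _]; apply: differentiable_continuous.
  exact/derivable1_diffP.
rewrite /Rintegral (@continuous_FTC2 R dg g 0 1) ?ltr01 -?EFinB//.
- by apply/continuous_in_subspaceT => s; rewrite inE/= in_itv/= => /Hc.
- split.
  + by move=> s; rewrite in_itv/= => /andP[s0 s1]; case: (Hg s); rewrite ?ltW.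
  + by apply: cvg_at_right_filter; apply: cg; rewrite lexx ler01.
  + by apply: cvg_at_left_filter; apply: cg; rewrite lexx ler01.
- move=> s; rewrite in_itv/= => /andP[s0 s1].
  by rewrite derive1E; case: (Hg s); rewrite ?ltW.
Qed.

(** In Stokes' formula on a strip, [g] is the boundary term and [m] the value of the 2-form,
    constant along the curve. *)
Lemma transgression (f df : R -> R -> R) (g : R -> R) (a m : R) :
  (\forall u \near a, forall s : R, 0 <= s <= 1 -> is_derive (u : R) 1 (f ^~ s) (df u s)) ->
  (\forall u \near a, forall s : R, 0 <= s <= 1 -> {for s, continuous (f u)}) ->
  (forall s : R, 0 <= s <= 1 -> {for (a, s), continuous (fun p : R * R => df p.1 p.2)}) ->
  (forall s : R, 0 <= s <= 1 -> is_derive s 1 g (df a s - m)) ->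
  is_derive a 1 (fun u => \int[mu]_(s in `[0, 1]) f u s) (g 1 - g 0 + m).
Proof.
move=> Hd Hc Hj Hg; apply: is_derive_eqr (is_derive_Rintegral Hd Hc Hj) _.
have cdf s : 0 <= s <= 1 -> {for s, continuous (df a)}.
  move=> s01; apply: (@continuous_comp _ _ _ (fun s : R => (a, s))
    (fun p : R * R => df p.1 p.2) s _ (Hj s s01)).
  exact: pair_continuousr.
(* Adding [m * s] to the boundary term produces a primitive of the whole integrand. *)
have G (s : R) : 0 <= s <= 1 -> is_derive s 1 (fun s => g s + m * s) (df a s).
  move=> /Hg h; der; ring.
by rewrite (Rintegral_derive G cdf); ring.
Qed.

End Transgression.

(** * Continuity rules in pointwise form *)

Section ContinuityRules.
Variables (R : realType) (X : topologicalType).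
Implicit Types (f g : X -> R) (x : X).

Lemma continuousDr f g x : {for x, continuous f} -> {for x, continuous g} ->
  {for x, continuous (fun y => f y + g y)}.
Proof. by move=> cf cg; exact: continuousD. Qed.

Lemma continuousBr f g x : {for x, continuous f} -> {for x, continuous g} ->
  {for x, continuous (fun y => f y - g y)}.
Proof. by move=> cf cg; exact: continuousB. Qed.

Lemma continuousNr f x : {for x, continuous f} ->
  {for x, continuous (fun y => - f y)}.
Proof. by move=> cf; exact: continuousN. Qed.

Lemma continuousMr f g x : {for x, continuous f} -> {for x, continuous g} ->
  {for x, continuous (fun y => f y * g y)}.
Proof. by move=> cf cg; exact: continuousM. Qed.

Lemma continuousVr f x : f x != 0 -> {for x, continuous f} ->
  {for x, continuous (fun y => (f y)^-1)}.
Proof. by move=> f0 cf; exact: continuousV. Qed.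

Lemma continuousXr f n x : {for x, continuous f} ->
  {for x, continuous (fun y => f y ^+ n)}.
Proof.
move=> cf; elim: n => [|n IH]; first exact: cst_continuous.
have -> : (fun y => f y ^+ n.+1) = (fun y => f y * f y ^+ n).
  by apply: funext => y; rewrite exprS.
exact: continuousMr.
Qed.

Lemma continuous_compr (Y Z : topologicalType) (F : Y -> Z) (f : X -> Y) x :
  {for f x, continuous F} -> {for x, continuous f} ->
  {for x, continuous (fun y => F (f y))}.
Proof. by move=> cF cf; exact: continuous_comp cf cF. Qed.

Lemma continuous_cstr (c : R) x : {for x, continuous (fun=> c)}.
Proof. exact: cst_continuous. Qed.

Lemma continuous_sumr n (h : 'I_n -> X -> R) x :
  (forall i, {for x, continuous (h i)}) ->
  {for x, continuous (fun y => \sum_i h i y)}.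
Proof.
elim: n h => [|n IH] h ch.
  have -> : (fun y => \sum_i h i y) = (fun=> 0).
    by apply: funext => y; rewrite big_ord0.
  exact: continuous_cstr.
have -> : (fun y => \sum_i h i y) =
    (fun y => \sum_(i < n) h (widen_ord (leqnSn n) i) y + h ord_max y).
  by apply: funext => y; rewrite big_ord_recr.
apply: continuousDr => //.
exact: (IH (fun i => h (widen_ord (leqnSn n) i))).
Qed.

Lemma continuous_row n (g : X -> 'rV[R]_n) x :
  (forall i, {for x, continuous (fun y => g y 0 i)}) -> {for x, continuous g}.
Proof.
move=> h; apply/cvgrPdist_le => /= e e0.
have : \forall y \near x, forall i, `|g x 0 i - g y 0 i| <= e.
  apply: (@filter_forall _ _ (fun i y => is_true (`|g x 0 i - g y 0 i| <= e)) (nbhs x)).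
  by move=> i; have /cvgrPdist_le := h i; apply.
apply: filterS => y hy.
rewrite /Num.Def.normr/= mx_normrE (bigmax_le _ (ltW e0))//= => -[i j] _ /=.
by rewrite ord1 !mxE.
Qed.

End ContinuityRules.

Lemma continuous_fstr (R : realType) (p : R * R) : {for p, continuous (fun q : R * R => q.1)}.
Proof. exact: cvg_fst. Qed.

Lemma continuous_sndr (R : realType) (p : R * R) : {for p, continuous (fun q : R * R => q.2)}.
Proof. exact: cvg_snd. Qed.

Lemma continuous_idr (R : realType) (x : R) : {for x, continuous (fun y : R => y)}.
Proof. exact: id. Qed.

Lemma continuous_affine (R : realType) (a b x : R) :
  {for x, continuous (fun y : R => y * a + b)}.
Proof.
by apply: continuousDr; [apply: continuousMr; [exact: continuous_idr|]|]; exact: continuous_cstr.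
Qed.

Lemma differentiable_continuousr (R : realType) (V : normedModType R) (f : V -> R) x :
  differentiable f x -> {for x, continuous f}.
Proof. exact: differentiable_continuous. Qed.

Lemma is_derive_continuous (R : realType) (f : R -> R) (x : R) df :
  is_derive x 1 f df -> {for x, continuous f}.
Proof.
by case=> D _; apply: differentiable_continuousr; exact/derivable1_diffP.
Qed.

Lemma is_derive_sumr (R : realType) (V : normedModType R) n
    (h : 'I_n -> V -> R) x v (dh : 'I_n -> R) :
  (forall i, is_derive x v (h i) (dh i)) ->
  is_derive x v (fun y => \sum_i h i y) (\sum_i dh i).
Proof.
move=> H; have -> : (fun y => \sum_i h i y) = \sum_i h i.
  by apply: funext => y; rewrite fct_sumE.
exact: is_derive_sum.
Qed.

(** * Variation of line integrals *)

Section FormTransgression.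
Variables (R : realType) (n : nat).
Local Notation mu := (@lebesgue_measure R).
Local Notation V := 'rV[R]_n.+1.

(* Derivative of a family of line integrals of q along the curves s |-> g u s:
   Stokes' formula on an infinitesimal strip, m being the contribution of dq. *)
Lemma derive_line_family (O : set V) (q : 'I_n.+1 -> V -> R) (g U W Z : R -> R -> V)
    (a m : R) :
  open O ->
  (forall i x, O x -> differentiable (q i) x) ->
  (forall i j x, O x -> {for x, continuous (pd j (q i))}) ->
  (\forall u \near a, forall s : R, 0 <= s <= 1 ->
     [/\ O (g u s), is_derive (u : R) 1 (g ^~ s) (U u s),
      is_derive s 1 (g u) (W u s) & is_derive (u : R) 1 (W ^~ s) (Z u s)]) ->
  (\forall u \near a, forall s : R, 0 <= s <= 1 -> {for s, continuous (W u)}) ->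
  (forall s : R, 0 <= s <= 1 -> is_derive s 1 (U a) (Z a s)) ->
  (forall s : R, 0 <= s <= 1 ->
     [/\ {for (a, s), continuous (fun p : R * R => g p.1 p.2)},
         {for (a, s), continuous (fun p : R * R => U p.1 p.2)},
         {for (a, s), continuous (fun p : R * R => W p.1 p.2)} &
         {for (a, s), continuous (fun p : R * R => Z p.1 p.2)}]) ->
  (forall s : R, 0 <= s <= 1 ->
     \sum_i \sum_j U a s 0 i * W a s 0 j * (pd i (q j) (g a s) - pd j (q i) (g a s)) = m) ->
  is_derive a 1 (fun u => \int[mu]_(s in `[0, 1]) \sum_i q i (g u s) * W u s 0 i)
    (\sum_i q i (g a 1) * U a 1 0 i - \sum_i q i (g a 0) * U a 0 0 i + m).
Proof.
move=> oO dq cdq Hg HW HU Hc Hm.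
(* Product and chain rules for the integrand, [Z] being the u-derivative of [W]. *)
pose df u s := \sum_i (q i (g u s) * Z u s 0 i
   + W u s 0 i * (\sum_j U u s 0 j * pd j (q i) (g u s))).
have ce (i : 'I_n.+1) (x : V) : {for x, continuous (fun y : V => y 0 i)}.
  exact: coord_continuous.
have ga (s : R) : 0 <= s <= 1 -> O (g a s).
  by move=> s01; have [] := nbhs_singleton Hg s s01.
apply: (@transgression R (fun u s => \sum_i q i (g u s) * W u s 0 i) df
  (fun s => \sum_i q i (g a s) * U a s 0 i)).
- apply: filterS Hg => u Hu s /Hu[Og gu gs Wu].
  apply: is_derive_sumr => i; apply: is_deriveMr.
    apply: is_derive_comp_row; last exact: dq.
    by move=> j; exact: (is_derive_coord j gu).
  exact: (is_derive_coord i Wu).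
- apply: filterS2 Hg HW => u Hu HWu s s01; have [Og gu gs Wu] := Hu s s01.
  apply: continuous_sumr => i; apply: continuousMr.
    apply: (continuous_compr (F := q i)).
      by apply: differentiable_continuousr; exact: dq.
    apply: continuous_row => j; exact: (is_derive_continuous (is_derive_coord j gs)).
  by apply: (continuous_compr (F := fun y : V => y 0 i)); [exact: ce|exact: HWu].
- move=> s s01; have [cg cU cW cZ] := Hc s s01; have Og := ga s s01.
  apply: continuous_sumr => i; apply: continuousDr; apply: continuousMr.
  + apply: (continuous_compr (F := q i)); last exact: cg.
    by apply: differentiable_continuousr; exact: dq.
  + exact: (continuous_compr (F := fun y : V => y 0 i)).
  + exact: (continuous_compr (F := fun y : V => y 0 i)).
  + apply: continuous_sumr => j; apply: continuousMr.
      exact: (continuous_compr (F := fun y : V => y 0 j)).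
    by apply: (continuous_compr (F := pd j (q i))); [exact: cdq|exact: cg].
- move=> s s01; have Og := ga s s01.
  have [_ _ gs _] := nbhs_singleton Hg s s01.
  apply: (@is_derive_eqr _ _ _ _ _ _ (\sum_i (q i (g a s) * Z a s 0 i
     + U a s 0 i * (\sum_j W a s 0 j * pd j (q i) (g a s))))).
    apply: is_derive_sumr => i; apply: is_deriveMr.
      apply: is_derive_comp_row; last exact: dq.
      by move=> j; exact: (is_derive_coord j gs).
    exact: (is_derive_coord i (HU s s01)).
  (* The u-derivative of q(W) and the s-derivative of q(U) share the term in the mixed derivative
     [Z], so they differ exactly by dq(U, W). *)
  have mE : m = \sum_i W a s 0 i * (\sum_j U a s 0 j * pd j (q i) (g a s))
     - \sum_i U a s 0 i * (\sum_j W a s 0 j * pd j (q i) (g a s)).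
    rewrite -(Hm s s01).
    under eq_bigr do under eq_bigr do rewrite mulrBr.
    under eq_bigr do rewrite sumrB.
    rewrite sumrB exchange_big/=; congr (_ - _).
      by apply: eq_bigr => i _; rewrite mulr_sumr; apply: eq_bigr => j _; ring.
    by apply: eq_bigr => i _; rewrite mulr_sumr; apply: eq_bigr => j _; ring.
  by rewrite mE /df !big_split/=; ring.
Qed.

End FormTransgression.
(** * Real coordinates of the local model *)

Section Coordinates.
Variable R : realType.
Implicit Types (z x : 'rV[R]_4) (c : 'rV[R]_2).

Lemma ord2P (P : 'I_2 -> Prop) : P 0 -> P 1 -> forall i, P i.
Proof.
move=> p0 p1 [[|[|//]] h].
- by rewrite (_ : Ordinal h = 0)//; exact: val_inj.
- by rewrite (_ : Ordinal h = 1)//; exact: val_inj.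
Qed.

Lemma ord4P (P : 'I_4 -> Prop) : P 0 -> P 1 -> P 2 -> P 3 -> forall i, P i.
Proof.
move=> p0 p1 p2 p3 [[|[|[|[|//]]]] h].
- by rewrite (_ : Ordinal h = 0)//; exact: val_inj.
- by rewrite (_ : Ordinal h = 1)//; exact: val_inj.
- by rewrite (_ : Ordinal h = 2)//; exact: val_inj.
- by rewrite (_ : Ordinal h = 3)//; exact: val_inj.
Qed.

Lemma sum2 (M : nmodType) (F : 'I_2 -> M) : \sum_i F i = F 0 + F 1.
Proof.
by rewrite !big_ord_recl big_ord0 addr0; congr (F _ + F _); exact: val_inj.
Qed.

Lemma sum4 (M : nmodType) (F : 'I_4 -> M) : \sum_i F i = F 0 + F 1 + F 2 + F 3.
Proof.
rewrite !big_ord_recl big_ord0 addr0 !addrA.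
by congr (F _ + F _ + F _ + F _); exact: val_inj.
Qed.

Lemma mk2_0 (a b : R) : mk2 a b 0 0 = a. Proof. by rewrite mxE. Qed.
Lemma mk2_1 (a b : R) : mk2 a b 0 1 = b. Proof. by rewrite mxE. Qed.
Definition mk2E := (mk2_0, mk2_1).
Lemma mk4_0 (a b c d : R) : mk4 a b c d 0 0 = a. Proof. by rewrite mxE. Qed.
Lemma mk4_1 (a b c d : R) : mk4 a b c d 0 1 = b. Proof. by rewrite mxE. Qed.
Lemma mk4_2 (a b c d : R) : mk4 a b c d 0 2 = c. Proof. by rewrite mxE. Qed.
Lemma mk4_3 (a b c d : R) : mk4 a b c d 0 3 = d. Proof. by rewrite mxE. Qed.
Definition mk4E := (mk4_0, mk4_1, mk4_2, mk4_3).
Lemma mkC2_0 (v w : R[i]) : mkC2 v w 0 0 = complex.Re v. Proof. by rewrite mxE. Qed.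
Lemma mkC2_1 (v w : R[i]) : mkC2 v w 0 1 = complex.Im v. Proof. by rewrite mxE. Qed.
Lemma mkC2_2 (v w : R[i]) : mkC2 v w 0 2 = complex.Re w. Proof. by rewrite mxE. Qed.
Lemma mkC2_3 (v w : R[i]) : mkC2 v w 0 3 = complex.Im w. Proof. by rewrite mxE. Qed.
Definition mkC2E := (mkC2_0, mkC2_1, mkC2_2, mkC2_3).

Lemma row2_eq c c' : c 0 0 = c' 0 0 -> c 0 1 = c' 0 1 -> c = c'.
Proof. by move=> e0 e1; apply/rowP; apply: ord2P. Qed.

Lemma row4_eq z z' : z 0 0 = z' 0 0 -> z 0 1 = z' 0 1 -> z 0 2 = z' 0 2 ->
  z 0 3 = z' 0 3 -> z = z'.
Proof. by move=> e0 e1 e2 e3; apply/rowP; apply: ord4P. Qed.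

Lemma delta4E i j : (delta_mx 0 i : 'rV[R]_4) 0 j = (j == i)%:R.
Proof. by rewrite mxE eqxx. Qed.

Lemma delta2E i j : (delta_mx 0 i : 'rV[R]_2) 0 j = (j == i)%:R.
Proof. by rewrite mxE eqxx. Qed.

Lemma mkC2K z : mkC2 (z1 z) (z2 z) = z.
Proof. by apply: row4_eq; rewrite mkC2E. Qed.

Lemma z1_mkC2 (v w : R[i]) : z1 (mkC2 v w) = v.
Proof. by rewrite /z1 !mkC2E; case: v. Qed.

Lemma z2_mkC2 (v w : R[i]) : z2 (mkC2 v w) = w.
Proof. by rewrite /z2 !mkC2E; case: w. Qed.

Lemma toC_mk2 (w : R[i]) : toC (mk2 (complex.Re w) (complex.Im w)) = w.
Proof. by rewrite /toC !mk2E; case: w. Qed.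

Lemma toC_pican z : toC (pican z) = z1 z * z2 z.
Proof. exact: toC_mk2. Qed.

Lemma toC_inj c c' : toC c = toC c' -> c = c'.
Proof. by case=> e0 e1; exact: row2_eq. Qed.

Lemma pican0 z : pican z 0 0 = z 0 0 * z 0 2 - z 0 1 * z 0 3.
Proof. by rewrite mk2E. Qed.

Lemma pican1 z : pican z 0 1 = z 0 0 * z 0 3 + z 0 1 * z 0 2.
Proof. by rewrite mk2E. Qed.

Definition picanE := (pican0, pican1).

Lemma z2_neq0 z : (z2 z != 0) = (z 0 2 ^+ 2 + z 0 3 ^+ 2 != 0).
Proof.
rewrite paddr_eq0 ?sqr_ge0// !sqrf_eq0.
by congr (~~ _); apply/eqP/andP => [[-> ->]|[/eqP h2 /eqP h3]] //; rewrite /z2 h2 h3.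
Qed.

Lemma cexpD (v w : R[i]) : cexp (v + w) = cexp v * cexp w.
Proof.
case: v => a b; case: w => c d; rewrite /cexp /= expRD cosD sinD.
by simpc; congr (_ +i* _)%C; ring.
Qed.

Lemma cexp0 : cexp (0 : R[i]) = 1.
Proof. by rewrite /cexp /= expR0 cos0 sin0; simpc. Qed.

Lemma cexpN (w : R[i]) : cexp (- w) * cexp w = 1.
Proof. by rewrite -cexpD addNr cexp0. Qed.

Lemma cexp_neq0 (w : R[i]) : cexp w != 0.
Proof.
apply/eqP => w0; have := cexpN w; rewrite w0 mulr0 => /eqP.
by rewrite eq_sym oner_eq0.
Qed.

Lemma T0 x : T x 0 0 = expR (- x 0 2) * (x 0 0 * cos (x 0 3) - x 0 1 * sin (x 0 3)).
Proof. by rewrite mkC2E /toC /base !mk2E /cexp /=; ring. Qed.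

Lemma T1 x : T x 0 1 = expR (- x 0 2) * (x 0 0 * sin (x 0 3) + x 0 1 * cos (x 0 3)).
Proof. by rewrite mkC2E /toC /base !mk2E /cexp /=; ring. Qed.

Lemma T2 x : T x 0 2 = expR (x 0 2) * cos (x 0 3).
Proof. by rewrite mkC2E /cexp /= cosN; ring. Qed.

Lemma T3 x : T x 0 3 = - (expR (x 0 2) * sin (x 0 3)).
Proof. by rewrite mkC2E /cexp /= sinN; ring. Qed.

Definition TE := (T0, T1, T2, T3).

Lemma z2_T x : z2 (T x) != 0.
Proof. by rewrite z2_mkC2 cexp_neq0. Qed.

Lemma pican_T x : pican (T x) = base x.
Proof.
apply: toC_inj; rewrite toC_pican z1_mkC2 z2_mkC2 -mulrA -cexpD.
suff -> : ((- x 0 2 +i* x 0 3) + (x 0 2 -i* x 0 3))%C = 0 by rewrite cexp0 mulr1.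
by apply/eqP; rewrite eq_complex /= addNr subrr !eqxx.
Qed.

Lemma base_mk4 c a b : base (mk4 (c 0 0) (c 0 1) a b) = c.
Proof. by apply: row2_eq; rewrite mk2E mk4E. Qed.

End Coordinates.

(** * Differentiability rules in pointwise form *)

Section DifferentiabilityRules.
Variables (R : realType) (V : normedModType R).
Implicit Types (f g : V -> R) (x : V).

Lemma differentiableDr f g x : differentiable f x -> differentiable g x ->
  differentiable (fun y => f y + g y) x.
Proof. by move=> hf hg; exact: differentiableD. Qed.

Lemma differentiableBr f g x : differentiable f x -> differentiable g x ->
  differentiable (fun y => f y - g y) x.
Proof. by move=> hf hg; exact: differentiableB. Qed.

Lemma differentiableNr f x : differentiable f x -> differentiable (fun y => - f y) x.
Proof. by move=> hf; exact: differentiableN. Qed.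

Lemma differentiableMr f g x : differentiable f x -> differentiable g x ->
  differentiable (fun y => f y * g y) x.
Proof. by move=> hf hg; exact: differentiableM. Qed.

Lemma differentiable_constr (c : R) x : differentiable (fun=> c) x.
Proof. exact: differentiable_cst. Qed.

Lemma differentiableXr f n x : differentiable f x -> differentiable (fun y => f y ^+ n) x.
Proof.
move=> df; elim: n => [|n IH]; first exact: differentiable_constr.
have -> : (fun y => f y ^+ n.+1) = (fun y => f y * f y ^+ n).
  by apply: funext => y; rewrite exprS.
exact: differentiableMr.
Qed.

Lemma differentiable_comp1 (F : R -> R) f x : derivable F (f x) 1 ->
  differentiable f x -> differentiable (fun y => F (f y)) x.
Proof.
move=> dF df; apply: (differentiable_comp (f := f) (g := F)) => //.
exact/derivable1_diffP.
Qed.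

Lemma differentiable_expRr f x : differentiable f x ->
  differentiable (fun y => expR (f y)) x.
Proof. by apply: differentiable_comp1; exact: derivable_expR. Qed.

Lemma differentiable_cosr f x : differentiable f x ->
  differentiable (fun y => cos (f y)) x.
Proof. by apply: differentiable_comp1; exact: derivable_cos. Qed.

Lemma differentiable_sinr f x : differentiable f x ->
  differentiable (fun y => sin (f y)) x.
Proof. by apply: differentiable_comp1; exact: derivable_sin. Qed.

Lemma differentiableVr f x : f x != 0 -> differentiable f x ->
  differentiable (fun y => (f y)^-1) x.
Proof. by move=> f0 df; exact: differentiableV. Qed.

Lemma differentiable_atanr f x : differentiable f x ->
  differentiable (fun y => atan (f y)) x.
Proof. by apply: differentiable_comp1; case: (is_derive1_atan (f x)). Qed.

End DifferentiabilityRules.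

Lemma differentiable_coordr (R : realType) n (x : 'rV[R]_n) i :
  differentiable (fun y : 'rV[R]_n => y 0 i) x.
Proof. exact: differentiable_coord. Qed.

Ltac dif := repeat first [ assumption | exact: differentiable_constr
  | exact: differentiable_coordr
  | apply: differentiableDr | apply: differentiableBr | apply: differentiableNr
  | apply: differentiableMr | apply: differentiableXr | apply: differentiable_expRr
  | apply: differentiable_cosr | apply: differentiable_sinr | apply: differentiable_atanr ].

(** * The frame of the chart T *)

Section Frame.
Variable R : realType.
Implicit Types (z x v : 'rV[R]_4) (c : 'rV[R]_2).

Definition sq2 z : R := z 0 2 ^+ 2 + z 0 3 ^+ 2.

(* The images under dT of the coordinate fields: the first two rows are
   1/z2 and i/z2 in the z1-direction, the last two the Hamiltonian fields. *)
Definition frame z : 'M[R]_4 := \matrix_(i, j) nth 0 (nth [::]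
  [:: [:: z 0 2 / sq2 z; - z 0 3 / sq2 z; 0; 0];
      [:: z 0 3 / sq2 z; z 0 2 / sq2 z; 0; 0];
      [:: - z 0 0; - z 0 1; z 0 2; z 0 3];
      [:: - z 0 1; z 0 0; z 0 3; - z 0 2]] i) j.

Lemma sq2_gt0 z : z2 z != 0 -> 0 < sq2 z.
Proof. by rewrite z2_neq0 => h; rewrite lt_def h addr_ge0 ?sqr_ge0. Qed.

Lemma sq2_T x : sq2 (T x) = expR (x 0 2) ^+ 2.
Proof.
rewrite /sq2 T2 T3 sqrrN !exprMn -mulrDr cos2Dsin2 mulr1 //.
Qed.

Lemma mul_frame v z : v *m frame z = mk4
  (v 0 0 * (z 0 2 / sq2 z) + v 0 1 * (z 0 3 / sq2 z) - v 0 2 * z 0 0 - v 0 3 * z 0 1)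
  (v 0 1 * (z 0 2 / sq2 z) - v 0 0 * (z 0 3 / sq2 z) - v 0 2 * z 0 1 + v 0 3 * z 0 0)
  (v 0 2 * z 0 2 + v 0 3 * z 0 3)
  (v 0 2 * z 0 3 - v 0 3 * z 0 2).
Proof. by apply: row4_eq; rewrite mk4E mxE sum4 !mxE /=; ring. Qed.

(** Real and imaginary parts of z2 / |z2|^2, the inverse of the conjugate of z2, that is e^(-t1 - i
    t2). *)
Lemma T_over_sq2 x : (T x 0 2 / sq2 (T x) = expR (- x 0 2) * cos (x 0 3)) *
  (T x 0 3 / sq2 (T x) = - (expR (- x 0 2) * sin (x 0 3))).
Proof.
rewrite sq2_T T2 T3 expRN; have := expR_gt0 (x 0 2) => /lt0r_neq0 e0.
by split; field.
Qed.

Lemma is_derive_T x v : is_derive x v (@T R) (v *m frame (T x)).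
Proof.
rewrite mul_frame !T_over_sq2 !TE.
apply: is_derive_row; apply: ord4P; rewrite mk4E.
- by rewrite (funext (@T0 R)); der; ring.
- by rewrite (funext (@T1 R)); der; ring.
- by rewrite (funext (@T2 R)); der; ring.
- by rewrite (funext (@T3 R)); der; ring.
Qed.

Lemma differentiable_T x : differentiable (@T R) x.
Proof.
apply: differentiable_row; apply: ord4P.
- by rewrite (funext (@T0 R)); dif.
- by rewrite (funext (@T1 R)); dif.
- by rewrite (funext (@T2 R)); dif.
- by rewrite (funext (@T3 R)); dif.
Qed.

Lemma is_derive_comp_T (V : normedModType R) (X : V -> 'rV[R]_4) y w dX :
  is_derive y w X dX ->
  is_derive y w (fun y => T (X y)) (dX *m frame (T (X y))).
Proof.
move=> hX; have := is_derive_comp_diff hX (differentiable_T (X y)).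
rewrite -(deriveE _ (differentiable_T (X y))).
by have [_ ->] := is_derive_T (X y) dX.
Qed.

Lemma jacobian_T x : jacobian (@T R) x = frame (T x).
Proof.
apply/matrixP => i j; rewrite jacobianE; last exact: differentiable_T.
rewrite (is_derive_pd (is_derive_coord j (is_derive_T x (delta_mx 0 i)))).
by rewrite -rowE mxE.
Qed.

Lemma differentiable_pican z : differentiable (@pican R) z.
Proof.
apply: differentiable_row; apply: ord2P.
- by rewrite (funext (@pican0 R)); dif.
- by rewrite (funext (@pican1 R)); dif.
Qed.

Lemma pican_continuous : continuous (@pican R).
Proof. by move=> z; exact/differentiable_continuous/differentiable_pican. Qed.

End Frame.

(** * The gluing map in real coordinates *)

Section Psi.
Variables (R : realType) (S : 'rV[R]_2 -> R).
Implicit Types (z x v : 'rV[R]_4) (c : 'rV[R]_2).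
Hypothesis smooth_S : smooth_on setT S.

Lemma differentiable_S1 c : differentiable (S1 S) c.
Proof. exact: (smooth_S [:: 0]). Qed.

Lemma differentiable_S2 c : differentiable (S2 S) c.
Proof. exact: (smooth_S [:: 1]). Qed.

Lemma psi0 z : psi S z 0 0 = expR (S1 S (pican z)) *
  (cos (S2 S (pican z)) * z 0 2 - sin (S2 S (pican z)) * z 0 3) / sq2 z.
Proof.
rewrite mkC2E /cexp /z2 /= /GRing.inv /= cosN sinN /sq2.
by ring.
Qed.

Lemma psi1 z : psi S z 0 1 = - (expR (S1 S (pican z)) *
  (sin (S2 S (pican z)) * z 0 2 + cos (S2 S (pican z)) * z 0 3)) / sq2 z.
Proof.
rewrite mkC2E /cexp /z2 /= /GRing.inv /= cosN sinN /sq2.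
by ring.
Qed.

Lemma psi2 z : psi S z 0 2 = expR (- S1 S (pican z)) *
  (cos (S2 S (pican z)) * (pican z 0 0 * z 0 2 - pican z 0 1 * z 0 3)
   - sin (S2 S (pican z)) * (pican z 0 0 * z 0 3 + pican z 0 1 * z 0 2)).
Proof.
rewrite mkC2E; set w := (- (_ -i* _))%C.
(* Writing z1 z2^2 as c z2 leaves z entering only through c and z2. *)
have -> : cexp w * z1 z * z2 z ^+ 2 = cexp w * (toC (pican z) * z2 z).
  by rewrite toC_pican; ring.
by rewrite /cexp /z2 /toC /= opprK; ring.
Qed.

Lemma psi3 z : psi S z 0 3 = expR (- S1 S (pican z)) *
  (sin (S2 S (pican z)) * (pican z 0 0 * z 0 2 - pican z 0 1 * z 0 3)
   + cos (S2 S (pican z)) * (pican z 0 0 * z 0 3 + pican z 0 1 * z 0 2)).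
Proof.
rewrite mkC2E; set w := (- (_ -i* _))%C.
have -> : cexp w * z1 z * z2 z ^+ 2 = cexp w * (toC (pican z) * z2 z).
  by rewrite toC_pican; ring.
by rewrite /cexp /z2 /toC /= opprK; ring.
Qed.

Lemma differentiable_psi z : z2 z != 0 -> differentiable (psi S) z.
Proof.
rewrite z2_neq0 => z0.
have d1 : differentiable (fun z => S1 S (pican z)) z.
  exact: differentiable_comp (differentiable_pican z) (differentiable_S1 _).
have d2 : differentiable (fun z => S2 S (pican z)) z.
  exact: differentiable_comp (differentiable_pican z) (differentiable_S2 _).
have p0 : differentiable (fun z => pican z 0 0) z.
  by rewrite (funext (@pican0 R)); dif.
have p1 : differentiable (fun z => pican z 0 1) z.
  by rewrite (funext (@pican1 R)); dif.
have r0 : differentiable (fun z => (sq2 z)^-1) z.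
  by apply: differentiableVr => //; rewrite /sq2; dif.
apply: differentiable_row; apply: ord4P.
- by rewrite (funext psi0); dif.
- by rewrite (funext psi1); dif.
- by rewrite (funext psi2); dif.
- by rewrite (funext psi3); dif.
Qed.

Lemma pican_psi z : z2 z != 0 -> pican (psi S z) = pican z.
Proof.
move=> z0; apply: toC_inj; rewrite !toC_pican z1_mkC2 z2_mkC2.
set w := (_ -i* _)%C.
transitivity (cexp (- w) * cexp w * ((z2 z)^-1 * z2 z) * (z1 z * z2 z)).
  by ring.
by rewrite cexpN mulVf// !mul1r.
Qed.

End Psi.
(** * The shape of a compatible form *)

Section PointwiseForms.
Variable R : realType.
Implicit Types (z x v : 'rV[R]_4).

Lemma ReD (v w : R[i]) : complex.Re (v + w) = complex.Re v + complex.Re w.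
Proof. by case: v; case: w. Qed.

Lemma ImD (v w : R[i]) : complex.Im (v + w) = complex.Im v + complex.Im w.
Proof. by case: v; case: w. Qed.

Lemma ReZ (r : R) (w : R[i]) : complex.Re (r%:C%C * w) = r * complex.Re w.
Proof. by case: w => a b /=; rewrite mul0r subr0. Qed.

Lemma ImZ (r : R) (w : R[i]) : complex.Im (r%:C%C * w) = r * complex.Im w.
Proof. by case: w => a b /=; rewrite mul0r addr0. Qed.

Lemma Re_iM (w : R[i]) : complex.Re ('i%C * w) = - complex.Im w.
Proof. by case: w => a b /=; rewrite mul0r mul1r sub0r. Qed.

Lemma Im_iM (w : R[i]) : complex.Im ('i%C * w) = complex.Re w.
Proof. by case: w => a b /=; rewrite mul0r mul1r add0r. Qed.

Definition ReImE := (ReD, ImD, ReZ, ImZ, Re_iM, Im_iM).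

Lemma wedge11E n (a b : 'rV[R[i]]_n) i j :
  wedge11 a b i j = a 0 i * b 0 j - b 0 i * a 0 j.
Proof. by rewrite !mxE !big_ord1 !mxE. Qed.

Lemma pd_coord n (i j : 'I_n.+1) (y : 'rV[R]_n.+1) :
  pd i (fun y : 'rV[R]_n.+1 => y 0 j) y = (j == i)%:R.
Proof. by rewrite (is_derive_pd (is_derive_coordr y _ j)) mxE eqxx. Qed.

Lemma d0_z1 z j : d0 (@z1 R) z 0 j = ((0 == j)%:R +i* (1 == j)%:R)%C.
Proof. by rewrite mxE /cpd /= !pd_coord. Qed.

Lemma d0_z2 z j : d0 (@z2 R) z 0 j = ((2 == j)%:R +i* (3 == j)%:R)%C.
Proof. by rewrite mxE /cpd /= !pd_coord. Qed.

Lemma omega_canE z i j : omega_can z i j =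
  (0 == i)%:R * (2 == j)%:R - (1 == i)%:R * (3 == j)%:R
  - ((0 == j)%:R * (2 == i)%:R - (1 == j)%:R * (3 == i)%:R).
Proof.
suff E (a b : 'rV[R[i]]_4) : (forall j, a 0 j = ((0 == j)%:R +i* (1 == j)%:R)%C) ->
    (forall j, b 0 j = ((2 == j)%:R +i* (3 == j)%:R)%C) ->
    complex.Re (wedge11 a b i j) = (0 == i)%:R * (2 == j)%:R - (1 == i)%:R * (3 == j)%:R
      - ((0 == j)%:R * (2 == i)%:R - (1 == j)%:R * (3 == i)%:R).
  by rewrite mxE; exact: E (d0_z1 z) (d0_z2 z).
move=> ha hb; rewrite wedge11E !ha !hb /=.
by congr (_ - _ - (_ - _)); exact: mulrC.
Qed.

Definition dc_re z : 'rV[R]_4 := mk4 (z 0 2) (- z 0 3) (z 0 0) (- z 0 1).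
Definition dc_im z : 'rV[R]_4 := mk4 (z 0 3) (z 0 2) (z 0 1) (z 0 0).

Lemma d0_picanC z j : d0 (@picanC R) z 0 j = (dc_re z 0 j +i* dc_im z 0 j)%C.
Proof.
rewrite mxE /cpd /=; congr (_ +i* _)%C; apply: is_derive_pd.
- move: j; apply: ord4P; rewrite mk4E; der; rewrite !delta4E /=; ring.
- move: j; apply: ord4P; rewrite mk4E; der; rewrite !delta4E /=; ring.
Qed.

(* Since J is of type (2,0) for A and pi is J-holomorphic, Im A - Im (dz1 /\ dz2)
   kills the Hamiltonian fields of c1 and c2, hence is a multiple of dc1 /\ dc2. *)
Lemma im_form_relations z (J : 'M[R]_4) (A : 'M[R[i]]_4) :
  A^T = - A -> map_mx (@complex.Re R) A = omega_can z ->
  cmx J *m A = 'i%C *: A ->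
  cmx J *m (d0 (@picanC R) z)^T = 'i%C *: (d0 (@picanC R) z)^T ->
  z2 z != 0 ->
  let N i j := complex.Im (A i j) in
  [/\ N 0 2 * sq2 z = N 0 1 * (z 0 2 * z 0 1 - z 0 0 * z 0 3),
      (N 0 3 - 1) * sq2 z = N 0 1 * (z 0 0 * z 0 2 + z 0 1 * z 0 3),
      (N 1 2 - 1) * sq2 z = - N 0 1 * (z 0 0 * z 0 2 + z 0 1 * z 0 3),
      N 1 3 * sq2 z = N 0 1 * (z 0 2 * z 0 1 - z 0 0 * z 0 3)
    & N 2 3 * sq2 z = N 0 1 * (z 0 0 ^+ 2 + z 0 1 ^+ 2)].
Proof.
move=> At Are JA Jpi /sq2_gt0/lt0r_neq0 r0 N.
have anti i j : N i j = - N j i.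
  have := congr1 (fun M : 'M[R[i]]_4 => complex.Im (M j i)) At.
  by rewrite /N !mxE => ->; case: (A j i).
have diag i : N i i = 0.
  by have := anti i i; lra.
(* As Re A is the constant invertible matrix of omega_can, the real part of J A = i A solves for J
   in terms of N ([Jof]). Holomorphy of pi then becomes linear equations in N ([R1], [R2]). *)
have JN i j : \sum_m J i m * omega_can z m j = - N i j.
  have := congr1 (fun M : 'M[R[i]]_4 => complex.Re (M i j)) JA.
  by rewrite !mxE !sum4 -Are !mxE !ReImE.
have E i : \sum_m ((J i m)%:C)%C * d0 (@picanC R) z 0 m = 'i%C * d0 (@picanC R) z 0 i.
  move: (d0 (@picanC R) z) Jpi => p /(congr1 (fun M : 'cV[R[i]]_4 => M i 0)).
  by rewrite !mxE => <-; apply: eq_bigr => m _; rewrite !mxE.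
have Jre i : \sum_m J i m * dc_re z 0 m = - dc_im z 0 i.
  have := congr1 (@complex.Re R) (E i).
  by rewrite !sum4 !ReImE !d0_picanC.
have Jim i : \sum_m J i m * dc_im z 0 m = dc_re z 0 i.
  have := congr1 (@complex.Im R) (E i).
  by rewrite !sum4 !ReImE !d0_picanC.
have Jof i : [/\ J i 0 = - N i 2, J i 1 = N i 3, J i 2 = N i 0 & J i 3 = - N i 1].
  have := JN i 0; have := JN i 1; have := JN i 2; have := JN i 3.
  rewrite !sum4 !omega_canE /= => e3 e2 e1 e0; split; lra.
have R1 i : - N i 2 * z 0 2 - N i 3 * z 0 3 + N i 0 * z 0 0 + N i 1 * z 0 1 = - dc_im z 0 i.
  by rewrite -Jre sum4 !mk4E; have [-> -> -> ->] := Jof i; ring.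
have R2 i : - N i 2 * z 0 3 + N i 3 * z 0 2 + N i 0 * z 0 1 - N i 1 * z 0 0 = dc_re z 0 i.
  by rewrite -Jim sum4 !mk4E; have [-> -> -> ->] := Jof i; ring.
have := R1 0; have := R2 0; have := R1 1; have := R2 1; have := R1 2; have := R2 2.
rewrite !mk4E !diag (anti 1 0) (anti 2 0) (anti 2 1) /sq2 => b2 a2 b1 a1 b0 a0.
(* [a0] and [b0] form one complex linear equation; weighting them by the real and imaginary parts of
   z2 solves it, at the cost of a factor |z2|^2. *)
have E02 : N 0 2 * sq2 z = N 0 1 * (z 0 2 * z 0 1 - z 0 0 * z 0 3).
  rewrite /sq2.
  have -> : N 0 2 * (z 0 2 ^+ 2 + z 0 3 ^+ 2) =
    - z 0 2 * (- N 0 2 * z 0 2 - N 0 3 * z 0 3 + 0 * z 0 0 + N 0 1 * z 0 1)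
    - z 0 3 * (- N 0 2 * z 0 3 + N 0 3 * z 0 2 + 0 * z 0 1 - N 0 1 * z 0 0)
    + N 0 1 * (z 0 2 * z 0 1 - z 0 0 * z 0 3) by ring.
  by rewrite a0 b0; ring.
have E03 : (N 0 3 - 1) * sq2 z = N 0 1 * (z 0 0 * z 0 2 + z 0 1 * z 0 3).
  rewrite /sq2.
  have -> : (N 0 3 - 1) * (z 0 2 ^+ 2 + z 0 3 ^+ 2) =
    - z 0 3 * (- N 0 2 * z 0 2 - N 0 3 * z 0 3 + 0 * z 0 0 + N 0 1 * z 0 1 + z 0 3)
    + z 0 2 * (- N 0 2 * z 0 3 + N 0 3 * z 0 2 + 0 * z 0 1 - N 0 1 * z 0 0 - z 0 2)
    + N 0 1 * (z 0 0 * z 0 2 + z 0 1 * z 0 3) by ring.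
  by rewrite a0 b0; ring.
have E12 : (N 1 2 - 1) * sq2 z = - N 0 1 * (z 0 0 * z 0 2 + z 0 1 * z 0 3).
  rewrite /sq2.
  have -> : (N 1 2 - 1) * (z 0 2 ^+ 2 + z 0 3 ^+ 2) =
    - z 0 2 * (- N 1 2 * z 0 2 - N 1 3 * z 0 3 + - N 0 1 * z 0 0 + 0 * z 0 1 + z 0 2)
    - z 0 3 * (- N 1 2 * z 0 3 + N 1 3 * z 0 2 + - N 0 1 * z 0 1 - 0 * z 0 0 + z 0 3)
    - N 0 1 * (z 0 0 * z 0 2 + z 0 1 * z 0 3) by ring.
  by rewrite a1 b1; ring.
have E13 : N 1 3 * sq2 z = N 0 1 * (z 0 2 * z 0 1 - z 0 0 * z 0 3).
  rewrite /sq2.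
  have -> : N 1 3 * (z 0 2 ^+ 2 + z 0 3 ^+ 2) =
    - z 0 3 * (- N 1 2 * z 0 2 - N 1 3 * z 0 3 + - N 0 1 * z 0 0 + 0 * z 0 1 + z 0 2)
    + z 0 2 * (- N 1 2 * z 0 3 + N 1 3 * z 0 2 + - N 0 1 * z 0 1 - 0 * z 0 0 + z 0 3)
    + N 0 1 * (z 0 2 * z 0 1 - z 0 0 * z 0 3) by ring.
  by rewrite a1 b1; ring.
split=> //.
(* The equations of row 2 involve [N 0 2] and [N 1 2], known only after multiplication by |z2|^2,
   whence a second such factor. *)
apply: (mulfI r0).
have -> : sq2 z * (N 2 3 * sq2 z) = sq2 z * (
    - z 0 3 * (- 0 * z 0 2 - N 2 3 * z 0 3 + - N 0 2 * z 0 0 + - N 1 2 * z 0 1 + z 0 1)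
    + z 0 2 * (- 0 * z 0 3 + N 2 3 * z 0 2 + - N 0 2 * z 0 1 - - N 1 2 * z 0 0 - z 0 0))
   + (N 0 2 * sq2 z) * (z 0 2 * z 0 1 - z 0 3 * z 0 0)
   - ((N 1 2 - 1) * sq2 z) * (z 0 3 * z 0 1 + z 0 2 * z 0 0).
  by rewrite /sq2; ring.
by rewrite a2 b2 E02 E12 /sq2; ring.
Qed.

End PointwiseForms.
(** The algebra of [imO01_frame]: x, y, z, w stand for the coordinates of the point, the p's for
    partial derivatives. The vanishing terms [0 * _] keep the left-hand side in the shape produced
    by [mul_frame]. *)
Lemma hamiltonian_direction (F : fieldType) (x y z w a b n p0 p1 p2 p3 : F) :
  z ^+ 2 + w ^+ 2 != 0 ->
  p2 * (z ^+ 2 + w ^+ 2) = p0 * (x * z + y * w) + p1 * (z * y - x * w) + 2 * n * z ->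
  p3 * (z ^+ 2 + w ^+ 2) = - p0 * (z * y - x * w) + p1 * (x * z + y * w) + 2 * n * w ->
  (0 * (z / (z ^+ 2 + w ^+ 2)) + 0 * (w / (z ^+ 2 + w ^+ 2)) - a * x - b * y) * p0
  + (0 * (z / (z ^+ 2 + w ^+ 2)) - 0 * (w / (z ^+ 2 + w ^+ 2)) - a * y + b * x) * p1
  + (a * z + b * w) * p2 + (a * w - b * z) * p3 = 2 * a * n.
Proof.
move=> r0 e2 e3; apply: (mulIf r0).
transitivity ((- a * x - b * y) * p0 * (z ^+ 2 + w ^+ 2)
     + (- a * y + b * x) * p1 * (z ^+ 2 + w ^+ 2)
     + (a * z + b * w) * (p2 * (z ^+ 2 + w ^+ 2))
     + (a * w - b * z) * (p3 * (z ^+ 2 + w ^+ 2))); first by ring.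
by rewrite e2 e3; ring.
Qed.

(** * Closedness and constancy of the coefficient along the fibres *)

Section CompatibleForm.
Variables (R : realType) (eps : R) (S : 'rV[R]_2 -> R) (Omega : 'rV[R]_4 -> 'M[R[i]]_4).
Implicit Types (z x v : 'rV[R]_4) (c : 'rV[R]_2).

Lemma differentiable_sq2 z : differentiable (@sq2 R) z.
Proof. by rewrite /sq2; dif. Qed.

Lemma open_z2_neq0 : open [set z : 'rV[R]_4 | z2 z != 0].
Proof.
have -> : [set z : 'rV[R]_4 | z2 z != 0] = @sq2 R @^-1` [set r | 0 < r].
  apply/seteqP; split=> z /=; first exact: sq2_gt0.
  by rewrite z2_neq0 => /lt0r_neq0.
apply: open_comp; last exact: open_gt.
by move=> z _; apply: differentiable_continuousr; exact: differentiable_sq2.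
Qed.

Lemma modulus_continuous : continuous (@modulus R).
Proof.
move=> c.
change {for c, continuous (fun y : 'rV[R]_2 => Num.sqrt (y 0 0 ^+ 2 + y 0 1 ^+ 2))}.
apply: (continuous_compr (F := Num.sqrt)); first exact: sqrt_continuous.
by apply: differentiable_continuousr; dif.
Qed.

Lemma open_disc : open (disc eps).
Proof.
have -> : disc eps = @modulus R @^-1` [set r | r < eps] by [].
by apply: open_comp; [move=> c _; exact: modulus_continuous|exact: open_lt].
Qed.

Lemma open_over (D : set 'rV[R]_2) : open D -> open (over D).
Proof. by move=> oD; apply: open_comp => // z _; exact: pican_continuous. Qed.

Hypothesis smooth_S : smooth_on setT S.
Hypothesis compatible_Omega : compatible eps S Omega.

Definition imO i j z : R := complex.Im (Omega z i j).

Lemma imO_smooth i j : smooth_on (over (disc eps)) (imO i j).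
Proof. by case: compatible_Omega => -[/(_ i j)[]]. Qed.

Lemma imO_anti i j z : over (disc eps) z -> imO i j z = - imO j i z.
Proof.
case: compatible_Omega => -[_ /(_ z) At _] _ _ _ /At.
move=> /(congr1 (fun M : 'M[R[i]]_4 => complex.Im (M j i))).
by rewrite /imO !mxE => ->; case: (Omega z j i).
Qed.

Lemma reO z i j : over (disc eps) z -> complex.Re (Omega z i j) = omega_can z i j.
Proof. by case: compatible_Omega => _ /(_ z) + _ _ oz => /(_ oz) <-; rewrite mxE. Qed.

Lemma imO_relations z : over (disc eps) z -> z2 z != 0 ->
  [/\ imO 0 2 z * sq2 z = imO 0 1 z * (z 0 2 * z 0 1 - z 0 0 * z 0 3),
      (imO 0 3 z - 1) * sq2 z = imO 0 1 z * (z 0 0 * z 0 2 + z 0 1 * z 0 3),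
      (imO 1 2 z - 1) * sq2 z = - imO 0 1 z * (z 0 0 * z 0 2 + z 0 1 * z 0 3),
      imO 1 3 z * sq2 z = imO 0 1 z * (z 0 2 * z 0 1 - z 0 0 * z 0 3)
    & imO 2 3 z * sq2 z = imO 0 1 z * (z 0 0 ^+ 2 + z 0 1 ^+ 2)].
Proof.
move=> oz z0; case: compatible_Omega => -[_ At _] Re _ [J [_ JJ]].
have [J1 J2] := JJ z oz.
exact: (im_form_relations (At z oz) (Re z oz) J1 J2 z0).
Qed.

Lemma imO_closed z i j k : over (disc eps) z ->
  pd i (imO j k) z + pd j (imO k i) z + pd k (imO i j) z = 0.
Proof.
case: compatible_Omega => _ _ [cl _ _] _ oz.
by have := congr1 (@complex.Im R) (cl z i j k oz); rewrite !ImD.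
Qed.

(** By [imO_relations] the entries 12, 20, 13, 30 are functions of the entry 01, so the components
    (0,1,2) and (0,1,3) of d Omega = 0 become transport equations for that single entry. *)
Lemma imO_pd01 z : over (disc eps) z -> z2 z != 0 ->
  pd 2 (imO 0 1) z * sq2 z = pd 0 (imO 0 1) z * (z 0 0 * z 0 2 + z 0 1 * z 0 3)
    + pd 1 (imO 0 1) z * (z 0 2 * z 0 1 - z 0 0 * z 0 3) + 2 * imO 0 1 z * z 0 2 /\
  pd 3 (imO 0 1) z * sq2 z = - pd 0 (imO 0 1) z * (z 0 2 * z 0 1 - z 0 0 * z 0 3)
    + pd 1 (imO 0 1) z * (z 0 0 * z 0 2 + z 0 1 * z 0 3) + 2 * imO 0 1 z * z 0 3.
Proof.
move=> oz z0.
have r0 := sq2_gt0 z0.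
have nz : nbhs z (over (disc eps) `&` [set z | z2 z != 0]).
  apply: filterI; apply: open_nbhs_nbhs; split=> //.
    exact: open_over open_disc.
  exact: open_z2_neq0.
have [d0 d1] : is_derive z (delta_mx 0 0) (imO 0 1) (pd 0 (imO 0 1) z) /\
    is_derive z (delta_mx 0 1) (imO 0 1) (pd 1 (imO 0 1) z).
  have D := smooth_on_differentiable (imO_smooth 0 1) oz.
  by split; apply/derivableP; exact: diff_derivable.
have rV y : z2 y != 0 -> sq2 y != 0 by move=> /sq2_gt0/lt0r_neq0.
(* |z2|^2 does not vary in the two z1-directions, so its inverse differentiates to 0 there. *)
have [v0 v1] : is_derive z (delta_mx 0 0) (fun y => (sq2 y)^-1) 0 /\
    is_derive z (delta_mx 0 1) (fun y => (sq2 y)^-1) 0.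
  have dV i : i = 0 \/ i = 1 -> is_derive z (delta_mx 0 i) (@sq2 R) 0.
    by rewrite /sq2; case=> ->; der; rewrite !delta4E /=; ring.
  have dV' i : i = 0 \/ i = 1 -> is_derive z (delta_mx 0 i) (fun y => (sq2 y)^-1) 0.
    move=> /dV h; eapply is_derive_eqr; first by eapply is_deriveVr; [exact: rV|exact: h].
    by rewrite mul0r.
  by split; apply: dV'; auto.
have pd4 i f g df : (forall y, over (disc eps) y -> z2 y != 0 -> f y = g y) ->
    is_derive z (delta_mx 0 i) g df -> pd i f z = df.
  move=> fg dg; rewrite (near_pd (g := g)); first exact: is_derive_pd.
  by apply: filterS nz => y [oy y0]; exact: fg.
have E12 : pd 0 (imO 1 2) z =
    - (pd 0 (imO 0 1) z * (z 0 0 * z 0 2 + z 0 1 * z 0 3) + imO 0 1 z * z 0 2) * (sq2 z)^-1.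
  apply: (pd4 _ _ (fun y => 1 - imO 0 1 y * (y 0 0 * y 0 2 + y 0 1 * y 0 3) * (sq2 y)^-1)).
    move=> y oy y0; have [_ _ e _ _] := imO_relations oy y0.
    have -> : imO 1 2 y = (imO 1 2 y - 1) * sq2 y * (sq2 y)^-1 + 1.
      by rewrite mulfK ?rV// subrK.
    by rewrite e; ring.
  by der; rewrite !delta4E /=; ring.
have E20 : pd 1 (imO 2 0) z =
    - (pd 1 (imO 0 1) z * (z 0 2 * z 0 1 - z 0 0 * z 0 3) + imO 0 1 z * z 0 2) * (sq2 z)^-1.
  apply: (pd4 _ _ (fun y => - (imO 0 1 y * (y 0 2 * y 0 1 - y 0 0 * y 0 3) * (sq2 y)^-1))).
    move=> y oy y0; have [e _ _ _ _] := imO_relations oy y0.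
    by rewrite imO_anti// -e mulfK ?rV.
  by der; rewrite !delta4E /=; ring.
have E13 : pd 0 (imO 1 3) z =
    (pd 0 (imO 0 1) z * (z 0 2 * z 0 1 - z 0 0 * z 0 3) - imO 0 1 z * z 0 3) * (sq2 z)^-1.
  apply: (pd4 _ _ (fun y => (imO 0 1 y * (y 0 2 * y 0 1 - y 0 0 * y 0 3) * (sq2 y)^-1))).
    move=> y oy y0; have [_ _ _ e _] := imO_relations oy y0.
    by rewrite -e mulfK ?rV.
  by der; rewrite !delta4E /=; ring.
have E30 : pd 1 (imO 3 0) z =
    - (pd 1 (imO 0 1) z * (z 0 0 * z 0 2 + z 0 1 * z 0 3) + imO 0 1 z * z 0 3) * (sq2 z)^-1.
  apply: (pd4 _ _ (fun y => -1 - (imO 0 1 y * (y 0 0 * y 0 2 + y 0 1 * y 0 3) * (sq2 y)^-1))).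
    move=> y oy y0; have [_ e _ _ _] := imO_relations oy y0.
    have -> : imO 3 0 y = - ((imO 0 3 y - 1) * sq2 y * (sq2 y)^-1 + 1).
      by rewrite imO_anti// mulfK ?rV// subrK.
    by rewrite e; ring.
  by der; rewrite !delta4E /=; ring.
have c2 := imO_closed 0 1 2 oz; have c3 := imO_closed 0 1 3 oz.
have aux (p q r : R) : p + q + r = 0 -> r = - p - q.
  by move=> /eqP; rewrite addrC addr_eq0 opprD => /eqP.
split.
- by rewrite (aux _ _ _ c2) E12 E20; field; exact: rV.
- by rewrite (aux _ _ _ c3) E13 E30; field; exact: rV.
Qed.

(** Along a X1 + b X2 the entry 01 grows at rate 2a, the same rate as |z2|^2 in [sq2_frame]; hence
    their quotient [Hcoef] is constant along the flows. *)
Lemma imO01_frame z (a b : R) : over (disc eps) z -> z2 z != 0 ->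
  \sum_i (mk4 0 0 a b *m frame z) 0 i * pd i (imO 0 1) z = 2 * a * imO 0 1 z.
Proof.
move=> oz z0; have [e2 e3] := imO_pd01 oz z0.
have r0 := lt0r_neq0 (sq2_gt0 z0).
rewrite mul_frame !mk4E sum4 !mk4E.
exact: hamiltonian_direction r0 e2 e3.
Qed.

Lemma sq2_frame z (a b : R) : z2 z != 0 ->
  \sum_i (mk4 0 0 a b *m frame z) 0 i * pd i (@sq2 R) z = 2 * a * sq2 z.
Proof.
move=> z0.
have pdr i : pd i (@sq2 R) z = 2 * z 0 2 * (i == 2)%:R + 2 * z 0 3 * (i == 3)%:R.
  by move: i; apply: ord4P; apply: is_derive_pd; rewrite /sq2; der; rewrite !delta4E /=; ring.
by rewrite mul_frame !mk4E sum4 !mk4E !pdr /= /sq2; ring.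
Qed.

(* Omega = dz1 /\ dz2 + i Hcoef dc1 /\ dc2 where z2 != 0; hcoef is the
   restriction of Hcoef to the section (c, 1). *)
Definition Hcoef z : R := imO 0 1 z / sq2 z.

Definition hcoef c : R := imO 0 1 (mk4 (c 0 0) (c 0 1) 1 0).

Lemma T_0 c : T (mk4 (c 0 0) (c 0 1) 0 0) = mk4 (c 0 0) (c 0 1) 1 0.
Proof.
by apply: row4_eq; rewrite TE !mk4E ?(oppr0, expR0, cos0, sin0); ring.
Qed.

(* The Hamiltonian flows of c1 and c2 preserve Hcoef since d Omega = 0. *)
Lemma Hcoef_T x : disc eps (base x) -> Hcoef (T x) = hcoef (base x).
Proof.
(* Rescaling the flow times by s joins the section (c, 1) at s = 0 to [T x] at s = 1 inside one
   fibre. *)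
move=> dx; pose X s := mk4 (x 0 0) (x 0 1) (s * x 0 2) (s * x 0 3).
have X1 : X 1 = x by apply: row4_eq; rewrite mk4E ?mul1r.
have bX s : base (X s) = base x by rewrite /base !mk4E.
have oX s : over (disc eps) (T (X s)) by rewrite /over /= pican_T bX.
have dX s : is_derive (s : R) 1 X (mk4 0 0 (x 0 2) (x 0 3)).
  apply: is_derive_row; apply: ord4P; rewrite mk4E.
  - by rewrite (funext (fun s => mk4_0 _ _ (s * x 0 2) (s * x 0 3))); der.
  - by rewrite (funext (fun s => mk4_1 _ _ (s * x 0 2) (s * x 0 3))); der.
  - by rewrite (funext (fun s => mk4_2 (x 0 0) (x 0 1) (s * x 0 2) (s * x 0 3))); der; ring.
  - by rewrite (funext (fun s => mk4_3 (x 0 0) (x 0 1) (s * x 0 2) (s * x 0 3))); der; ring.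
have dH (s : R) : is_derive s 1 (fun s => Hcoef (T (X s))) 0.
  have dT := is_derive_comp_T (dX s).
  set z := T (X s) in dT.
  have oz : over (disc eps) z by exact: oX.
  have z0 : z2 z != 0 by exact: z2_T.
  have dn : is_derive s 1 (fun s => imO 0 1 (T (X s))) (2 * x 0 2 * imO 0 1 z).
    have D : differentiable (imO 0 1) (T (X s)).
      exact: (smooth_on_differentiable (imO_smooth 0 1)).
    apply: is_derive_eqr (is_derive_comp_row (fun i => is_derive_coord i dT) D) _.
    exact: imO01_frame.
  have dr : is_derive s 1 (fun s => sq2 (T (X s))) (2 * x 0 2 * sq2 z).
    apply: is_derive_eqr
      (is_derive_comp_row (fun i => is_derive_coord i dT) (differentiable_sq2 _)) _.
    exact: sq2_frame.
  have r0 := lt0r_neq0 (sq2_gt0 z0).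
  rewrite /Hcoef; eapply is_derive_eqr.
    eapply is_deriveMr; first exact: dn.
    by eapply is_deriveVr; [exact: r0|exact: dr].
  by cbv beta; rewrite -/z; field.
have [s _ E] := @MVT_segment R (fun s => Hcoef (T (X s))) (fun=> 0) 0 1 ler01
  (fun s _ => dH s) (derivable_within_continuous (fun s _ => @ex_derive _ _ _ _ _ _ _ (dH s))).
move/eqP: E; rewrite mul0r subr_eq0 X1 => /eqP ->.
have -> : X 0 = mk4 (base x 0 0) (base x 0 1) 0 0.
  by apply: row4_eq; rewrite !mk4E ?mk2E ?mul0r.
rewrite T_0 /Hcoef /hcoef /sq2 !mk4E expr1n expr0n addr0 divr1 //.
Qed.

End CompatibleForm.

(** * Polar coordinates and surjectivity of T *)

Section Polar.
Variable R : realType.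

Lemma polar_angle (a b : R) : a ^+ 2 + b ^+ 2 = 1 -> exists t, a = cos t /\ b = sin t.
Proof.
move=> ab; have a1 : -1 <= a <= 1 by apply/andP; split; nra.
have ca : cos (acos a) = a by rewrite acosK// in_itv.
have sa : sin (acos a) = `|b|.
  by rewrite sin_acos// (_ : 1 - a ^+ 2 = b ^+ 2) ?sqrtr_sqr//; rewrite -ab; ring.
have [b0|b0] := leP 0 b.
  by exists (acos a); rewrite ca sa ger0_norm.
by exists (- acos a); rewrite cosN sinN ca sa ltr0_norm// opprK.
Qed.

Lemma modulus_gt0 (c : 'rV[R]_2) : c != 0 -> 0 < modulus c.
Proof.
move=> c0; rewrite sqrtr_gt0 lt_def addr_ge0 ?sqr_ge0// andbT.
apply: contra c0; rewrite paddr_eq0 ?sqr_ge0// !sqrf_eq0 => /andP[/eqP e0 /eqP e1].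
by apply/eqP/row2_eq; rewrite mxE.
Qed.

Lemma modulus_sqr (c : 'rV[R]_2) : modulus c ^+ 2 = c 0 0 ^+ 2 + c 0 1 ^+ 2.
Proof. by rewrite sqr_sqrtr// addr_ge0 ?sqr_ge0. Qed.

Lemma polar_form (c : 'rV[R]_2) : c != 0 ->
  exists t, c 0 0 = modulus c * cos t /\ c 0 1 = modulus c * sin t.
Proof.
move=> /modulus_gt0 r0; have r1 := lt0r_neq0 r0.
have [t [ct st]] : exists t, c 0 0 / modulus c = cos t /\ c 0 1 / modulus c = sin t.
  apply: polar_angle; rewrite !exprMn -mulrDl -modulus_sqr -exprMn divff//.
  by rewrite expr1n.
by exists t; rewrite -ct -st ![modulus c * _]mulrC !divfK.
Qed.

(** Since z2 = e^(t1 - i t2), the times are ln|z2| and minus an argument of z2; z1 is then forced by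
    c = z1 z2. *)
Lemma T_surj (z : 'rV[R]_4) : z2 z != 0 -> exists x, z = T x.
Proof.
move=> z0; have c0 : mk2 (z 0 2) (z 0 3) != 0.
  apply: contra z0 => /eqP e; rewrite /z2.
  have := congr1 (fun c : 'rV[R]_2 => c 0 0) e; have := congr1 (fun c : 'rV[R]_2 => c 0 1) e.
  by rewrite !mk2E !mxE => -> ->.
have [t [ct st]] := polar_form c0; have r0 := modulus_gt0 c0.
move: (modulus _) r0 ct st => r r0; rewrite !mk2E => ct st.
pose x := mk4 (pican z 0 0) (pican z 0 1) (ln r) (- t).
have z2x : z2 (T x) = z2 z.
  rewrite z2_mkC2 /cexp /x !mk4E /= lnK// opprK /z2.
  by rewrite ct st; simpc.
have z1x : z1 (T x) = z1 z.
  apply: (mulIf z0); rewrite -toC_pican -z2x -toC_pican pican_T.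
  by rewrite /x base_mk4.
by exists x; rewrite -(mkC2K z) -z1x -z2x mkC2K.
Qed.

End Polar.

(** * Explicit coefficients of Omega *)

Section FormCoefficients.
Variables (R : realType) (eps : R) (S : 'rV[R]_2 -> R) (Omega : 'rV[R]_4 -> 'M[R[i]]_4).
Implicit Types (z x : 'rV[R]_4) (c : 'rV[R]_2).
Hypothesis smooth_S : smooth_on setT S.
Hypothesis compatible_Omega : compatible eps S Omega.
Local Notation H := (Hcoef Omega).
Local Notation h := (hcoef Omega).
Local Notation N := (imO Omega).

Lemma Hcoef_pican z : over (disc eps) z -> z2 z != 0 -> H z = h (pican z).
Proof.
move=> + /T_surj[x zE]; rewrite zE /over /= pican_T => dx.
exact: (Hcoef_T compatible_Omega).
Qed.

(** The 0-1 terms are the entries of Im (dz1 /\ dz2) = dx1 /\ dy2 + dy1 /\ dx2, the last term those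
    of H dc1 /\ dc2. *)
Lemma imO_formula z i j : over (disc eps) z -> z2 z != 0 ->
  N i j z = (0 == i)%:R * (3 == j)%:R + (1 == i)%:R * (2 == j)%:R
    - (0 == j)%:R * (3 == i)%:R - (1 == j)%:R * (2 == i)%:R
    + H z * (dc_re z 0 i * dc_im z 0 j - dc_re z 0 j * dc_im z 0 i).
Proof.
move=> oz z0; have r0 := lt0r_neq0 (sq2_gt0 z0).
have [e02 e03 e12 e13 e23] := imO_relations compatible_Omega oz z0.
have f02 : N 0 2 z = H z * (z 0 2 * z 0 1 - z 0 0 * z 0 3).
  by rewrite /Hcoef mulrAC -e02 mulfK.
have f03 : N 0 3 z = 1 + H z * (z 0 0 * z 0 2 + z 0 1 * z 0 3).
  by rewrite /Hcoef mulrAC -e03 mulfK// addrC subrK.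
have f12 : N 1 2 z = 1 - H z * (z 0 0 * z 0 2 + z 0 1 * z 0 3).
  by rewrite /Hcoef mulrAC -mulNr -mulNr -e12 mulfK// addrC subrK.
have f13 : N 1 3 z = H z * (z 0 2 * z 0 1 - z 0 0 * z 0 3).
  by rewrite /Hcoef mulrAC -e13 mulfK.
have f23 : N 2 3 z = H z * (z 0 0 ^+ 2 + z 0 1 ^+ 2).
  by rewrite /Hcoef mulrAC -e23 mulfK.
have f01 : N 0 1 z = H z * (z 0 2 ^+ 2 + z 0 3 ^+ 2).
  by rewrite /Hcoef divfK.
have anti k l : N k l z = - N l k z by exact: (imO_anti compatible_Omega).
have diag k : N k k z = 0 by have := anti k k; lra.
move: i j; apply: ord4P; apply: ord4P; rewrite ?diag !mk4E /=;
  rewrite ?(anti 1 0) ?(anti 2 0) ?(anti 3 0) ?(anti 2 1) ?(anti 3 1) ?(anti 3 2);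
  rewrite ?f01 ?f02 ?f03 ?f12 ?f13 ?f23; ring.
Qed.

Lemma imO_bilinear z (U W : 'I_4 -> R) : over (disc eps) z -> z2 z != 0 ->
  \sum_i \sum_j U i * W j * N i j z =
  U 0 * W 3 - U 3 * W 0 + U 1 * W 2 - U 2 * W 1 + H z *
  ((\sum_i U i * dc_re z 0 i) * (\sum_j W j * dc_im z 0 j)
   - (\sum_i U i * dc_im z 0 i) * (\sum_j W j * dc_re z 0 j)).
Proof.
move=> oz z0; rewrite !sum4 !imO_formula// /=; ring.
Qed.

Lemma reO_bilinear z (U W : 'I_4 -> R) : over (disc eps) z ->
  \sum_i \sum_j U i * W j * complex.Re (Omega z i j) =
  U 0 * W 2 - U 2 * W 0 - U 1 * W 3 + U 3 * W 1.
Proof.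
by move=> oz; rewrite !sum4 !(reO compatible_Omega)// !omega_canE /=; ring.
Qed.

Lemma dc_frame z (a : 'rV[R]_4) : z2 z != 0 ->
  (\sum_i (a *m frame z) 0 i * dc_re z 0 i = a 0 0) *
  (\sum_i (a *m frame z) 0 i * dc_im z 0 i = a 0 1).
Proof.
move=> z0; have := lt0r_neq0 (sq2_gt0 z0); rewrite !sum4 mul_frame !mk4E /sq2 => r0.
by split; field.
Qed.

(** In frame coordinates this is Im (dc /\ d(t1 - i t2)) + H dc1 /\ dc2; [reO_frame] is the
    corresponding real part. *)
Lemma imO_frame z (a b : 'rV[R]_4) : over (disc eps) z -> z2 z != 0 ->
  \sum_i \sum_j (a *m frame z) 0 i * (b *m frame z) 0 j * N i j z =
  H z * (a 0 0 * b 0 1 - a 0 1 * b 0 0)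
  - (a 0 0 * b 0 3 - a 0 3 * b 0 0) + (a 0 1 * b 0 2 - a 0 2 * b 0 1).
Proof.
move=> oz z0; rewrite imO_bilinear// !dc_frame// !mul_frame !mk4E.
have := lt0r_neq0 (sq2_gt0 z0); rewrite /sq2 => r0.
by field.
Qed.

Lemma reO_frame z (a b : 'rV[R]_4) : over (disc eps) z -> z2 z != 0 ->
  \sum_i \sum_j (a *m frame z) 0 i * (b *m frame z) 0 j * complex.Re (Omega z i j) =
  (a 0 0 * b 0 2 - a 0 2 * b 0 0) + (a 0 1 * b 0 3 - a 0 3 * b 0 1).
Proof.
move=> oz z0; rewrite reO_bilinear// !mul_frame !mk4E.
have := lt0r_neq0 (sq2_gt0 z0); rewrite /sq2 => r0.
by field.
Qed.

(** The Jacobian is real, so pulling back commutes with real and imaginary parts. *)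
Lemma pull2E n m (f : 'rV[R]_n.+1 -> 'rV[R]_m.+1) (A : 'rV[R]_m.+1 -> 'M[R[i]]_m.+1) y i j :
  pull2 f A y i j = (
    (\sum_k \sum_l jacobian f y i k * jacobian f y j l * complex.Re (A (f y) k l))
    +i* (\sum_k \sum_l jacobian f y i k * jacobian f y j l * complex.Im (A (f y) k l)))%C.
Proof.
have E : pull2 f A y i j = \sum_k \sum_l
    ((jacobian f y i k * jacobian f y j l)%:C)%C * A (f y) k l.
  rewrite mxE exchange_big/=; apply: eq_bigr => l _.
  rewrite !mxE mulr_suml; apply: eq_bigr => k _; rewrite !mxE.
  by rewrite rmorphM/=; ring.
have ReS p (F : 'I_p -> R[i]) : complex.Re (\sum_k F k) = \sum_k complex.Re (F k).
  by elim/big_rec2 : _ => // k a b _ <-; rewrite ReD.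
have ImS p (F : 'I_p -> R[i]) : complex.Im (\sum_k F k) = \sum_k complex.Im (F k).
  by elim/big_rec2 : _ => // k a b _ <-; rewrite ImD.
rewrite E; apply/eqP; rewrite eq_complex /= !ReS !ImS; apply/andP; split; apply/eqP.
- by apply: eq_bigr => k _; rewrite ReS; apply: eq_bigr => l _; rewrite ReZ.
- by apply: eq_bigr => k _; rewrite ImS; apply: eq_bigr => l _; rewrite ImZ.
Qed.

End FormCoefficients.
Lemma is_derive_unique (R : realType) (V W : normedModType R) (f : V -> W) x v a b :
  is_derive x v f a -> is_derive x v f b -> a = b.
Proof. by move=> [_ <-] [_ <-]. Qed.

(** * The image of the section under psi *)

Section PsiRow.
Variable R : realType.

Lemma expRN_mul (t : R) : expR t * expR (- t) = 1.
Proof. by rewrite -expRD subrr expR0. Qed.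

Variables s t c0 c1 : R.

(* The derivative of psi (c, 1) = (e^(s - it), c e^(-s + it)) when s, t and c
   vary at the rates p, q and (a, b). *)
Definition dpsi_row (p q a b : R) : 'rV[R]_4 := mk4
  (expR s * (p * cos t - q * sin t)) (- (expR s * (p * sin t + q * cos t)))
  (expR (- s) * (cos t * (a - p * c0 - q * c1) - sin t * (b - p * c1 + q * c0)))
  (expR (- s) * (sin t * (a - p * c0 - q * c1) + cos t * (b - p * c1 + q * c0))).

(** With sigma = s - i t, z1 = e^sigma and z2 = c e^(-sigma) give dz1 /\ dz2 = dsigma /\ dc; here is
    the real part, and [dpsi_row_im] is the imaginary part. *)
Lemma dpsi_row_re p q a b p' q' a' b' :
  let U := dpsi_row p q a b in let W := dpsi_row p' q' a' b' in
  U 0 0 * W 0 2 - U 0 2 * W 0 0 - U 0 1 * W 0 3 + U 0 3 * W 0 1 =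
  p * a' + q * b' - (p' * a + q' * b).
Proof.
rewrite /dpsi_row !mk4E.
transitivity (expR s * expR (- s) * (cos t ^+ 2 + sin t ^+ 2) *
   (p * a' + q * b' - (p' * a + q' * b))); first by ring.
by rewrite expRN_mul cos2Dsin2 !mul1r.
Qed.

Lemma dpsi_row_im p q a b p' q' a' b' :
  let U := dpsi_row p q a b in let W := dpsi_row p' q' a' b' in
  U 0 0 * W 0 3 - U 0 3 * W 0 0 + U 0 1 * W 0 2 - U 0 2 * W 0 1 =
  p * b' - q * a' - (p' * b - q' * a).
Proof.
rewrite /dpsi_row !mk4E.
transitivity (expR s * expR (- s) * (cos t ^+ 2 + sin t ^+ 2) *
   (p * b' - q * a' - (p' * b - q' * a))); first by ring.
by rewrite expRN_mul cos2Dsin2 !mul1r.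
Qed.

(** The two components of psi (c, 1) multiply to c, so dc of the row is just the rate (a, b) of
    c. *)
Lemma dpsi_row_dc p q a b :
  let z := mk4 (expR s * cos t) (- (expR s * sin t))
    (expR (- s) * (cos t * c0 - sin t * c1)) (expR (- s) * (sin t * c0 + cos t * c1)) in
  (\sum_i dpsi_row p q a b 0 i * dc_re z 0 i = a) *
  (\sum_i dpsi_row p q a b 0 i * dc_im z 0 i = b).
Proof.
move=> z; rewrite !sum4 /dpsi_row /dc_re /dc_im /z !mk4E; split.
- transitivity (expR s * expR (- s) * (cos t ^+ 2 + sin t ^+ 2) * a); first by ring.
  by rewrite expRN_mul cos2Dsin2 !mul1r.
- transitivity (expR s * expR (- s) * (cos t ^+ 2 + sin t ^+ 2) * b); first by ring.
  by rewrite expRN_mul cos2Dsin2 !mul1r.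
Qed.

End PsiRow.

(** * Harmonicity of S from invariance on the section *)

Section Harmonicity.
Variables (R : realType) (eps : R) (S : 'rV[R]_2 -> R) (Omega : 'rV[R]_4 -> 'M[R[i]]_4).
Implicit Types (z x : 'rV[R]_4) (c : 'rV[R]_2).
Hypothesis smooth_S : smooth_on setT S.
Hypothesis compatible_Omega : compatible eps S Omega.
Local Notation H := (Hcoef Omega).
Local Notation h := (hcoef Omega).
Local Notation N := (imO Omega).
Local Notation s1 := (S1 S).
Local Notation s2 := (S2 S).

(** The section Pi_1, which [psi] carries to Pi_2. *)
Definition slice c : 'rV[R]_4 := mk4 (c 0 0) (c 0 1) 1 0.

Lemma pican_slice c : pican (slice c) = c.
Proof. by apply: row2_eq; rewrite picanE !mk4E; ring. Qed.

Lemma sq2_slice c : sq2 (slice c) = 1.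
Proof. by rewrite /sq2 !mk4E; ring. Qed.

Lemma z2_slice c : z2 (slice c) != 0.
Proof. by rewrite z2_neq0 -/(sq2 _) sq2_slice oner_eq0. Qed.

Lemma is_derive_slice c v : is_derive c v slice (mk4 (v 0 0) (v 0 1) 0 0).
Proof.
apply: is_derive_row; apply: ord4P; rewrite ?/dpsi_slice ?/dpsi_row mk4E.
- by rewrite (funext (fun c : 'rV[R]_2 => mk4_0 (c 0 0) (c 0 1) 1 0)); der.
- by rewrite (funext (fun c : 'rV[R]_2 => mk4_1 (c 0 0) (c 0 1) 1 0)); der.
- by rewrite (funext (fun c : 'rV[R]_2 => mk4_2 (c 0 0) (c 0 1) 1 0)); der.
- by rewrite (funext (fun c : 'rV[R]_2 => mk4_3 (c 0 0) (c 0 1) 1 0)); der.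
Qed.

Lemma psi_slice c : psi S (slice c) = mk4
  (expR (s1 c) * cos (s2 c)) (- (expR (s1 c) * sin (s2 c)))
  (expR (- s1 c) * (cos (s2 c) * c 0 0 - sin (s2 c) * c 0 1))
  (expR (- s1 c) * (sin (s2 c) * c 0 0 + cos (s2 c) * c 0 1)).
Proof.
apply: row4_eq; rewrite ?psi0 ?psi1 ?psi2 ?psi3 pican_slice ?sq2_slice !mk4E ?divr1; ring.
Qed.

Definition dpsi_slice c v : 'rV[R]_4 :=
  dpsi_row (s1 c) (s2 c) (c 0 0) (c 0 1) ('D_v s1 c) ('D_v s2 c) (v 0 0) (v 0 1).

Lemma is_derive_psi_slice c v :
  is_derive c v (fun c => psi S (slice c)) (dpsi_slice c v).
Proof.
have d1 : is_derive c v s1 ('D_v s1 c).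
  by apply/derivableP/diff_derivable; exact: differentiable_S1.
have d2 : is_derive c v s2 ('D_v s2 c).
  by apply/derivableP/diff_derivable; exact: differentiable_S2.
have G (f g : 'rV[R]_2 -> R) p q : is_derive c v f p -> is_derive c v g q ->
  [/\ is_derive c v (fun c => expR (f c) * cos (g c))
        (expR (f c) * (p * cos (g c) - q * sin (g c))),
      is_derive c v (fun c => - (expR (f c) * sin (g c)))
        (- (expR (f c) * (p * sin (g c) + q * cos (g c)))),
      is_derive c v (fun c => expR (- f c) * (cos (g c) * c 0 0 - sin (g c) * c 0 1))
        (expR (- f c) * (cos (g c) * (v 0 0 - p * c 0 0 - q * c 0 1)
                    - sin (g c) * (v 0 1 - p * c 0 1 + q * c 0 0)))
    & is_derive c v (fun c => expR (- f c) * (sin (g c) * c 0 0 + cos (g c) * c 0 1))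
        (expR (- f c) * (sin (g c) * (v 0 0 - p * c 0 0 - q * c 0 1)
                    + cos (g c) * (v 0 1 - p * c 0 1 + q * c 0 0)))].
  by move=> df dg; split; der; ring.
have [g0 g1 g2 g3] := G _ _ _ _ d1 d2.
have eq f j : (forall c, psi S (slice c) 0 j = f c) -> forall df,
    is_derive c v f df -> is_derive c v (fun c => psi S (slice c) 0 j) df.
  by move=> /funext -> df.
apply: is_derive_row; apply: ord4P; rewrite ?/dpsi_slice ?/dpsi_row mk4E.
- by refine (eq _ _ _ _ g0) => y; rewrite psi_slice mk4E.
- by refine (eq _ _ _ _ g1) => y; rewrite psi_slice mk4E.
- by refine (eq _ _ _ _ g2) => y; rewrite psi_slice mk4E.
- by refine (eq _ _ _ _ g3) => y; rewrite psi_slice mk4E.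
Qed.

(** The first two coordinate directions are tangent to the section, where psi has a simple closed
    form, so these rows come from differentiating psi along it. No other row is required for the
    entry (0, 1) of the pull-back. *)
Lemma jacobian_psi_slice c j :
  (jacobian (psi S) (slice c) 0 j = dpsi_slice c (delta_mx 0 0) 0 j) *
  (jacobian (psi S) (slice c) 1 j = dpsi_slice c (delta_mx 0 1) 0 j).
Proof.
have D v := is_derive_jacobian j (is_derive_slice c v)
  (differentiable_psi smooth_S (z2_slice c)).
have E v := is_derive_unique (D v) (is_derive_coord j (is_derive_psi_slice c v)).
split; rewrite -E sum4 !mk4E !delta2E /=; ring.
Qed.

Lemma slice_over c : disc eps c -> over (disc eps) (slice c).
Proof. by rewrite /over /= pican_slice. Qed.

Lemma psi_slice_over c : disc eps c -> over (disc eps) (psi S (slice c)).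
Proof. by move=> dc; rewrite /over /= pican_psi ?pican_slice//; exact: z2_slice. Qed.

Lemma pull2_psi_slice c : disc eps c ->
  pull2 (psi S) Omega (slice c) 0 1 = Omega (slice c) 0 1.
Proof.
move=> dc; case: compatible_Omega => -[_ _ inv] _ _ _.
by rewrite inv//; [exact: slice_over|exact: z2_slice].
Qed.

Lemma dpsi_slice_dc c v :
  (\sum_i dpsi_slice c v 0 i * dc_re (psi S (slice c)) 0 i = v 0 0) *
  (\sum_i dpsi_slice c v 0 i * dc_im (psi S (slice c)) 0 i = v 0 1).
Proof. by rewrite psi_slice /dpsi_slice; split; rewrite dpsi_row_dc. Qed.

(** omega_can vanishes on the section, hence by invariance on its image, where it is Re (d(S_1 - i
    S_2) /\ dc). This argument also holds at c = 0. *)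
Lemma S_mixed c : disc eps c -> pd 0 s2 c = pd 1 s1 c.
Proof.
move=> dc; have := congr1 (@complex.Re R) (pull2_psi_slice dc).
rewrite pull2E /= (reO_bilinear compatible_Omega); last exact: psi_slice_over.
rewrite (reO compatible_Omega) ?omega_canE; last exact: slice_over.
rewrite !jacobian_psi_slice dpsi_row_re !delta2E.
have aux (p q p' q' : R) : p * (0 == 1 :> 'I_2)%:R + q * (1 == 1 :> 'I_2)%:R -
    (p' * (0 == 0 :> 'I_2)%:R + q' * (1 == 0 :> 'I_2)%:R) = 0 -> q = p'.
  by move=> /=; lra.
by move=> E; apply: (aux _ _ _ _ (etrans E _)) => /=; ring.
Qed.

Lemma psi_slice_z2 c : c != 0 -> z2 (psi S (slice c)) != 0.
Proof.
move=> c0; have : toC (pican (psi S (slice c))) != 0.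
  rewrite pican_psi ?pican_slice ?z2_slice//.
  apply: contra c0 => /eqP[e0 e1]; apply/eqP/row2_eq; rewrite mxE //.
by rewrite toC_pican mulf_eq0 negb_or => /andP[].
Qed.

(** Imaginary part of the same invariance: [Hcoef] depends on c alone and psi preserves c, so h
    cancels and Im (d(S_1 - i S_2) /\ dc) = 0 remains. [imO_bilinear] requires z2 <> 0 at the image
    point, hence c <> 0. *)
Lemma S_laplace_pdisc c : pdisc eps c -> pd 0 s1 c + pd 1 s2 c = 0.
Proof.
move=> [dc c0]; have z0 := psi_slice_z2 c0.
have oz := psi_slice_over dc.
have := congr1 (@complex.Im R) (pull2_psi_slice dc).
rewrite pull2E /= -/(imO _ _ _ _) (imO_bilinear compatible_Omega)//.
have -> : imO Omega 0 1 (slice c) = h c by [].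
have J (i : 'I_2) (k : 'I_4) : (i == 0) && (k == 0) || (i == 1) && (k == 1) ->
   (\sum_j jacobian (psi S) (slice c) k j * dc_re (psi S (slice c)) 0 j = (i == 0)%:R) *
   (\sum_j jacobian (psi S) (slice c) k j * dc_im (psi S (slice c)) 0 j = (i == 1)%:R).
  move=> ik; have E j : jacobian (psi S) (slice c) k j = dpsi_slice c (delta_mx 0 i) 0 j.
    by case/orP: ik => /andP[/eqP -> /eqP ->]; rewrite jacobian_psi_slice.
  have [e0 e1] := dpsi_slice_dc c (delta_mx 0 i).
  rewrite delta2E eq_sym in e0; rewrite delta2E eq_sym in e1.
  by split; rewrite -?e0 -?e1; apply: eq_bigr => j _; rewrite E.
rewrite (J 0 0)// (J 0 0)// (J 1 1)// (J 1 1)// !jacobian_psi_slice dpsi_row_im !delta2E.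
rewrite (Hcoef_pican compatible_Omega)// pican_psi ?pican_slice ?z2_slice//.
have aux (p q p' q' r : R) : p * (1 == 1 :> 'I_2)%:R - q * (0 == 1 :> 'I_2)%:R -
    (p' * (1 == 0 :> 'I_2)%:R - q' * (0 == 0 :> 'I_2)%:R)
    + r * ((0 == 0 :> 'I_2)%:R * (1 == 1 :> 'I_2)%:R - (0 == 1 :> 'I_2)%:R * (1 == 0 :> 'I_2)%:R)
   = r -> p + q' = 0.
  by move=> /=; lra.
exact: aux.
Qed.

Lemma S_laplace c : 0 < eps -> disc eps c -> pd 0 s1 c + pd 1 s2 c = 0.
Proof.
move=> e0 dc; have [->|c0] := eqVneq c 0; last exact: S_laplace_pdisc.
pose L c := pd 0 s1 c + pd 1 s2 c.
have cL : {for 0, continuous L}.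
  apply: continuousDr; apply: differentiable_continuousr.
  - exact: (smooth_S [:: 0; 0]).
  - exact: (smooth_S [:: 1; 1]).
(* The origin is approached along the real axis, on which the Laplacian vanishes away from 0. *)
pose g (t : R) := mk2 t 0.
have g0 : g 0 = 0 by apply: row2_eq; rewrite !mk2E mxE.
have cg : {for 0, continuous g}.
  apply: continuous_row; apply: ord2P.
  - by rewrite (funext (fun t => mk2_0 t 0)); exact: continuous_idr.
  - by rewrite (funext (fun t => mk2_1 t 0)); exact: continuous_cstr.
have cLg : {for 0, continuous (fun t => L (g t))}.
  by apply: (continuous_compr (F := L)); rewrite ?g0.
have L1 : L (g t) @[t --> 0^'] --> L 0.
  by rewrite -g0; apply: cvg_within_filter; exact: cLg.
have L0 : L (g t) @[t --> 0^'] --> (0 : R).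
  have : (cst 0 : R -> R) t @[t --> 0^'] --> (0 : R) by exact: cvg_cst.
  apply: cvg_trans; apply: near_eq_cvg; near=> t.
  rewrite /L /= S_laplace_pdisc//; split.
  - rewrite /disc /= /modulus !mk2E expr0n addr0 sqrtr_sqr.
    by near: t; exact: dnbhs0_lt.
  - apply/eqP => /(congr1 (fun c : 'rV[R]_2 => c 0 0)); rewrite mk2E mxE.
    by apply/eqP; near: t; exact: nbhs_dnbhs_neq.
exact: (cvg_unique _ L1 L0).
Unshelve. all: by end_near. Qed.

Lemma S_harmonic : 0 < eps -> harmonic_on (disc eps) S.
Proof. by move=> e0; split=> [s c _|c]; [exact: smooth_S|exact: S_laplace]. Qed.

(** The section is affine with c as its first two coordinates, so iterated partials of h are the
    partials of [imO 0 1] in the same directions, restricted to it; no division by |z2|^2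
    intervenes. *)
Lemma hcoef_smooth : smooth_on (disc eps) h.
Proof.
have sN := imO_smooth compatible_Omega 0 1.
pose lift4 (i : 'I_2) : 'I_4 := widen_ord (isT : (2 <= 4)%N) i.
have dsl c : differentiable slice c.
  apply: differentiable_row; apply: ord4P.
  - by rewrite (funext (fun c : 'rV[R]_2 => mk4_0 (c 0 0) (c 0 1) 1 0)); dif.
  - by rewrite (funext (fun c : 'rV[R]_2 => mk4_1 (c 0 0) (c 0 1) 1 0)); dif.
  - by rewrite (funext (fun c : 'rV[R]_2 => mk4_2 (c 0 0) (c 0 1) 1 0)); dif.
  - by rewrite (funext (fun c : 'rV[R]_2 => mk4_3 (c 0 0) (c 0 1) 1 0)); dif.
have nd c : disc eps c -> nbhs c (disc eps).
  by move=> dc; apply: open_nbhs_nbhs; split=> //; exact: open_disc.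
have E s c : disc eps c ->
    foldr (@pd R 1) h s c = foldr (@pd R 3) (imO Omega 0 1) (map lift4 s) (slice c).
  elim: s c => [//|i s IH] c dc /=.
  have dF := sN (map lift4 s) _ (slice_over dc).
  rewrite (near_pd (g := fun c => foldr (@pd R 3) (imO Omega 0 1) (map lift4 s) (slice c))).
    apply: is_derive_pd; apply: is_derive_eqr.
      apply: is_derive_comp_row => [j|//].
      exact: (is_derive_coord j (is_derive_slice c (delta_mx 0 i))).
    move: i; apply: ord2P; rewrite sum4 !mk4E !delta2E /=.
    - by rewrite !mul0r mul1r !addr0; congr (pd _ _ _); exact: val_inj.
    - by rewrite !mul0r mul1r !addr0 add0r; congr (pd _ _ _); exact: val_inj.
  by apply: filterS (nd c dc) => y; exact: IH.
move=> s c dc.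
apply: (@near_differentiable _ _ _
  (fun c => foldr (@pd R 3) (imO Omega 0 1) (map lift4 s) (slice c))).
  by apply: filterS (nd c dc) => y /E ->.
apply: (differentiable_comp (f := slice)) => //.
exact: (sN (map lift4 s) _ (slice_over dc)).
Qed.

End Harmonicity.
(** U is star-shaped about [p], hence a union of segments through [p]. *)
Lemma segment_closed_connected (R : realType) n (U : set 'rV[R]_n) p :
  U p -> (forall q (t : R), U q -> 0 <= t <= 1 -> U (t *: (q - p) + p)) -> connected U.
Proof.
move=> Up H; pose f q (t : R) := t *: (q - p) + p.
have -> : U = \bigcup_(q in U) (f q @` `[0, 1]).
  apply/seteqP; split => [q Uq|_ [q Uq] [t /= + <-]].
    exists q => //; exists 1; first by rewrite /= in_itv/= ler01 lexx.
    by rewrite /f scale1r subrK.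
  by rewrite in_itv/=; exact: H.
apply: bigcup_connected.
  exists p => q Uq; exists 0; first by rewrite /= in_itv/= ler01 lexx.
  by rewrite /f scale0r add0r.
move=> q _; apply: connected_continuous_connected; first exact: segment_connected.
apply: continuous_subspaceT => t; apply: continuous_row => i.
have -> : (fun y => f q y 0 i) = (fun y => y * (q - p) 0 i + p 0 i).
  by apply: funext => y; rewrite /f !mxE.
exact: continuous_affine.
Qed.

(** * Branches of the argument *)

Section ArgBranches.
Variable R : realType.
Implicit Types (c v : 'rV[R]_2) (a : R).

(** [rot_re] and [rot_im] are the real and imaginary parts of e^(-ia) c; [arg_near a] is the branch
    on the half-plane [rot_re a c > 0] with values within pi/2 of a. *)
Definition rot_re a c : R := cos a * c 0 0 + sin a * c 0 1.
Definition rot_im a c : R := cos a * c 0 1 - sin a * c 0 0.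
Definition arg_near a c : R := a + atan (rot_im a c / rot_re a c).

Lemma rot_sqr a c : rot_re a c ^+ 2 + rot_im a c ^+ 2 = modulus c ^+ 2.
Proof.
rewrite modulus_sqr /rot_re /rot_im.
transitivity ((cos a ^+ 2 + sin a ^+ 2) * (c 0 0 ^+ 2 + c 0 1 ^+ 2)); first by ring.
by rewrite cos2Dsin2 mul1r.
Qed.

Lemma rot_re_neq0 a c : 0 < rot_re a c -> c != 0.
Proof. by apply: contraTneq => ->; rewrite /rot_re !mxE !mulr0 addr0 ltxx. Qed.

Lemma arg_near_polar a c : 0 < rot_re a c ->
  c 0 0 = modulus c * cos (arg_near a c) /\ c 0 1 = modulus c * sin (arg_near a c).
Proof.
move=> k0; have m0 := modulus_gt0 (rot_re_neq0 k0).
have kn := lt0r_neq0 k0; have mn := lt0r_neq0 m0.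
have E : cos (atan (rot_im a c / rot_re a c)) = rot_re a c / modulus c.
  rewrite cos_atan -[RHS]invrK invf_div; congr (_^-1).
  rewrite -[RHS]ger0_norm ?divr_ge0 ?ltW// -sqrtr_sqr; congr (Num.sqrt _).
  by rewrite [in RHS]exprMn -(rot_sqr a); field.
have F : sin (atan (rot_im a c / rot_re a c)) = rot_im a c / modulus c.
  have := atanK (rot_im a c / rot_re a c); rewrite {1}/tan E.
  move=> /(congr1 (fun r => r * (rot_re a c / modulus c))).
  rewrite divfK; last by rewrite mulf_neq0// invr_eq0.
  by move=> ->; field; rewrite kn mn.
rewrite /arg_near cosD sinD E F /rot_re /rot_im; split.
- transitivity ((cos a ^+ 2 + sin a ^+ 2) * c 0 0); first by rewrite cos2Dsin2 mul1r.
  by field.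
- transitivity ((cos a ^+ 2 + sin a ^+ 2) * c 0 1); first by rewrite cos2Dsin2 mul1r.
  by field.
Qed.

Lemma is_derive_arg_near a c v : 0 < rot_re a c ->
  is_derive c v (arg_near a) ((c 0 0 * v 0 1 - c 0 1 * v 0 0) / modulus c ^+ 2).
Proof.
move=> k0; have kn := lt0r_neq0 k0; have m0 := lt0r_neq0 (modulus_gt0 (rot_re_neq0 k0)).
have dV : is_derive c v (fun y => (rot_re a y)^-1) (rot_re a v * - rot_re a c ^- 2).
  apply: is_deriveVr => //; rewrite /rot_re; der; ring.
have dI : is_derive c v (rot_im a) (rot_im a v).
  by rewrite /rot_im; der; ring.
have d : is_derive c v (fun y => rot_im a y * (rot_re a y)^-1)
   (rot_im a c * (rot_re a v * - rot_re a c ^- 2) + (rot_re a c)^-1 * rot_im a v).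
  exact: is_deriveMr.
rewrite /arg_near; eapply is_derive_eqr.
  by eapply is_deriveDr; [exact: is_derive_constr|exact: (is_derive_atanr d)].
have mk : modulus c ^+ 2 != 0 by rewrite expf_neq0.
have k2 : 1 + (rot_im a c / rot_re a c) ^+ 2 = modulus c ^+ 2 / rot_re a c ^+ 2.
  by rewrite -(rot_sqr a); field.
rewrite k2 add0r invf_div.
have -> : c 0 0 * v 0 1 - c 0 1 * v 0 0 = rot_re a c * rot_im a v - rot_im a c * rot_re a v.
  rewrite /rot_re /rot_im.
  transitivity ((cos a ^+ 2 + sin a ^+ 2) * (c 0 0 * v 0 1 - c 0 1 * v 0 0)).
    by rewrite cos2Dsin2 mul1r.
  by ring.
by field; rewrite kn m0.
Qed.

Lemma differentiable_rot_re a c : differentiable (rot_re a) c.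
Proof. by rewrite /rot_re; dif. Qed.

Lemma differentiable_arg_near a c : 0 < rot_re a c -> differentiable (arg_near a) c.
Proof.
move=> k0; rewrite /arg_near.
have dV : differentiable (fun y => (rot_re a y)^-1) c.
  by apply: differentiableVr; [exact: lt0r_neq0|exact: differentiable_rot_re].
have dI : differentiable (rot_im a) c by rewrite /rot_im; dif.
by dif.
Qed.

Lemma modulus_segment (e : R) (p q : 'rV[R]_2) (t : R) : 0 <= t <= 1 ->
  modulus p < e -> modulus q < e -> modulus (t *: (q - p) + p) < e.
Proof.
move=> /andP[t0 t1] pe qe.
have e0 : 0 < e by apply: le_lt_trans pe; exact: sqrtr_ge0.
have sq y : (modulus y < e) = (modulus y ^+ 2 < e ^+ 2).
  by rewrite ltr_sqr ?nnegrE ?sqrtr_ge0 ?ltW.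
move: pe qe; rewrite !sq !modulus_sqr !mxE => pe qe.
(* Convexity of the squared modulus, with its exact defect t (1 - t) |q - p|^2. *)
have -> : (t * (q 0 0 - p 0 0) + p 0 0) ^+ 2 + (t * (q 0 1 - p 0 1) + p 0 1) ^+ 2 =
   (1 - t) * (p 0 0 ^+ 2 + p 0 1 ^+ 2) + t * (q 0 0 ^+ 2 + q 0 1 ^+ 2)
   - t * (1 - t) * ((q 0 0 - p 0 0) ^+ 2 + (q 0 1 - p 0 1) ^+ 2) by ring.
have h : 0 <= t * (1 - t) * ((q 0 0 - p 0 0) ^+ 2 + (q 0 1 - p 0 1) ^+ 2).
  by apply: mulr_ge0; [rewrite mulr_ge0 ?subr_ge0|rewrite addr_ge0 ?sqr_ge0].
(* Strictness comes from [q] when t = 1 and from [p] otherwise. *)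
have [t1'|t1'] := eqVneq t 1.
  by rewrite t1' in h *; lra.
have t1p : 0 < 1 - t by rewrite subr_gt0 lt_neqAle t1'.
have h1 : (1 - t) * (p 0 0 ^+ 2 + p 0 1 ^+ 2) < (1 - t) * e ^+ 2 by rewrite ltr_pM2l.
have h2 : t * (q 0 0 ^+ 2 + q 0 1 ^+ 2) <= t * e ^+ 2 by rewrite ler_wpM2l// ltW.
by lra.
Qed.

Lemma toC_polar c a : c 0 0 = modulus c * cos a /\ c 0 1 = modulus c * sin a <->
  toC c = ((modulus c)%:C * (cos a +i* sin a))%C.
Proof.
rewrite /toC; simpc; split => [[e0 e1]|[e0 e1]]; last by rewrite e0 e1.
by congr (_ +i* _)%C.
Qed.

Lemma arg_near_branch (eps a : R) c0 : disc eps c0 -> 0 < rot_re a c0 ->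
  arg_branch eps (disc eps `&` [set c | 0 < rot_re a c]) (arg_near a).
Proof.
move=> dc k0; split.
- apply: openI; first exact: open_disc.
  have -> : [set c | 0 < rot_re a c] = rot_re a @^-1` [set r | 0 < r] by [].
  apply: open_comp; last exact: open_gt.
  by move=> c _; apply: differentiable_continuousr; exact: differentiable_rot_re.
- apply: (@segment_closed_connected _ _ _ c0) => // q t [dq kq] t01; split.
    exact: modulus_segment.
  move: t01 => /andP[t0 t1]; rewrite /= /rot_re !mxE.
  have -> : cos a * (t * (q 0 0 - c0 0 0) + c0 0 0) + sin a * (t * (q 0 1 - c0 0 1) + c0 0 1)
     = t * rot_re a q + (1 - t) * rot_re a c0 by rewrite /rot_re; ring.
  move: kq => /= kq; have [t1'|t1'] := eqVneq t 1.
    by rewrite t1' subrr mul0r addr0 mul1r.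
  have t1p : 0 < 1 - t by rewrite subr_gt0 lt_neqAle t1'.
  by rewrite ltr_wpDl ?mulr_ge0 ?mulr_gt0// ltW.
- by move=> c [dc' kc]; split=> //; exact: rot_re_neq0 kc.
- move=> c [dc' kc]; split.
    by apply: differentiable_continuousr; exact: differentiable_arg_near.
  by apply/toC_polar; exact: arg_near_polar.
Qed.

(** Positivity of Omega is expressed over branch domains; this makes it available at every point of
    the punctured disc. *)
Lemma pdisc_arg_branch (eps : R) c : pdisc eps c -> exists D arg, arg_branch eps D arg /\ D c.
Proof.
move=> [dc /= c0]; have [a [ca sa]] := polar_form c0.
have k0 : 0 < rot_re a c.
  rewrite /rot_re ca sa (_ : _ + _ = modulus c * (cos a ^+ 2 + sin a ^+ 2)); last by ring.
  by rewrite cos2Dsin2 mulr1 modulus_gt0.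
exists (disc eps `&` [set c | 0 < rot_re a c]), (arg_near a); split=> //.
exact: (arg_near_branch dc).
Qed.

(** Continuity keeps arg c - arg c0 within pi/2, where atan inverts tan; so every branch is locally
    an [arg_near], and inherits its derivative. *)
Lemma arg_branch_near (eps : R) (D : set 'rV[R]_2) arg c0 : arg_branch eps D arg -> D c0 ->
  0 < rot_re (arg c0) c0 /\ \forall c \near c0, arg c = arg_near (arg c0) c.
Proof.
move=> [oD _ Dp H] Dc0.
have pos c : D c -> 0 < modulus c by move=> /Dp[_ /= c0']; exact: modulus_gt0.
have rotE c : D c -> rot_re (arg c0) c = modulus c * cos (arg c - arg c0) /\
    rot_im (arg c0) c = modulus c * sin (arg c - arg c0).
  move=> /H[_ /toC_polar[e0 e1]]; rewrite /rot_re /rot_im cosB sinB e0 e1.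
  by split; ring.
split.
  by have [-> _] := rotE _ Dc0; rewrite subrr cos0 mulr1 pos.
have [ac _] := H _ Dc0.
have n1 : \forall c \near c0, `|arg c - arg c0| < pi / 2.
  by have /cvgrPdistC_lt /(_ (pi / 2)) := ac; apply; rewrite divr_gt0// pi_gt0.
near=> c.
have Dc : D c by near: c; exact: open_nbhs_nbhs.
have : `|arg c - arg c0| < pi / 2 by near: c.
rewrite ltr_norml => /[dup] B /cos_gt0_pihalf cg.
have [re im] := rotE _ Dc.
rewrite /arg_near re im -mulf_div divff ?mul1r; last exact: lt0r_neq0 (pos _ Dc).
by rewrite -/(tan _) tanK ?in_itv//= addrC subrK.
Unshelve. all: by end_near. Qed.

Lemma is_derive_arg_branch (eps : R) (D : set 'rV[R]_2) arg c v :
  arg_branch eps D arg -> D c ->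
  is_derive c v arg ((c 0 0 * v 0 1 - c 0 1 * v 0 0) / modulus c ^+ 2).
Proof.
move=> hb Dc; have [k0 nE] := arg_branch_near hb Dc.
have := is_derive_arg_near v k0; have [->|v0] := eqVneq v 0.
  by rewrite !mxE !mulr0 subrr mul0r => _; exact: is_derive0.
by apply: near_eq_is_derive => //; apply: filterS nE => y ->.
Qed.

End ArgBranches.
Lemma d0_real (R : realType) n (f : 'rV[R]_n.+1 -> R) x j (df : R) :
  is_derive x (delta_mx 0 j) f df -> d0 (fun y => ((f y)%:C)%C) x 0 j = (df%:C)%C.
Proof.
move=> hd; rewrite mxE /cpd /=; congr (_ +i* _)%C; first exact: is_derive_pd.
exact: derive_cst.
Qed.

(** * Pull-back by T and the sign of the period *)

Section Pullback.
Variables (R : realType) (eps : R) (S : 'rV[R]_2 -> R) (Omega : 'rV[R]_4 -> 'M[R[i]]_4).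
Implicit Types (z x : 'rV[R]_4) (c : 'rV[R]_2).
Hypothesis smooth_S : smooth_on setT S.
Hypothesis compatible_Omega : compatible eps S Omega.
Local Notation h := (hcoef Omega).
Local Notation s1 := (S1 S).
Local Notation s2 := (S2 S).

Lemma pull2_T x i j : disc eps (base x) -> pull2 (@T R) Omega x i j =
  (((0 == i)%:R * (2 == j)%:R - (2 == i)%:R * (0 == j)%:R
    + ((1 == i)%:R * (3 == j)%:R - (3 == i)%:R * (1 == j)%:R))
   +i* (h (base x) * ((0 == i)%:R * (1 == j)%:R - (1 == i)%:R * (0 == j)%:R)
    - ((0 == i)%:R * (3 == j)%:R - (3 == i)%:R * (0 == j)%:R)
    + ((1 == i)%:R * (2 == j)%:R - (2 == i)%:R * (1 == j)%:R)))%C.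
Proof.
move=> dx; have ox : over (disc eps) (T x) by rewrite /over /= pican_T.
have z0 := z2_T x.
have J k l : jacobian (@T R) x k l = ((delta_mx 0 k : 'rV[R]_4) *m frame (T x)) 0 l.
  by rewrite jacobian_T -rowE [RHS]mxE.
have re := reO_frame compatible_Omega (delta_mx 0 i) (delta_mx 0 j) ox z0.
have im := imO_frame compatible_Omega (delta_mx 0 i) (delta_mx 0 j) ox z0.
rewrite (Hcoef_T compatible_Omega dx) !delta4E in im; rewrite !delta4E in re.
rewrite pull2E; congr (_ +i* _)%C.
- by rewrite -re; apply: eq_bigr => k _; apply: eq_bigr => l _; rewrite !J.
- by rewrite -im; apply: eq_bigr => k _; apply: eq_bigr => l _; rewrite !J.
Qed.

(** The h-term is a multiple of dc1 /\ dc2 and dies against every factor containing dc or its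
    conjugate; -4 is the coefficient of dc /\ dtau /\ conj (dc /\ dtau) with tau = t1 - i t2. *)
Lemma wedge22_pull2_T x : disc eps (base x) ->
  wedge22 (pull2 (@T R) Omega x) (conj_mx (pull2 (@T R) Omega x)) = ((- 4)%:C)%C.
Proof.
move=> dx; rewrite /wedge22 /conj_mx.
have cE i j : map_mx (fun w : R[i] => w^*) (pull2 (@T R) Omega x) i j =
   (pull2 (@T R) Omega x i j)^* by rewrite mxE.
rewrite !cE !pull2_T //; move: (h (base x)) => r.
apply/eqP; rewrite eq_complex /=; apply/andP; split; apply/eqP; ring.
Qed.

(** After wedging with dc1 /\ dc2 only the dt1 and dt2 components of the angle forms survive, and in
    those directions the periods are constant. *)
Lemma dtheta_fibre arg x : 
  [/\ dtheta_ge S x 0 2 = ((2 * pi / per1 S (base x))%:C)%C, dtheta_ge S x 0 3 = 0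
    & dtheta_gm S arg x 0 3 = 1].
Proof.
have B (j : 'I_4) (t : R) : (j == 2) || (j == 3) -> base (t *: delta_mx 0 j + x) = base x.
  by move=> jE; apply: row2_eq; rewrite !mk2E !mxE;
    case/orP: jE => /eqP -> /=; rewrite mulr0 add0r.
have X (j k : 'I_4) (t : R) : (t *: delta_mx 0 j + x) 0 k = t * (k == j)%:R + x 0 k.
  by rewrite !mxE eqxx.
split.
- apply: d0_real; apply/derive1_line; rewrite /theta_ge.
  under eq_fun => t do rewrite B// X /=.
  by der; ring.
- apply: d0_real; apply/derive1_line; rewrite /theta_ge.
  under eq_fun => t do rewrite B// X /=.
  by der; ring.
- apply: d0_real; apply/derive1_line; rewrite /theta_gm.
  under eq_fun => t do rewrite B// !X /=.
  by der; ring.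
Qed.

Lemma dc1E x j : dc1 x 0 j = (j == 0)%:R.
Proof.
rewrite (d0_real (is_derive_coordr x _ 0)) delta4E eq_sym.
by case: (j == 0).
Qed.

Lemma dc2E x j : dc2 x 0 j = (j == 1)%:R.
Proof.
rewrite (d0_real (is_derive_coordr x _ 1)) delta4E eq_sym.
by case: (j == 1).
Qed.

Lemma wedge22_dc x (p q : 'rV[R[i]]_4) :
  wedge22 (wedge11 (dc1 x) (dc2 x)) (wedge11 p q) = p 0 2 * q 0 3 - q 0 2 * p 0 3.
Proof.
have [a aE] : exists a, a = dc1 x by exists (dc1 x).
have [b bE] : exists b, b = dc2 x by exists (dc2 x).
have aj j : a 0 j = (j == 0)%:R by rewrite aE dc1E.
have bj j : b 0 j = (j == 1)%:R by rewrite bE dc2E.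
by rewrite -aE -bE /wedge22 !wedge11E !aj !bj /=; ring.
Qed.

(** Against dc1 /\ dc2 /\ dt1 /\ dt2 the volume is -4 and the orientation form is -2 pi / per1, so a
    positive ratio forces per1 > 0. *)
Lemma per1_gt0 c : pdisc eps c -> 0 < per1 S c.
Proof.
move=> pc; have [D [arg [hb Dc]]] := pdisc_arg_branch pc.
case: compatible_Omega => _ _ [_ _ [_ pos]] _.
pose x := mk4 (c 0 0) (c 0 1) 0 0.
have bx : base x = c by rewrite /x base_mk4.
have Dx : D (base x) by rewrite bx.
have [f f0] := pos D arg hb x Dx.
rewrite wedge22_pull2_T; last by rewrite bx; case: pc.
rewrite wedge22_dc.
have [-> -> ->] := dtheta_fibre arg x; rewrite bx mulr0 mulr1 sub0r.
move=> /(congr1 (@complex.Re R)) /=; move: (per1 S c) => P.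
rewrite !mul0r subr0 => E.
have p0 := pi_gt0 R.
rewrite -invr_gt0 ltNge; apply/negP => P0.
have : 0 <= f * - (2 * pi / P).
  apply: mulr_ge0; first exact: ltW.
  by rewrite oppr_ge0; apply: mulr_ge0_le0 => //; rewrite mulr_ge0// ltW.
by rewrite -E; lra.
Qed.

End Pullback.
(** * Action-angle coordinates *)

Section Differentials.
Variables (R : realType) (S : 'rV[R]_2 -> R).
Implicit Types (x : 'rV[R]_4) (c v : 'rV[R]_2).
Hypothesis smooth_S : smooth_on setT S.
Local Notation s1 := (S1 S).
Local Notation s2 := (S2 S).

(** Removes the square root before differentiating. It holds at c = 0 too, since ln 0 = 0 by
    convention, so the functions can be exchanged globally. *)
Lemma ln_modulus c : ln (modulus c) = 2^-1 * ln (c 0 0 ^+ 2 + c 0 1 ^+ 2).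
Proof.
rewrite -modulus_sqr; have [m0|m0] := ltP 0 (modulus c).
  by rewrite lnXn// mulr2n; field.
have -> : modulus c = 0 by apply/eqP; rewrite eq_le m0 sqrtr_ge0.
by rewrite expr0n/= ln0// mulr0.
Qed.

Lemma is_derive_ln_modulus c v : c != 0 ->
  is_derive c v (fun c => ln (modulus c)) ((c 0 0 * v 0 0 + c 0 1 * v 0 1) / modulus c ^+ 2).
Proof.
move=> c0; have m0 : 0 < modulus c ^+ 2 by rewrite exprn_gt0// modulus_gt0.
rewrite (funext ln_modulus).
have d : is_derive c v (fun y : 'rV[R]_2 => y 0 0 ^+ 2 + y 0 1 ^+ 2)
   (2 * c 0 0 * v 0 0 + 2 * c 0 1 * v 0 1).
  by der; rewrite /=; ring.
have q0 : 0 < c 0 0 ^+ 2 + c 0 1 ^+ 2 by rewrite -modulus_sqr.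
have dl := is_derive_lnr (f := fun y : 'rV[R]_2 => y 0 0 ^+ 2 + y 0 1 ^+ 2) q0 d.
eapply is_derive_eqr; first by eapply is_deriveMr; [exact: is_derive_constr|exact: dl].
by rewrite modulus_sqr /=; field; exact: lt0r_neq0.
Qed.

Lemma is_derive_S1 c v : is_derive c v s1 (v 0 0 * pd 0 s1 c + v 0 1 * pd 1 s1 c).
Proof.
have D := differentiable_S1 smooth_S c.
apply: DeriveDef; first exact: diff_derivable.
by rewrite derive_pd// sum2.
Qed.

Lemma is_derive_S2 c v : is_derive c v s2 (v 0 0 * pd 0 s2 c + v 0 1 * pd 1 s2 c).
Proof.
have D := differentiable_S2 smooth_S c.
apply: DeriveDef; first exact: diff_derivable.
by rewrite derive_pd// sum2.
Qed.

Lemma is_derive_S c v : is_derive c v S (v 0 0 * s1 c + v 0 1 * s2 c).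
Proof.
have D : differentiable S c by exact: (smooth_S [::]).
apply: DeriveDef; first exact: diff_derivable.
by rewrite derive_pd// sum2.
Qed.

Lemma is_derive_per1 c v : c != 0 -> is_derive c v (per1 S)
  (v 0 0 * pd 0 s1 c + v 0 1 * pd 1 s1 c - (c 0 0 * v 0 0 + c 0 1 * v 0 1) / modulus c ^+ 2).
Proof.
by move=> c0; apply: is_deriveBr; [exact: is_derive_S1|exact: is_derive_ln_modulus].
Qed.

Lemma is_derive_base (f : 'rV[R]_2 -> R) x (v : 'rV[R]_4) df :
  is_derive (base x) (base v) f df -> is_derive x v (fun y => f (base y)) df.
Proof.
move=> /derive1_line d; apply/derive1_line.
suff -> : (fun t : R => f (base (t *: v + x))) = (fun t : R => f (t *: base v + base x)) by [].
by apply: funext => t; congr f; apply: row2_eq; rewrite !mxE.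
Qed.

Section Branch.
Variables (eps : R) (D : set 'rV[R]_2) (arg : 'rV[R]_2 -> R).
Hypothesis arg_D : arg_branch eps D arg.

Lemma arg_branch_neq0 c : D c -> c != 0.
Proof. by case: arg_D => _ _ Dp _ /Dp[]. Qed.

Lemma arg_branch_disc c : D c -> disc eps c.
Proof. by case: arg_D => _ _ Dp _ /Dp[]. Qed.

Lemma is_derive_per2 c v : D c -> is_derive c v (per2 S arg)
  (v 0 0 * pd 0 s2 c + v 0 1 * pd 1 s2 c + (c 0 0 * v 0 1 - c 0 1 * v 0 0) / modulus c ^+ 2).
Proof.
by move=> Dc; apply: is_deriveDr; [exact: is_derive_S2|exact: (is_derive_arg_branch v arg_D Dc)].
Qed.

(* d (c - c ln c) = - ln c dc, split into real and imaginary parts *)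
Lemma is_derive_c_ln_c (L a f : 'rV[R]_2 -> R) c v l r g : modulus c ^+ 2 != 0 ->
  is_derive c v L l -> is_derive c v a r -> is_derive c v f g ->
  l = (c 0 0 * v 0 0 + c 0 1 * v 0 1) / modulus c ^+ 2 ->
  r = (c 0 0 * v 0 1 - c 0 1 * v 0 0) / modulus c ^+ 2 ->
  is_derive c v (fun c => (2 * pi)^-1 * (c 0 0 - (c 0 0 * L c - c 0 1 * a c) + f c))
    ((2 * pi)^-1 * (a c * v 0 1 - L c * v 0 0 + g)) /\
  is_derive c v (fun c => (2 * pi)^-1 * (c 0 1 - (c 0 0 * a c + c 0 1 * L c) + f c))
    ((2 * pi)^-1 * (- a c * v 0 0 - L c * v 0 1 + g)).
Proof.
move=> m0 dL da df lE rE.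
(* [e] and [e'] are the real and imaginary parts of c d(ln c) = dc. *)
have e : c 0 0 * l - c 0 1 * r = v 0 0.
  by rewrite lE rE; rewrite modulus_sqr in m0 *; field.
have e' : c 0 0 * r + c 0 1 * l = v 0 1.
  by rewrite lE rE; rewrite modulus_sqr in m0 *; field.
split; der.
- transitivity ((2 * pi)^-1 * (v 0 0 - (c 0 0 * l - c 0 1 * r) + a c * v 0 1 - L c * v 0 0 + g)).
    by ring.
  by rewrite e; ring.
- transitivity ((2 * pi)^-1 * (v 0 1 - (c 0 0 * r + c 0 1 * l) - a c * v 0 0 - L c * v 0 1 + g)).
    by ring.
  by rewrite e'; ring.
Qed.

(** Real part of 2 pi dZ = (per1 - i per2) dc; [is_derive_Im_Z_gm] gives the imaginary part. *)
Lemma is_derive_Re_Z_gm c v (St : 'rV[R]_2 -> R) : D c ->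
  is_derive c v (fun c => complex.Re (Z_gm S arg St c))
   ((2 * pi)^-1 * (per1 S c * v 0 0 + per2 S arg c * v 0 1)).
Proof.
move=> Dc; have c0 := arg_branch_neq0 Dc.
have e : (fun c => complex.Re (Z_gm S arg St c)) = (fun c => (2 * pi)^-1 *
   (c 0 0 - (c 0 0 * ln (modulus c) - c 0 1 * arg c) + S c)).
  by apply: funext => y; rewrite /Z_gm /= mul0r subr0.
have m0 : modulus c ^+ 2 != 0 by rewrite lt0r_neq0// exprn_gt0// modulus_gt0.
have [d _] := is_derive_c_ln_c m0 (is_derive_ln_modulus v c0)
  (is_derive_arg_branch v arg_D Dc) (is_derive_S c v) erefl erefl.
by rewrite e; apply: is_derive_eqr d _; rewrite /per1 /per2; ring.
Qed.

Lemma is_derive_Im_Z_gm c v (St : 'rV[R]_2 -> R) : D c ->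
  is_derive c v St (- v 0 0 * s2 c + v 0 1 * s1 c) ->
  is_derive c v (fun c => complex.Im (Z_gm S arg St c))
   ((2 * pi)^-1 * (per1 S c * v 0 1 - per2 S arg c * v 0 0)).
Proof.
move=> Dc dSt; have c0 := arg_branch_neq0 Dc.
have e : (fun c => complex.Im (Z_gm S arg St c)) = (fun c => (2 * pi)^-1 *
   (c 0 1 - (c 0 0 * arg c + c 0 1 * ln (modulus c)) + St c)).
  by apply: funext => y; rewrite /Z_gm /= mul0r addr0.
have m0 : modulus c ^+ 2 != 0 by rewrite lt0r_neq0// exprn_gt0// modulus_gt0.
have [_ d] := is_derive_c_ln_c m0 (is_derive_ln_modulus v c0)
  (is_derive_arg_branch v arg_D Dc) dSt erefl erefl.
by rewrite e; apply: is_derive_eqr d _; rewrite /per1 /per2; ring.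
Qed.

Lemma harmonic_conjugate_derive c v (St : 'rV[R]_2 -> R) :
  harmonic_conjugate (disc eps) S St -> disc eps c ->
  is_derive c v St (- v 0 0 * s2 c + v 0 1 * s1 c).
Proof.
move=> [_ /(_ c) hol] dc; have [_ dSt [e1 e2]] := hol dc.
rewrite /= in dSt; apply: DeriveDef; first exact: diff_derivable.
move: e1 e2; rewrite derive_pd// sum2 /S1 /S2.
rewrite !mul0r !mul1r sub0r add0r => -> ->; ring.
Qed.

Lemma d0_Z_gm x (St : 'rV[R]_2 -> R) j : D (base x) ->
  harmonic_conjugate (disc eps) S St ->
  d0 (fun y => Z_gm S arg St (base y)) x 0 j =
  ((2 * pi)^-1 * (per1 S (base x) * (j == 0)%:R + per2 S arg (base x) * (j == 1)%:R)
   +i* ((2 * pi)^-1 * (per1 S (base x) * (j == 1)%:R - per2 S arg (base x) * (j == 0)%:R)))%C.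
Proof.
move=> Dc hSt.
have dSt v := harmonic_conjugate_derive v hSt (arg_branch_disc Dc).
have B : (base (delta_mx 0 j) 0 0 = (j == 0)%:R :> R) *
    (base (delta_mx 0 j) 0 1 = (j == 1)%:R :> R).
  by rewrite !mk2E !delta4E ![_ == j]eq_sym.
rewrite mxE /cpd; congr (_ +i* _)%C; apply: is_derive_pd.
- apply: (is_derive_base (f := fun c => complex.Re (Z_gm S arg St c))).
  by have := is_derive_Re_Z_gm (base (delta_mx 0 j)) St Dc; rewrite !B.
- apply: (is_derive_base (f := fun c => complex.Im (Z_gm S arg St c))).
  by have := is_derive_Im_Z_gm Dc (dSt (base (delta_mx 0 j))); rewrite !B.
Qed.

Lemma d0_Z_ge x j : d0 (fun y => Z_ge (base y)) x 0 j = ((j == 1)%:R -i* (j == 0)%:R)%C.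
Proof.
rewrite mxE /cpd; congr (_ +i* _)%C; apply: is_derive_pd.
- have -> : (fun y : 'rV[R]_4 => complex.Re (Z_ge (base y))) = (fun y => y 0 1).
    by apply: funext => y; rewrite /Z_ge /= !mk2E; ring.
  by der; rewrite delta4E eq_sym.
- have -> : (fun y : 'rV[R]_4 => complex.Im (Z_ge (base y))) = (fun y => - y 0 0).
    by apply: funext => y; rewrite /Z_ge /= !mk2E; ring.
  by der; rewrite delta4E eq_sym.
Qed.

Lemma is_derive_theta (P Q : 'rV[R]_4 -> R) (x v : 'rV[R]_4) p q : P x != 0 ->
  is_derive x v P p -> is_derive x v Q q ->
  is_derive x v (fun y => 2 * pi * y 0 2 / P y)
    (2 * pi * (v 0 2 / P x - x 0 2 * p / P x ^+ 2)) /\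
  is_derive x v (fun y => y 0 3 - Q y / P y * y 0 2)
    (v 0 3 - Q x / P x * v 0 2 - x 0 2 * (q / P x - Q x * p / P x ^+ 2)).
Proof.
move=> P0 dP dQ; have dV := is_deriveVr P0 dP.
by split; der; field.
Qed.

Definition dper_re c : R := pd 0 s1 c - c 0 0 / modulus c ^+ 2.
Definition dper_im c : R := pd 1 s1 c - c 0 1 / modulus c ^+ 2.

(* per1 - i per2 = 2 dS/dc - ln c is holomorphic. *)
Lemma is_derive_per x (v : 'rV[R]_4) : D (base x) ->
  pd 0 s1 (base x) + pd 1 s2 (base x) = 0 -> pd 0 s2 (base x) = pd 1 s1 (base x) ->
  is_derive x v (fun y => per1 S (base y))
    (v 0 0 * dper_re (base x) + v 0 1 * dper_im (base x)) /\
  is_derive x v (fun y => per2 S arg (base y))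
    (v 0 0 * dper_im (base x) - v 0 1 * dper_re (base x)).
Proof.
move=> Dc h1 h2; have cn := arg_branch_neq0 Dc.
have [b0 b1] : base v 0 0 = v 0 0 /\ base v 0 1 = v 0 1 by split; rewrite mxE.
have aux1 (a b c0 c1 v0 v1 m : R) : v0 * a + v1 * b - (c0 * v0 + c1 * v1) / m =
    v0 * (a - c0 / m) + v1 * (b - c1 / m) by ring.
have aux2 (a b d e c0 c1 v0 v1 m : R) : a + e = 0 -> d = b ->
    v0 * d + v1 * e + (c0 * v1 - c1 * v0) / m = v0 * (b - c1 / m) - v1 * (a - c0 / m).
  by move=> /eqP; rewrite addrC addr_eq0 => /eqP -> ->; ring.
split; apply: is_derive_base.
- by apply: is_derive_eqr (is_derive_per1 (base v) cn) _; rewrite b0 b1; exact: aux1.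
- by apply: is_derive_eqr (is_derive_per2 (base v) Dc) _; rewrite b0 b1; exact: aux2 h1 h2.
Qed.

Lemma dthetaE x j : D (base x) -> per1 S (base x) != 0 ->
  pd 0 s1 (base x) + pd 1 s2 (base x) = 0 -> pd 0 s2 (base x) = pd 1 s1 (base x) ->
  let P := per1 S (base x) in let Q := per2 S arg (base x) in
  let p := (j == 0)%:R * dper_re (base x) + (j == 1)%:R * dper_im (base x) in
  let q := (j == 0)%:R * dper_im (base x) - (j == 1)%:R * dper_re (base x) in
  dtheta_ge S x 0 j = ((2 * pi * ((j == 2)%:R / P - x 0 2 * p / P ^+ 2))%:C)%C /\
  dtheta_gm S arg x 0 j =
    (((j == 3)%:R - Q / P * (j == 2)%:R - x 0 2 * (q / P - Q * p / P ^+ 2))%:C)%C.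
Proof.
move=> Dc P0 h1 h2 P Q p q.
have [dP dQ] := is_derive_per (delta_mx 0 j) Dc h1 h2.
have [d1 d2] := is_derive_theta P0 dP dQ.
split; apply: d0_real.
- apply: is_derive_eqr d1 _.
  by rewrite !delta4E ![_ == j]eq_sym.
- apply: is_derive_eqr d2 _.
  by rewrite !delta4E ![_ == j]eq_sym.
Qed.

End Branch.
End Differentials.

Lemma two_pi_neq0 (R : realType) : 2 * pi != 0 :> R.
Proof. by rewrite mulf_neq0// lt0r_neq0// pi_gt0. Qed.

(** * Omega in action-angle coordinates *)

Section Decomposition.
Variables (R : realType) (eps : R) (S : 'rV[R]_2 -> R) (Omega : 'rV[R]_4 -> 'M[R[i]]_4).
Implicit Types (x : 'rV[R]_4) (c : 'rV[R]_2).
Hypothesis smooth_S : smooth_on setT S.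
Hypothesis eps_gt0 : 0 < eps.
Hypothesis compatible_Omega : compatible eps S Omega.

(* dc /\ dtau rewritten in action-angle coordinates; a, b are the partial
   derivatives of P = per1, with dQ = b dc1 - a dc2 for Q = per2. *)
Lemma action_angle_identity (P Q t a b w r : R) (i j : 'I_4) : P != 0 -> w != 0 ->
  let p (k : 'I_4) := (k == 0)%:R * a + (k == 1)%:R * b in
  let q (k : 'I_4) := (k == 0)%:R * b - (k == 1)%:R * a in
  let zm k := (w^-1 * (P * (k == 0)%:R + Q * (k == 1)%:R)
    +i* (w^-1 * (P * (k == 1)%:R - Q * (k == 0)%:R)))%C in
  let ze (k : 'I_4) := ((k == 1)%:R -i* (k == 0)%:R)%C in
  let te (k : 'I_4) := ((w * ((k == 2)%:R / P - t * p k / P ^+ 2))%:C)%C in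
  let tm (k : 'I_4) := (((k == 3)%:R - Q / P * (k == 2)%:R
      - t * (q k / P - Q * p k / P ^+ 2))%:C)%C in
  (((0 == i)%:R * (2 == j)%:R - (2 == i)%:R * (0 == j)%:R
    + ((1 == i)%:R * (3 == j)%:R - (3 == i)%:R * (1 == j)%:R))
   +i* (r * ((0 == i)%:R * (1 == j)%:R - (1 == i)%:R * (0 == j)%:R)
    - ((0 == i)%:R * (3 == j)%:R - (3 == i)%:R * (0 == j)%:R)
    + ((1 == i)%:R * (2 == j)%:R - (2 == i)%:R * (1 == j)%:R)))%C =
  (zm i * te j - te i * zm j) + (ze i * tm j - tm i * ze j)
  + ('i%C * (r%:C)%C) * ((i == 0)%:R * (j == 1)%:R - (i == 1)%:R * (j == 0)%:R).
Proof.
move=> P0 w0 p q zm ze te tm; rewrite /zm /ze /te /tm /p /q {p q zm ze te tm}.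
by apply/eqP; rewrite eq_complex; move: i j; apply: ord4P; apply: ord4P;
  rewrite /=; apply/andP; split; apply/eqP; field; rewrite ?P0 ?w0.
Qed.

(** Harmonicity and the symmetry of second derivatives enter through [dthetaE]: they tie the
    differential of per2 to that of per1, as [action_angle_identity] requires. *)
Lemma pull2_T_decomposition (D : set 'rV[R]_2) arg (St : 'rV[R]_2 -> R) x :
  arg_branch eps D arg -> harmonic_conjugate (disc eps) S St -> D (base x) ->
  pull2 (@T R) Omega x
  = wedge11 (d0 (fun y => Z_gm S arg St (base y)) x) (dtheta_ge S x)
    + wedge11 (d0 (fun y => Z_ge (base y)) x) (dtheta_gm S arg x)
    + ('i%C * ((hcoef Omega (base x))%:C)%C) *: wedge11 (dc1 x) (dc2 x).
Proof.
move=> hb hSt Dx; have [_ _ Dp _] := hb; have px := Dp _ Dx.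
have dx : disc eps (base x) by case: px.
have P0 := lt0r_neq0 (per1_gt0 compatible_Omega px).
have h1 := S_laplace smooth_S compatible_Omega eps_gt0 dx.
have h2 := S_mixed smooth_S compatible_Omega dx.
have th j := dthetaE smooth_S hb j Dx P0 h1 h2.
have w0 := two_pi_neq0 R.
apply/matrixP => i j.
have I := action_angle_identity (per2 S arg (base x)) (x 0 2) (dper_re S (base x))
  (dper_im S (base x)) (hcoef Omega (base x)) i j P0 w0.
refine (etrans (pull2_T compatible_Omega i j dx) (etrans I _)).
move=> {I}.
have [tei tmi] := th i; have [tej tmj] := th j.
rewrite [RHS]mxE [X in _ = X + _]mxE [X in _ = _ + X]mxE.
symmetry; congr (_ + _ + _ * _).
- by rewrite wedge11E tei tej (d0_Z_gm smooth_S hb i Dx hSt) (d0_Z_gm smooth_S hb j Dx hSt).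
- by rewrite wedge11E tmi tmj 2!d0_Z_ge.
- by rewrite wedge11E 2!dc1E 2!dc2E [(i == 1)%:R * _]mulrC.
Qed.

End Decomposition.
Lemma is_derive0_constant (R : realType) n (D : set 'rV[R]_n.+1) (f : 'rV[R]_n.+1 -> R) :
  open D -> connected D -> (forall x v, D x -> is_derive x v f 0) ->
  forall x y, D x -> D y -> f x = f y.
Proof.
move=> oD cD df x y Dx Dy.
have loc z : D z -> \forall w \near z, D w /\ f w = f z.
  move=> Dz; have [r /= r0 rD] := (nbhs_ballP z _).1 (open_nbhs_nbhs (conj oD Dz)).
  apply/(nbhs_ballP z _); exists r => //= w zw; split; first exact: rD.
  have Dseg (t : R) : t \in `[0, 1] -> D (t *: (w - z) + z).
    rewrite in_itv/= => /andP[t0 t1]; apply: rD.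
    move: zw; rewrite -!ball_normE/= opprD addrCA subrr addr0 normrN normrZ => zw.
    rewrite ger0_norm//; apply: le_lt_trans (_ : `|w - z| < r).
      by rewrite ler_piMl.
    by rewrite distrC.
  have d (t : R) : t \in `[0, 1] -> is_derive t 1 (fun t : R => f (t *: (w - z) + z)) 0.
    by move=> /Dseg Dt; apply: is_derive_line; exact: df.
  have [t _ E] := @MVT_segment R (fun t : R => f (t *: (w - z) + z)) (fun=> 0) 0 1 ler01
    (fun t ht => d t (subset_itv_oo_cc ht))
    (@derivable_within_continuous _ _ _ `[0, 1] (fun t ht => @ex_derive _ _ _ _ _ _ _ (d t ht))).
  move/eqP: E; rewrite mul0r subr_eq0 scale1r subrK scale0r add0r => /eqP.
  by [].
(* By local constancy every condition on the value of f is open, so the level set of [y] and its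
   complement are both open in D. *)
have op (P : R -> Prop) : open (D `&` [set w | P (f w)]).
  rewrite openE => z [Dz Pz]; apply: filterS (loc z Dz) => w [Dw fw].
  by split=> //=; rewrite fw.
have E : D `&` [set w | f w = f y] = D.
  apply: cD.
  - by exists y.
  - by exists (D `&` [set w | f w = f y]); [exact: (op (fun r => r = f y))|rewrite setIA setIid].
  - exists (~` (D `&` [set w | f w <> f y])).
      by rewrite closedC; exact: (op (fun r => r <> f y)).
    apply/seteqP; split=> w [Dw fw]; split=> //=; first by case.
    by apply: contrapT => h; exact: (fw (conj Dw h)).
by have [_] : (D `&` [set w | f w = f y]) x by rewrite E.
Qed.

(** * Harmonic conjugates and action integrals *)

Section HarmonicConjugate.
Variables (R : realType) (eps : R) (S : 'rV[R]_2 -> R).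
Implicit Types (c v : 'rV[R]_2).
Hypothesis smooth_S : smooth_on setT S.
Hypothesis harmonic_S : forall c, disc eps c -> pd 0 (S1 S) c + pd 1 (S2 S) c = 0.
Hypothesis mixed_S : forall c, disc eps c -> pd 0 (S2 S) c = pd 1 (S1 S) c.
Local Notation s1 := (S1 S).
Local Notation s2 := (S2 S).

Lemma smooth_s1 : smooth_on (disc eps) s1.
Proof. by move=> s c _; rewrite /S1 -foldr_rcons; exact: smooth_S. Qed.

Lemma smooth_s2 : smooth_on (disc eps) s2.
Proof. by move=> s c _; rewrite /S2 -foldr_rcons; exact: smooth_S. Qed.

(** Coefficients of -S_2 dc1 + S_1 dc2, the differential of a harmonic conjugate by Cauchy-Riemann;
    it is closed because S is harmonic. *)
Definition conj_form (i : 'I_2) : 'rV[R]_2 -> R :=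
  if i == 0 then (fun c => - s2 c) else s1.

Lemma conj_form_smooth i : smooth_on (disc eps) (conj_form i).
Proof.
move: i; apply: ord2P; rewrite /conj_form /=; last exact: smooth_s1.
by apply: smooth_onN; [exact: open_disc|exact: smooth_s2].
Qed.

(** Regularity is bootstrapped: continuous partials give differentiability, then smooth partials
    give smoothness. The Laplacian of a primitive is -d_1 S_2 + d_2 S_1, which vanishes by
    symmetry. *)
Lemma harmonic_conjugateP (St : 'rV[R]_2 -> R) :
  (forall c v, disc eps c -> is_derive c v St (\sum_i v 0 i * conj_form i c)) ->
  harmonic_conjugate (disc eps) S St.
Proof.
move=> dSt; have oD := @open_disc R eps.
have nD c : disc eps c -> nbhs c (disc eps).
  by move=> dc; apply: open_nbhs_nbhs.
have pdSt i c : disc eps c -> pd i St c = conj_form i c.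
  move=> dc; apply: is_derive_pd; apply: is_derive_eqr (dSt c _ dc) _.
  by move: i; apply: ord2P; rewrite sum2 !delta2E /= mul0r mul1r ?addr0 ?add0r.
have difSt c : disc eps c -> differentiable St c.
  move=> dc; apply: (differentiable_pd (a := conj_form)).
    by apply: filterS (nD c dc) => y dy v; exact: dSt.
  move=> i; apply: differentiable_continuousr.
  exact: smooth_on_differentiable (conj_form_smooth i) dc.
split; first split.
- apply: smooth_on_pd => // i; exists (conj_form i); split=> [|c dc].
    exact: conj_form_smooth.
  exact: pdSt.
- move=> c dc.
  have E i j : pd j (pd i St) c = pd j (conj_form i) c.
    by apply: near_pd; apply: filterS (nD c dc) => y dy; exact: pdSt.
  rewrite !E /conj_form /= -mixed_S//.
  have -> : pd 0 (fun c => - s2 c) c = - pd 0 s2 c.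
    by apply: deriveN; apply: diff_derivable; exact: differentiable_S2.
  by rewrite addNr.
- move=> c dc; split.
  + exact: (smooth_S [::]).
  + exact: difSt.
  + rewrite /cpd /= !pdSt// /conj_form /=.
    by apply/eqP; rewrite eq_complex /= !mul0r !mul1r sub0r add0r opprK !eqxx.
Qed.

Lemma harmonic_conjugate_exists : 0 < eps -> exists St, forall c v, disc eps c ->
  is_derive c v St (\sum_i v 0 i * conj_form i c).
Proof.
move=> e0.
(* Poincare lemma on the disc: the form is integrated along the radius from 0 to c. *)
exists (fun c => \int[lebesgue_measure]_(s in `[0, 1]) \sum_i conj_form i (s *: c) * c 0 i).
move=> c v dc; apply/derive1_line.
have dseg (y : 'rV[R]_2) (s : R) : 0 <= s <= 1 -> disc eps y -> disc eps (s *: y).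
  move=> s01 dy; have := @modulus_segment R eps 0 y s s01.
  rewrite subr0 addr0; apply => //.
  by rewrite /modulus !mxE expr0n addr0 sqrtr0.
have nc : \forall u \near (0 : R), disc eps (u *: v + c).
  have cu : {for 0, continuous (fun u : R => u *: v + c)}.
    apply: continuous_row => i.
    have -> : (fun u : R => (u *: v + c) 0 i) = (fun y => y * v 0 i + c 0 i).
      by apply: funext => y; rewrite !mxE.
    exact: continuous_affine.
  apply: cu; rewrite scale0r add0r; apply: open_nbhs_nbhs; split=> //; exact: open_disc.
have linE (y w : 'rV[R]_2) (b : R) (t : R) :
    is_derive t 1 (fun t : R => b *: (t *: y + w)) (b *: y).
  apply: is_derive_row => i.
  rewrite (_ : (fun y => _) = (fun t => b * (t * y 0 i + w 0 i))); last first.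
    by apply: funext => u; rewrite !mxE.
  by der; rewrite !mxE; ring.
have linE1 (y w : 'rV[R]_2) (t : R) : is_derive t 1 (fun t : R => t *: y + w) y.
  have := linE y w 1 t; rewrite scale1r.
  by under eq_fun do rewrite scale1r.
have linE0 (y : 'rV[R]_2) (t : R) : is_derive t 1 (fun t : R => t *: y) y.
  have := linE1 y 0 t.
  by under eq_fun do rewrite addr0.
have sq := conj_form_smooth.
have pairE (y w : 'rV[R]_2) (p : R * R) (F : R * R -> 'rV[R]_2) :
    (forall i, exists f, (forall p, F p 0 i = f p) /\ {for p, continuous f}) ->
    {for p, continuous F}.
  move=> H; apply: continuous_row => i; have [f [fE cf]] := H i.
  by rewrite (funext fE).
apply: is_derive_eqr (@derive_line_family R 1 (disc eps) conj_form
  (fun u s => s *: (u *: v + c)) (fun u s => s *: v) (fun u s => u *: v + c) (fun u s => v)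
  0 0 (@open_disc R eps) _ _ _ _ _ _ _) _.
- by move=> i y dy; exact: (smooth_on_differentiable (sq i) dy).
- move=> i j y dy; apply: differentiable_continuousr.
  exact: (smooth_on_differentiable (@smooth_on_pdr _ _ _ _ j (sq i)) dy).
- apply: filterS nc => u du s s01; split.
  + exact: dseg.
  + exact: linE.
  + exact: linE0.
  + exact: linE1.
- by near=> u => s _; exact: cst_continuous.
- move=> s _.
  have c1 := @continuous_fstr R (0, s); have c2 := @continuous_sndr R (0, s).
  have cst (r : R) : {for ((0 : R), s), continuous (fun _ : R * R => r)} by exact: continuous_cstr.
  split; apply: (pairE v c) => i.
  + exists (fun p => p.2 * (p.1 * v 0 i + c 0 i)); split; first by move=> p; rewrite !mxE.
    exact: (continuousMr c2 (continuousDr (continuousMr c1 (cst _)) (cst _))).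
  + exists (fun p => p.2 * v 0 i); split; first by move=> p; rewrite !mxE.
    exact: (continuousMr c2 (cst _)).
  + exists (fun p => p.1 * v 0 i + c 0 i); split; first by move=> p; rewrite !mxE.
    exact: (continuousDr (continuousMr c1 (cst _)) (cst _)).
  + by exists (fun=> v 0 i); split.
(* Closedness of the form, so that the strip between two radii contributes m = 0. *)
- move=> s s01; rewrite scale0r add0r.
  have ds : disc eps (s *: c) by exact: dseg.
  have h1 := harmonic_S ds; have h2 : pd 1 (fun c => - s2 c) (s *: c) = - pd 1 s2 (s *: c).
    by apply: deriveN; apply: diff_derivable; exact: differentiable_S2.
  rewrite !sum2 /conj_form /= h2; move: h1.
  move: (pd 0 (fun c => - s2 c) _) (pd 1 s1 _) (pd 0 s1 _) (pd 1 s2 _) => p q r t h1.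
  have -> : t = - r by apply/eqP; rewrite -addr_eq0 addrC h1.
  by ring.
(* The boundary term at s = 0 vanishes, all radii starting at the origin. *)
- rewrite scale1r scale0r add0r addr0 [X in _ - X]big1 ?subr0.
    by apply: eq_bigr => i _; rewrite scale1r mulrC.
  by move=> i _; rewrite scale0r mxE mulr0.
Unshelve. all: by end_near. Qed.

End HarmonicConjugate.

(** * Hamiltonian fields along the chart *)

Section Hamiltonian.
Variable R : realType.
Implicit Types (y z x : 'rV[R]_4).

(* p X1 + q X2, as a linear map of the point y. *)
Definition hamil (p q : R) y : 'rV[R]_4 := mk4
  (- p * y 0 0 - q * y 0 1) (- p * y 0 1 + q * y 0 0)
  (p * y 0 2 + q * y 0 3) (p * y 0 3 - q * y 0 2).

(** z1 = c e^(-t1 + i t2) is linear in c, so a variation (a, b) of c moves z1 by the same formula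
    with (a, b) for c. Free of the quotients by |z2|^2, this form of a velocity is easily
    differentiated again. *)
Lemma mul_frame_T (a b p q : R) x :
  mk4 a b p q *m frame (T x) =
  mk4 (T (mk4 a b (x 0 2) (x 0 3)) 0 0) (T (mk4 a b (x 0 2) (x 0 3)) 0 1) 0 0
  + hamil p q (T x).
Proof.
have [y yE] : exists y, y = T (mk4 a b (x 0 2) (x 0 3)) by eexists.
have [z zE] : exists z, z = T x by eexists.
have [f3 f4] := T_over_sq2 x.
have y0 : y 0 0 = a * (z 0 2 / sq2 z) + b * (z 0 3 / sq2 z).
  by rewrite yE zE f3 f4 T0 !mk4E; ring.
have y1 : y 0 1 = b * (z 0 2 / sq2 z) - a * (z 0 3 / sq2 z).
  by rewrite yE zE f3 f4 T1 !mk4E; ring.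
rewrite -yE -zE mul_frame /hamil y0 y1 {yE zE f3 f4 y0 y1}.
by apply: row4_eq; rewrite [RHS]mxE !mk4E; ring.
Qed.

Lemma hamilE p q z : hamil p q z = mk4 0 0 p q *m frame z.
Proof.
rewrite mul_frame; apply: row4_eq; rewrite !mk4E; ring.
Qed.

Lemma is_derive_hamil (V : normedModType R) (p q : V -> R) (y : V -> 'rV[R]_4) u w p' q' y' :
  is_derive u w p p' -> is_derive u w q q' -> is_derive u w y y' ->
  is_derive u w (fun u => hamil (p u) (q u) (y u)) (hamil p' q' (y u) + hamil (p u) (q u) y').
Proof.
move=> dp dq dy; have d i := is_derive_coord i dy.
have d0 := d 0; have d1 := d 1; have d2 := d 2; have d3 := d 3.
apply: is_derive_row; apply: ord4P; rewrite mxE /hamil !mk4E.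
- by rewrite (funext (fun u => mk4_0 (- p u * y u 0 0 - q u * y u 0 1) _ _ _)); der; ring.
- by rewrite (funext (fun u => mk4_1 _ (- p u * y u 0 1 + q u * y u 0 0) _ _)); der; ring.
- by rewrite (funext (fun u => mk4_2 _ _ (p u * y u 0 2 + q u * y u 0 3) _)); der; ring.
- by rewrite (funext (fun u => mk4_3 _ _ _ (p u * y u 0 3 - q u * y u 0 2))); der; ring.
Qed.

Lemma continuous_mk4 (X : topologicalType) (a b p q : X -> R) u :
  {for u, continuous a} -> {for u, continuous b} -> {for u, continuous p} ->
  {for u, continuous q} -> {for u, continuous (fun u => mk4 (a u) (b u) (p u) (q u))}.
Proof.
move=> ca cb cp cq; apply: continuous_row; apply: ord4P.
- by rewrite (funext (fun u => mk4_0 (a u) (b u) (p u) (q u))).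
- by rewrite (funext (fun u => mk4_1 (a u) (b u) (p u) (q u))).
- by rewrite (funext (fun u => mk4_2 (a u) (b u) (p u) (q u))).
- by rewrite (funext (fun u => mk4_3 (a u) (b u) (p u) (q u))).
Qed.

Lemma continuous_coordr (X : topologicalType) (y : X -> 'rV[R]_4) u i :
  {for u, continuous y} -> {for u, continuous (fun u => y u 0 i)}.
Proof.
by apply: (continuous_compr (F := fun y : 'rV[R]_4 => y 0 i)); exact: coord_continuous.
Qed.

Lemma continuous_hamil (X : topologicalType) (p q : X -> R) (y : X -> 'rV[R]_4) u :
  {for u, continuous p} -> {for u, continuous q} -> {for u, continuous y} ->
  {for u, continuous (fun u => hamil (p u) (q u) (y u))}.
Proof.
move=> cp cq cy; have c i := @continuous_coordr _ _ _ i cy.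
apply: continuous_mk4.
- by apply: continuousBr; apply: continuousMr => //; exact: continuousNr.
- by apply: continuousDr; apply: continuousMr => //; exact: continuousNr.
- by apply: continuousDr; exact: continuousMr.
- by apply: continuousBr; exact: continuousMr.
Qed.

Lemma continuousT (X : topologicalType) (y : X -> 'rV[R]_4) u :
  {for u, continuous y} -> {for u, continuous (fun u => T (y u))}.
Proof.
apply: (continuous_compr (F := @T R)).
by apply: differentiable_continuous; exact: differentiable_T.
Qed.

Lemma continuousDrow (X : topologicalType) (y z : X -> 'rV[R]_4) u :
  {for u, continuous y} -> {for u, continuous z} ->
  {for u, continuous (fun u => y u + z u)}.
Proof. by move=> cy cz; exact: continuousD. Qed.

Lemma is_derive_mk4 (V : normedModType R) (a b p q : V -> R) u w a' b' p' q' :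
  is_derive u w a a' -> is_derive u w b b' -> is_derive u w p p' ->
  is_derive u w q q' -> is_derive u w (fun u => mk4 (a u) (b u) (p u) (q u)) (mk4 a' b' p' q').
Proof.
move=> ca cb cp cq; apply: is_derive_row; apply: ord4P; rewrite mk4E.
- by rewrite (funext (fun u => mk4_0 (a u) (b u) (p u) (q u))).
- by rewrite (funext (fun u => mk4_1 (a u) (b u) (p u) (q u))).
- by rewrite (funext (fun u => mk4_2 (a u) (b u) (p u) (q u))).
- by rewrite (funext (fun u => mk4_3 (a u) (b u) (p u) (q u))).
Qed.

Lemma is_deriveDrow (V : normedModType R) (y z : V -> 'rV[R]_4) u w y' z' :
  is_derive u w y y' -> is_derive u w z z' ->
  is_derive u w (fun u => y u + z u) (y' + z').
Proof. by move=> dy dz; exact: is_deriveD. Qed.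

End Hamiltonian.

(** * Derivative of the integral of a primitive along moving fibre curves *)

Section FibreIntegral.
Variables (R : realType) (eps : R) (S : 'rV[R]_2 -> R) (Omega : 'rV[R]_4 -> 'M[R[i]]_4).
Hypothesis compatible_Omega : compatible eps S Omega.
Variables (V : set 'rV[R]_2) (k : 'rV[R]_4 -> 'rV[R[i]]_4).
Hypotheses (oV : open V) (V_disc : V `<=` disc eps).
Hypothesis smooth_k : forall i, csmooth_on (over V) (fun z => k z 0 i).
Hypothesis dk : forall z, over V z -> d1 k z = Omega z.

Definition imk (i : 'I_4) (z : 'rV[R]_4) : R := complex.Im (k z 0 i).

Lemma imk_smooth i : smooth_on (over V) (imk i).
Proof. by case: (smooth_k i). Qed.

Lemma d_imk i j z : over V z -> pd i (imk j) z - pd j (imk i) z = imO Omega i j z.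
Proof. by move=> oz; rewrite /imO -dk// mxE. Qed.

Variables (c0 v : 'rV[R]_2) (P1 P2 P1' P2' : R -> R).
Hypothesis V_c0 : V c0.
Hypotheses (dP1 : \forall u \near (0 : R), is_derive (u : R) 1 P1 (P1' u))
  (dP2 : \forall u \near (0 : R), is_derive (u : R) 1 P2 (P2' u)).
Hypotheses (cP1' : {for 0, continuous P1'}) (cP2' : {for 0, continuous P2'}).

(** Data of the strip over the line c0 + u v: [g] is the strip, [W] and [U] its s- and u-velocities,
    [Z] their common mixed derivative, and the z1-part of [Y] is the share of [U] due to the motion
    of c. *)
Let cu (u : R) : 'rV[R]_2 := u *: v + c0.
Let g u s : 'rV[R]_4 := T (mk4 (cu u 0 0) (cu u 0 1) (s * P1 u) (s * P2 u)).
Let W u s : 'rV[R]_4 := hamil (P1 u) (P2 u) (g u s).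
Let Y u s : 'rV[R]_4 := T (mk4 (v 0 0) (v 0 1) (s * P1 u) (s * P2 u)).
Let U u s : 'rV[R]_4 :=
  mk4 (Y u s 0 0) (Y u s 0 1) 0 0 + hamil (s * P1' u) (s * P2' u) (g u s).
Let Z u s : 'rV[R]_4 := hamil (P1' u) (P2' u) (g u s) + hamil (P1 u) (P2 u) (U u s).

(** [W] is tangent to the fibre, so neither H nor the variation of the times contributes to Im Omega
    (U, W), which is the same for every s. *)
Lemma fibre_integral_derive :
  is_derive (0 : R) 1 (fun u => \int[lebesgue_measure]_(s in `[0, 1])
     \sum_i imk i (g u s) * W u s 0 i)
   (\sum_i imk i (g 0 1) * (mk4 (v 0 0) (v 0 1) (1 * P1' 0) (1 * P2' 0) *m frame (g 0 1)) 0 i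
    - \sum_i imk i (g 0 0) * (mk4 (v 0 0) (v 0 1) (0 * P1' 0) (0 * P2' 0) *m frame (g 0 0)) 0 i
    + (v 0 1 * P1 0 - v 0 0 * P2 0)).
Proof.
have cuE u j : cu u 0 j = u * v 0 j + c0 0 j by rewrite !mxE.
have gU u s : U u s = mk4 (v 0 0) (v 0 1) (s * P1' u) (s * P2' u) *m frame (g u s).
  by rewrite mul_frame_T mk4_2 mk4_3.
have gW u s : W u s = mk4 0 0 (P1 u) (P2 u) *m frame (g u s) by rewrite -hamilE.
have Vcu : \forall u \near (0 : R), V (cu u).
  have ccu : {for 0, continuous cu}.
    apply: continuous_row => i; rewrite (funext (fun u => cuE u i)).
    exact: continuous_affine.
  apply: ccu; rewrite /cu scale0r add0r; exact: open_nbhs_nbhs.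
have pg u s : pican (g u s) = cu u.
  by rewrite pican_T; apply: row2_eq; rewrite !mk2E !mk4E.
have dcu (u : R) j : is_derive u 1 (fun u => cu u 0 j) (v 0 j).
  by rewrite (funext (fun u => cuE u j)); der; ring.
have dlin (s : R) (P : R -> R) (u P' : R) :
    is_derive u 1 P P' -> is_derive u 1 (fun u => s * P u) (s * P').
  by move=> dP; der; ring.
have dmul (r s : R) : is_derive s 1 (fun s => s * r) r by der; ring.
have dcst (r s : R) : is_derive s 1 (fun=> r) 0 by exact: is_derive_constr.
have dgu (u s : R) : is_derive (u : R) 1 P1 (P1' u) -> is_derive (u : R) 1 P2 (P2' u) ->
    is_derive u 1 (g ^~ s) (U u s).
  move=> h1 h2; rewrite gU; apply: is_derive_comp_T.
  exact: (is_derive_mk4 (dcu u 0) (dcu u 1) (dlin s _ _ _ h1) (dlin s _ _ _ h2)).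
have dgs (u s : R) : is_derive s 1 (g u) (W u s).
  rewrite gW; apply: is_derive_comp_T.
  exact: (is_derive_mk4 (dcst _ s) (dcst _ s) (dmul _ s) (dmul _ s)).
have dYs (u s : R) : is_derive s 1 (Y u) (hamil (P1 u) (P2 u) (Y u s)).
  rewrite hamilE; apply: is_derive_comp_T.
  exact: (is_derive_mk4 (dcst _ s) (dcst _ s) (dmul _ s) (dmul _ s)).
have dUs (u s : R) : is_derive s 1 (U u) (Z u s).
  have d0 := is_derive_coord 0 (dYs u s); have d1 := is_derive_coord 1 (dYs u s).
  have dY4 := is_derive_mk4 d0 d1 (dcst 0 s) (dcst 0 s).
  have dH := is_derive_hamil (dmul (P1' u) s) (dmul (P2' u) s) (dgs u s).
  eapply is_derive_eq; first exact: (is_deriveDrow dY4 dH).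
  rewrite /Z /W /U /hamil; move: (g u s) (Y u s) => y z {d0 d1 dY4 dH}.
  apply: row4_eq; rewrite !mxE /=; ring.
have nP1 := nbhs_singleton dP1; have nP2 := nbhs_singleton dP2.
have VO (u s : R) : V (cu u) -> over V (g u s) by rewrite /over /= pg.
apply: is_derive_eqr (@derive_line_family R 3 (over V) imk g U W Z 0
  (v 0 1 * P1 0 - v 0 0 * P2 0) (open_over oV) _ _ _ _ _ _ _) _.
- by move=> i z oz; exact: (smooth_on_differentiable (imk_smooth i) oz).
- move=> i j z oz; apply: differentiable_continuousr.
  exact: (smooth_on_differentiable (@smooth_on_pdr _ _ _ _ j (imk_smooth i)) oz).
- apply: filterS3 Vcu dP1 dP2 => u Vu h1 h2 s _; split.
  + exact: VO.
  + exact: dgu.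
  + exact: dgs.
  + exact: (is_derive_hamil h1 h2 (dgu u s h1 h2)).
- near=> u => s _; apply: continuous_hamil; [exact: continuous_cstr..|].
  by apply: differentiable_continuous; apply/derivable1_diffP; case: (dgs u s).
- move=> s _.
  have f1 (F : R -> R) : {for 0, continuous F} ->
      {for ((0 : R), s), continuous (fun p : R * R => F p.1)}.
    by move=> cF; apply: continuous_compr; [exact: cF|exact: continuous_fstr].
  have cs : {for ((0 : R), s), continuous (fun p : R * R => p.2)} by exact: continuous_sndr.
  have c1 := f1 _ (is_derive_continuous nP1); have c2 := f1 _ (is_derive_continuous nP2).
  have c1' := f1 _ cP1'; have c2' := f1 _ cP2'.
  have ccu j := f1 _ (is_derive_continuous (dcu 0 j)).
  have cst r : {for ((0 : R), s), continuous (fun _ : R * R => r : R)} by exact: continuous_cstr.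
  have cg : {for ((0 : R), s), continuous (fun p : R * R => g p.1 p.2)}.
    exact: (continuousT (continuous_mk4 (ccu 0) (ccu 1) (continuousMr cs c1) (continuousMr cs c2))).
  have cY : {for ((0 : R), s), continuous (fun p : R * R => Y p.1 p.2)}.
    exact: (continuousT (continuous_mk4 (cst _) (cst _) (continuousMr cs c1) (continuousMr cs c2))).
  have cU : {for ((0 : R), s), continuous (fun p : R * R => U p.1 p.2)}.
    exact: (continuousDrow (continuous_mk4 (continuous_coordr cY) (continuous_coordr cY)
      (cst _) (cst _)) (continuous_hamil (continuousMr cs c1') (continuousMr cs c2') cg)).
  split; [exact: cg|exact: cU|exact: (continuous_hamil c1 c2 cg)|].
  exact: (continuousDrow (continuous_hamil c1' c2' cg) (continuous_hamil c1 c2 cU)).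
- move=> s _.
  have o0 : over V (g 0 s) by apply: VO; exact: nbhs_singleton Vcu.
  have od : over (disc eps) (g 0 s) by exact: V_disc.
  transitivity (\sum_i \sum_j (mk4 (v 0 0) (v 0 1) (s * P1' 0) (s * P2' 0) *m frame (g 0 s)) 0 i
    * (mk4 0 0 (P1 0) (P2 0) *m frame (g 0 s)) 0 j * imO Omega i j (g 0 s)).
    apply: eq_bigr => i _; apply: eq_bigr => j _.
    by rewrite -gU -gW d_imk.
  rewrite (imO_frame compatible_Omega)//; last exact: z2_T.
  by rewrite !mk4E; ring.
- by rewrite -!gU.
Unshelve. all: by end_near. Qed.

End FibreIntegral.
Lemma near_is_derive (R : realType) (V : normedModType R) (f g : V -> R) x v df :
  (\near x, f x = g x) -> is_derive x v g df -> is_derive x v f df.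
Proof.
move=> fg dg; have [v0|v0] := eqVneq v 0.
  have := is_derive_unique dg; rewrite v0 => /(_ _ (is_derive0 _ _)) ->.
  exact: is_derive0.
by apply: near_eq_is_derive dg; rewrite // ; apply: filterS fg => y ->.
Qed.

(** * Closing of the cycles and differentials of the actions *)

Section ActionIntegrals.
Variables (R : realType) (eps : R) (S : 'rV[R]_2 -> R) (Omega : 'rV[R]_4 -> 'M[R[i]]_4).
Implicit Types (c v : 'rV[R]_2).
Hypothesis smooth_S : smooth_on setT S.
Hypothesis compatible_Omega : compatible eps S Omega.

(** Common shape of both cycles, straight in the times (t1, t2): [gamma_m] has p = (per1, per2), and
    [gamma_e] has p = (0, 2 pi) once [s * 0] is simplified. *)
Definition fibre_curve (p1 p2 : 'rV[R]_2 -> R) c (s : R) : 'rV[R]_4 :=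
  T (mk4 (c 0 0) (c 0 1) (s * p1 c) (s * p2 c)).

Lemma is_derive_fibre_curve_s p1 p2 c (s : R) :
  is_derive s 1 (fibre_curve p1 p2 c) (hamil (p1 c) (p2 c) (fibre_curve p1 p2 c s)).
Proof.
rewrite hamilE; apply: is_derive_comp_T.
have dmul (r : R) : is_derive s 1 (fun s => s * r) r by der; ring.
exact: (is_derive_mk4 (is_derive_constr _ s 1) (is_derive_constr _ s 1) (dmul _) (dmul _)).
Qed.

Lemma is_derive_fibre_curve p1 p2 c v (s d1 d2 : R) :
  is_derive c v p1 d1 -> is_derive c v p2 d2 ->
  is_derive c v (fun c => fibre_curve p1 p2 c s)
    (mk4 (v 0 0) (v 0 1) (s * d1) (s * d2) *m frame (fibre_curve p1 p2 c s)).
Proof.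
move=> h1 h2; apply: is_derive_comp_T.
have dlin (p : 'rV[R]_2 -> R) d : is_derive c v p d -> is_derive c v (fun c => s * p c) (s * d).
  by move=> dp; der; ring.
exact: (is_derive_mk4 (is_derive_coordr c v 0) (is_derive_coordr c v 1)
  (dlin _ _ h1) (dlin _ _ h2)).
Qed.

Lemma Im_line_integral (k : 'rV[R]_4 -> 'rV[R[i]]_4) (g W : R -> 'rV[R]_4) :
  (forall s : R, is_derive s 1 g (W s)) ->
  complex.Im (line_integral k g) =
  \int[lebesgue_measure]_(s in `[0, 1]) \sum_i imk k i (g s) * W s 0 i.
Proof.
move=> dg; apply: eq_Rintegral => s _.
rewrite derive1E; have [_ ->] := dg s.
by rewrite mxE !sum4 !ImD !mxE ![k _ _ _ * _]mulrC !ImZ ![W _ _ _ * _]mulrC.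
Qed.

(** Near each point Z is an integral of a primitive up to a constant, which differentiation removes.
    The hypothesis on [u1] and [u0] is the cancellation of the two boundary terms, proved separately
    for each cycle. *)
Lemma action_derive (p1 p2 : 'rV[R]_2 -> R) (dp1 dp2 : 'rV[R]_2 -> 'rV[R]_2 -> R)
    (D : set 'rV[R]_2) (Z : 'rV[R]_2 -> R[i]) :
  open D -> D `<=` disc eps ->
  (forall c v, D c -> is_derive c v p1 (dp1 v c) /\ is_derive c v p2 (dp2 v c)) ->
  (forall c v, D c -> {for c, continuous (dp1 v)} /\ {for c, continuous (dp2 v)}) ->
  (forall V k c v u1 u0, open V -> V c -> V `<=` D -> one_form_over S V k ->
    is_derive c v (fun c => fibre_curve p1 p2 c 1) u1 ->
    is_derive c v (fun c => fibre_curve p1 p2 c 0) u0 ->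
    \sum_i imk k i (fibre_curve p1 p2 c 1) * u1 0 i =
    \sum_i imk k i (fibre_curve p1 p2 c 0) * u0 0 i) ->
  action_integral S Omega (fibre_curve p1 p2) D Z ->
  forall c v, D c ->
    is_derive c v (fun c => complex.Im (Z c)) ((2 * pi)^-1 * (v 0 1 * p1 c - v 0 0 * p2 c)).
Proof.
move=> oD Dd dp cdp bd hZ c v Dc.
have [V [k [a [oV Vc VD hk [dk ZE]]]]] := hZ c Dc.
have cE (u : R) i : (u *: v + c) 0 i = u * v 0 i + c 0 i by rewrite !mxE.
have cuc : {for (0 : R), continuous (fun u : R => u *: v + c)}.
  apply: continuous_row => i; rewrite (funext (fun u => cE u i)).
  exact: continuous_affine.
have cu0 : 0 *: v + c = c by rewrite scale0r add0r.
have Vu : \forall u \near (0 : R), V (u *: v + c).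
  by apply: cuc; rewrite cu0; exact: open_nbhs_nbhs.
have dP (p : 'rV[R]_2 -> R) (d : 'rV[R]_2 -> 'rV[R]_2 -> R) :
    (forall c v, D c -> is_derive c v p (d v c)) ->
    \forall u \near (0 : R), is_derive (u : R) 1 (fun u : R => p (u *: v + c)) (d v (u *: v + c)).
  move=> h; apply: filterS Vu => u /VD Du; apply: is_derive_line; exact: h.
have cP (d : 'rV[R]_2 -> 'rV[R]_2 -> R) : {for c, continuous (d v)} ->
    {for (0 : R), continuous (fun u : R => d v (u *: v + c))}.
  by move=> h; apply: (continuous_compr (F := d v)); rewrite ?cu0.
have [ck1 ck2] := hk.
have F := fibre_integral_derive compatible_Omega oV (subset_trans VD Dd) ck1 dk v Vc
  (dP p1 dp1 (fun c v Dc => (dp c v Dc).1)) (dP p2 dp2 (fun c v Dc => (dp c v Dc).2))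
  (cP _ (cdp c v Dc).1) (cP _ (cdp c v Dc).2).
have [h1 h2] := dp c v Dc.
have B := bd V k c v _ _ oV Vc VD hk
  (is_derive_fibre_curve 1 h1 h2) (is_derive_fibre_curve 0 h1 h2).
have {}F : is_derive c v (fun c => complex.Im (line_integral k (fibre_curve p1 p2 c)))
    (v 0 1 * p1 c - v 0 0 * p2 c).
  apply/derive1_line.
  rewrite (funext (fun u : R => Im_line_integral k (is_derive_fibre_curve_s p1 p2 (u *: v + c)))).
  apply: is_derive_eqr F _.
  rewrite !cu0; move: B; rewrite /fibre_curve => ->.
  by rewrite subrr add0r.
move: F; set G := (fun c => complex.Im (line_integral k _)) => F.
have dG := is_deriveDr (is_derive_constr (complex.Im a) c v)
  (is_deriveMr (is_derive_constr (2 * pi)^-1 c v) F).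
apply: (near_is_derive (g := fun y => complex.Im a + (2 * pi)^-1 * G y)).
  apply: filterS (open_nbhs_nbhs (conj oV Vc)) => y Vy.
  by rewrite ZE// ImD ImZ.
by apply: is_derive_eqr dG _; rewrite add0r mulr0 addr0.
Qed.

Lemma fibre_curve0 p1 p2 c : fibre_curve p1 p2 c 0 = slice c.
Proof. by rewrite /fibre_curve !mul0r T_0. Qed.

Section Branch.
Variables (D : set 'rV[R]_2) (arg : 'rV[R]_2 -> R).
Hypothesis arg_D : arg_branch eps D arg.

(** The endpoint of gamma_m is glued to its starting point, since psi subtracts the first lattice
    generator from the times. *)
Lemma psi_period c : D c ->
  psi S (fibre_curve (per1 S) (per2 S arg) c 1) = slice c.
Proof.
move=> Dc; rewrite /fibre_curve !mul1r.
have z2E : z2 (T (mk4 (c 0 0) (c 0 1) (per1 S c) (per2 S arg c))) =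
    cexp (per1 S c -i* per2 S arg c)%C.
  by rewrite z2_mkC2 mk4_2 mk4_3.
have piE : pican (T (mk4 (c 0 0) (c 0 1) (per1 S c) (per2 S arg c))) = c.
  by rewrite pican_T base_mk4.
move: (T _) z2E piE => z z2E piE.
have z0 : z2 z != 0 by rewrite z2E cexp_neq0.
have LnE : cexp (Ln arg c) = toC c.
  have [_ _ Dp H] := arg_D; have [_ ->] := H c Dc; have [_ c0] := Dp c Dc.
  by rewrite /cexp /Ln /= lnK ?posrE ?modulus_gt0.
(* The exponent of psi is the period plus ln c; the period cancels against z2 and e^(ln c) = c is
   what remains. *)
have wE : (S1 S c -i* S2 S c)%C = (per1 S c -i* per2 S arg c)%C + Ln arg c.
  apply/eqP; rewrite eq_complex /= /per1 /per2; apply/andP; split; apply/eqP; ring.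
have sE : slice c = mkC2 (toC c) 1 by apply: row4_eq; rewrite ?mkC2E ?mk4E.
rewrite sE /psi piE wE cexpD LnE -z2E; congr mkC2.
  by rewrite mulrAC divff// mul1r.
rewrite -mulrA expr2 (mulrA (z1 z)) -toC_pican piE -LnE z2E.
by rewrite (mulrC (cexp (Ln arg c))) -cexpD addrC cexpN.
Qed.

(** Differentiating [psi_period] in c shows that psi carries the velocity of the endpoint to that of
    the section; invariance of k under psi then equates its values on the two velocities. *)
Lemma boundary_gm V k c v u1 u0 : open V -> V c -> V `<=` D -> one_form_over S V k ->
  is_derive c v (fun c => fibre_curve (per1 S) (per2 S arg) c 1) u1 ->
  is_derive c v (fun c => fibre_curve (per1 S) (per2 S arg) c 0) u0 ->
  \sum_i imk k i (fibre_curve (per1 S) (per2 S arg) c 1) * u1 0 i =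
  \sum_i imk k i (fibre_curve (per1 S) (per2 S arg) c 0) * u0 0 i.
Proof.
move=> oV Vc VD [_ inv] d1 d0.
set sg := (fun c => fibre_curve (per1 S) (per2 S arg) c 1) in d1 *.
have z0 : z2 (sg c) != 0 by exact: z2_T.
have osg : over V (sg c) by rewrite /over /= /sg /fibre_curve pican_T base_mk4.
rewrite fibre_curve0; rewrite (funext (fibre_curve0 _ _)) in d0.
have J j := is_derive_jacobian j d1 (differentiable_psi smooth_S z0).
have nE : \forall y \near c, psi S (sg y) = slice y.
  by apply: filterS (open_nbhs_nbhs (conj oV Vc)) => y /VD; exact: psi_period.
have uE j : u0 0 j = \sum_i u1 0 i * jacobian (psi S) (sg c) i j.
  apply: is_derive_unique (J j).
  apply: (near_is_derive (g := fun y => slice y 0 j)); last exact: is_derive_coord.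
  by apply: filterS nE => y ->.
have kE i : imk k i (sg c) = \sum_j jacobian (psi S) (sg c) i j * imk k j (slice c).
  rewrite -(nbhs_singleton nE) {1}/imk -(inv _ osg z0) mxE !sum4 !ImD.
  by rewrite !mxE ![k _ _ _ * _]mulrC !ImZ.
under eq_bigr do rewrite kE mulr_suml.
rewrite exchange_big/=; apply: eq_bigr => j _; rewrite uE mulr_sumr.
by apply: eq_bigr => i _; ring.
Qed.

End Branch.

Lemma fibre_curve_e c : fibre_curve (fun=> 0) (fun=> 2 * pi) c 1 = slice c.
Proof.
rewrite /fibre_curve mulr0 mul1r; apply: row4_eq.
- by rewrite T0 !mk4E oppr0 expR0 mulr_natl cos2pi sin2pi; ring.
- by rewrite T1 !mk4E oppr0 expR0 mulr_natl cos2pi sin2pi; ring.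
- by rewrite T2 !mk4E expR0 mulr_natl cos2pi; ring.
- by rewrite T3 !mk4E expR0 mulr_natl sin2pi; ring.
Qed.

(** gamma_e closes up in C^2 itself, the second flow being 2 pi-periodic, so both boundary terms
    coincide without the gluing. *)
Lemma boundary_ge (k : 'rV[R]_4 -> 'rV[R[i]]_4) c v u1 u0 :
  is_derive c v (fun c => fibre_curve (fun=> 0) (fun=> 2 * pi) c 1) u1 ->
  is_derive c v (fun c => fibre_curve (fun=> 0) (fun=> 2 * pi) c 0) u0 ->
  \sum_i imk k i (fibre_curve (fun=> 0) (fun=> 2 * pi) c 1) * u1 0 i =
  \sum_i imk k i (fibre_curve (fun=> 0) (fun=> 2 * pi) c 0) * u0 0 i.
Proof.
rewrite fibre_curve0 fibre_curve_e (funext (fibre_curve0 _ _)) (funext fibre_curve_e).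
by move=> d1 d0; rewrite (is_derive_unique d1 d0).
Qed.

End ActionIntegrals.

(** * Closed forms of the action integrals *)

Section ActionForms.
Variables (R : realType) (eps : R) (S : 'rV[R]_2 -> R) (Omega : 'rV[R]_4 -> 'M[R[i]]_4).
Implicit Types (c v : 'rV[R]_2).
Hypothesis smooth_S : smooth_on setT S.
Hypothesis eps_gt0 : 0 < eps.
Hypothesis compatible_Omega : compatible eps S Omega.
Variables (D : set 'rV[R]_2) (arg : 'rV[R]_2 -> R).
Hypothesis arg_D : arg_branch eps D arg.
Local Notation s1 := (S1 S).
Local Notation s2 := (S2 S).

Lemma Im_Z_gm_derive (Z : 'rV[R]_2 -> R[i]) c v :
  action_integral S Omega (gamma_m S arg) D Z -> D c ->
  is_derive c v (fun c => complex.Im (Z c))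
    ((2 * pi)^-1 * (v 0 1 * per1 S c - v 0 0 * per2 S arg c)).
Proof.
move=> hZ Dc; have [oD _ _ _] := arg_D.
have Dd y : D y -> disc eps y by move=> Dy; exact: (arg_branch_disc arg_D Dy).
have D0 y : D y -> y != 0 by move=> Dy; exact: (arg_branch_neq0 arg_D Dy).
have cpd (f : 'rV[R]_2 -> R) (i : 'I_2) y :
    smooth_on setT f -> {for y, continuous (pd i f)}.
  by move=> sf; apply: differentiable_continuousr; exact: (sf [:: i]).
have sm1 : smooth_on setT s1 by exact: smooth_on_pdr.
have sm2 : smooth_on setT s2 by exact: smooth_on_pdr.
have cm y : y != 0 -> {for y, continuous (fun y : 'rV[R]_2 => (modulus y ^+ 2)^-1)}.
  move=> y0; apply: continuousVr; first by rewrite lt0r_neq0// exprn_gt0// modulus_gt0.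
  by apply: continuousXr; exact: modulus_continuous.
have cc (i : 'I_2) (y : 'rV[R]_2) : {for y, continuous (fun y : 'rV[R]_2 => y 0 i)}.
  exact: coord_continuous.
have cr (r : R) (y : 'rV[R]_2) : {for y, continuous (fun _ : 'rV[R]_2 => r)}.
  exact: continuous_cstr.
apply: (@action_derive R eps S Omega compatible_Omega (per1 S) (per2 S arg)
  (fun v c => v 0 0 * pd 0 s1 c + v 0 1 * pd 1 s1 c
     - (c 0 0 * v 0 0 + c 0 1 * v 0 1) / modulus c ^+ 2)
  (fun v c => v 0 0 * pd 0 s2 c + v 0 1 * pd 1 s2 c
     + (c 0 0 * v 0 1 - c 0 1 * v 0 0) / modulus c ^+ 2) D Z oD Dd _ _ _ hZ c v Dc).
- move=> y w Dy; split; first exact: (is_derive_per1 smooth_S w (D0 y Dy)).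
  exact: (is_derive_per2 smooth_S arg_D w Dy).
- move=> y w Dy; split.
  + apply: continuousBr; first apply: continuousDr.
    * exact: (continuousMr (cr _ _) (cpd _ 0 y sm1)).
    * exact: (continuousMr (cr _ _) (cpd _ 1 y sm1)).
    * apply: (continuousMr _ (cm y (D0 y Dy))).
      exact: (continuousDr (continuousMr (cc 0 y) (cr _ y)) (continuousMr (cc 1 y) (cr _ y))).
  + apply: continuousDr; first apply: continuousDr.
    * exact: (continuousMr (cr _ _) (cpd _ 0 y sm2)).
    * exact: (continuousMr (cr _ _) (cpd _ 1 y sm2)).
    * apply: (continuousMr _ (cm y (D0 y Dy))).
      exact: (continuousBr (continuousMr (cc 0 y) (cr _ y)) (continuousMr (cc 1 y) (cr _ y))).
- move=> V k y w u1 u0 oV Vy VD hk; exact: (boundary_gm smooth_S arg_D oV Vy VD hk).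
Qed.

Lemma gamma_e_fibre : @gamma_e R = fibre_curve (fun=> 0) (fun=> 2 * pi).
Proof. by apply: funext => c; apply: funext => s; rewrite /fibre_curve mulr0. Qed.

Lemma Im_Z_ge_derive (Z : 'rV[R]_2 -> R[i]) c v :
  action_integral S Omega (@gamma_e R) D Z -> D c ->
  is_derive c v (fun c => complex.Im (Z c)) (- v 0 0).
Proof.
rewrite gamma_e_fibre => hZ Dc; have [oD _ _ _] := arg_D.
have Dd y : D y -> disc eps y by move=> Dy; exact: (arg_branch_disc arg_D Dy).
have H := @action_derive R eps S Omega compatible_Omega (fun=> 0) (fun=> 2 * pi)
  (fun _ _ => 0) (fun _ _ => 0) D Z oD Dd _ _ _ hZ c v Dc.
apply: is_derive_eqr (H _ _ _) _.
- by move=> y w _; split; exact: is_derive_constr.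
- by move=> y w _; split; exact: continuous_cstr.
- by move=> V k y w u1 u0 _ _ _ _; exact: boundary_ge.
- by rewrite mulr0 sub0r mulrN mulrCA mulVf ?mulr1 ?two_pi_neq0.
Qed.

Lemma constant_on_branch (f : 'rV[R]_2 -> R) :
  (forall c v, D c -> is_derive c v f 0) -> exists b, forall c, D c -> f c = b.
Proof.
move=> df; have [oD cD _ _] := arg_D.
(* A branch domain may be empty, in which case any constant will do. *)
have [[p Dp]|nD] := pselect (D !=set0).
  by exists (f p) => c Dc; apply: (is_derive0_constant oD cD df).
by exists 0 => c Dc; exfalso; apply: nD; exists c.
Qed.

Lemma Z_gm_form (Z : 'rV[R]_2 -> R[i]) :
  action_integral S Omega (gamma_m S arg) D Z ->
  (forall c, D c -> complex.Re (Z c) = z_gm S arg c) ->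
  exists St : 'rV[R]_2 -> R, harmonic_conjugate (disc eps) S St /\
    forall c, D c -> Z c = Z_gm S arg St c.
Proof.
move=> hZ ReZ.
have hS c : disc eps c -> pd 0 s1 c + pd 1 s2 c = 0.
  exact: (S_laplace smooth_S compatible_Omega eps_gt0).
have mS c : disc eps c -> pd 0 s2 c = pd 1 s1 c.
  exact: (S_mixed smooth_S compatible_Omega).
have [St dSt] := harmonic_conjugate_exists smooth_S hS eps_gt0.
(* Both imaginary parts have differential (per1 dc2 - per2 dc1) / 2 pi, and D is connected. *)
have [b bE] : exists b, forall c, D c ->
    complex.Im (Z c) - complex.Im (Z_gm S arg St c) = b.
  apply: constant_on_branch => c v Dc.
  have d1 := Im_Z_gm_derive v hZ Dc.
  have d2 : is_derive c v (fun c => complex.Im (Z_gm S arg St c))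
      ((2 * pi)^-1 * (per1 S c * v 0 1 - per2 S arg c * v 0 0)).
    apply: (is_derive_Im_Z_gm arg_D Dc).
    apply: is_derive_eqr (dSt c v (arg_branch_disc arg_D Dc)) _.
    by rewrite sum2 /conj_form /= mulrN mulNr.
  by apply: is_derive_eqr (is_deriveBr d1 d2) _; ring.
(* The factor 2 pi compensates the division by 2 pi in [Z_gm]; adding a constant preserves harmonic
   conjugacy. *)
exists (fun c => St c + 2 * pi * b); split.
  apply: (harmonic_conjugateP smooth_S mS) => c v dc.
  apply: is_derive_eqr (is_deriveDr (dSt c v dc) (is_derive_constr _ c v)) _.
  by rewrite addr0.
move=> c Dc; apply/eqP; rewrite eq_complex; apply/andP; split; apply/eqP.
  by rewrite ReZ// /z_gm /Z_gm /=; ring.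
have -> : complex.Im (Z c) = b + complex.Im (Z_gm S arg St c) by rewrite -(bE c Dc) subrK.
rewrite -{1}(mulKf (two_pi_neq0 R) b) /Z_gm /=; ring.
Qed.

Lemma Z_ge_form (Z : 'rV[R]_2 -> R[i]) :
  action_integral S Omega (@gamma_e R) D Z ->
  (forall c, D c -> complex.Re (Z c) = z_ge c) ->
  exists b : R, action_integral S Omega (@gamma_e R) D (fun c => Z c - (0 +i* b)%C) /\
    forall c, D c -> Z c - (0 +i* b)%C = Z_ge c.
Proof.
move=> hZ ReZ.
have [b bE] : exists b, forall c, D c -> complex.Im (Z c) + c 0 0 = b.
  apply: constant_on_branch => c v Dc.
  apply: is_derive_eqr (is_deriveDr (Im_Z_ge_derive v hZ Dc) (is_derive_coordr c v 0)) _.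
  by rewrite addNr.
exists b; split.
  move=> c0 Dc0; have [V [k [a [oV Vc VD hk [dk ZE]]]]] := hZ c0 Dc0.
  (* The shift is absorbed by the free constant in the notion of action integral. *)
  exists V, k, (a - (0 +i* b)%C); split=> //; split=> // c Vc'.
  by rewrite ZE// addrAC.
move=> c Dc; apply/eqP; rewrite eq_complex; apply/andP; split; apply/eqP.
  by move: (ReZ c Dc); rewrite /Z_ge /z_ge /=; case: (Z c) => x y /= ->; ring.
by move: (bE c Dc); rewrite /Z_ge /=; case: (Z c) => x y /= <-; ring.
Qed.

End ActionForms.
Theorem corollary4p3 (R : realType) (eps : R) (S : 'rV[R]_2 -> R)
    (Omega : 'rV[R]_4 -> 'M[R[i]]_4)
    (heps : 0 < eps < 1) (hS : smooth_on setT S) (hS0 : S 0 = 0)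
    (hOmega : compatible eps S Omega) :
  [/\ harmonic_on (disc eps) S,
      forall (D : set 'rV[R]_2) (arg : 'rV[R]_2 -> R), arg_branch eps D arg ->
      forall Zm Ze : 'rV[R]_2 -> R[i],
        action_integral S Omega (gamma_m S arg) D Zm ->
        action_integral S Omega (@gamma_e R) D Ze ->
        (forall c, D c -> complex.Re (Zm c) = z_gm S arg c) ->
        (forall c, D c -> complex.Re (Ze c) = z_ge c) ->
        (exists St : 'rV[R]_2 -> R, harmonic_conjugate (disc eps) S St /\
           forall c, D c -> Zm c = Z_gm S arg St c) /\
        (exists b : R,
           action_integral S Omega (@gamma_e R) D (fun c => Ze c - (0 +i* b)%C) /\
           forall c, D c -> Ze c - (0 +i* b)%C = Z_ge c)
    & (exists2 h : 'rV[R]_2 -> R, smooth_on (disc eps) h &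
         forall (D : set 'rV[R]_2) (arg : 'rV[R]_2 -> R), arg_branch eps D arg ->
         forall St : 'rV[R]_2 -> R, harmonic_conjugate (disc eps) S St ->
         forall x : 'rV[R]_4, D (base x) ->
           pull2 (@T R) Omega x
           = wedge11 (d0 (fun y => Z_gm S arg St (base y)) x) (dtheta_ge S x)
             + wedge11 (d0 (fun y => Z_ge (base y)) x) (dtheta_gm S arg x)
             + ('i%C * ((h (base x))%:C)%C) *: wedge11 (dc1 x) (dc2 x)) /\
      (forall c, pdisc eps c -> ln (modulus c) < S1 S c)].
Proof.
have /andP[eps_gt0 _] := heps.
have harm := S_harmonic hS hOmega eps_gt0.
split=> //.
- move=> D arg hD Zm Ze hZm hZe ReZm ReZe; split.
    exact: (Z_gm_form hS eps_gt0 hOmega hD hZm ReZm).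
  exact: (Z_ge_form hOmega hD hZe ReZe).
- split.
    (* The coefficient on the section is fixed before any branch of arg or harmonic conjugate is
       chosen, so one h serves all of them. *)
    exists (hcoef Omega); first exact: (hcoef_smooth hOmega).
    move=> D arg hD St hSt x Dx.
    exact: (pull2_T_decomposition hS eps_gt0 hOmega hD hSt Dx).
  by move=> c pc; have := per1_gt0 hOmega pc; rewrite subr_gt0.
Qed.
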